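(* Let $\mathcal{F}$ be the set of all continuous functions $v:\overline\Omega\to\mathbb{R}$ that are infinity superharmonic in $\Omega$ and satisfy $v\ge\Psi$ in $\Omega$ and $v=F$ on $\partial\Omega$. Then $u_\infty$ is the smallest element of $\mathcal{F}$; that is, $u_\infty\in\mathcal{F}$ and $u_\infty\le v$ in $\overline\Omega$ for every $v\in\mathcal{F}$.
   Context: Setting: $\Omega\subset\mathbb{R}^d$ is a bounded smooth domain, $F$ is a Lipschitz function on $\partial\Omega$, and $\Psi:\overline\Omega\to\mathbb{R}$ is a continuous obstacle with $\sup_{\partial\Omega}\Psi<\inf_{\partial\Omega}F$. For $1<p<\infty$, $u_p$ denotes the unique minimizer of $\int_\Omega|Dv|^p\,dx$ among all $v\in W^{1,p}(\Omega)$ with trace $F$ on $\partial\Omega$ and $v\ge\Psi$ in $\Omega$. The function $u_\infty$ denotes a limit of $u_{p_j}$ along a sequence $p_j\to\infty$, the convergence being locally uniform in $\overline\Omega$ and weak in $W^{1,q}(\Omega)$ for every finite $q>1$ (such subsequential limits exist). The infinity Laplacian is $\Delta_\infty u=\sum_{i,j=1}^d u_{x_i}u_{x_j}u_{x_ix_j}$. A function $v$ is infinity superharmonic in $\Omega$ if $-\Delta_\infty v\ge0$ in $\Omega$ in the viscosity sense, i.e. whenever $\varphi\in C^2$ touches $v$ from below at $x\in\Omega$, then $-\Delta_\infty\varphi(x)\ge0$. *)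

(* Defs.v *)
From HB Require Import structures.
From mathcomp Require Import all_boot all_order all_algebra.
From mathcomp Require Import all_classical all_reals all_analysis.
Set Implicit Arguments.
Unset Strict Implicit.
Unset Printing Implicit Defensive.
Import Order.TTheory GRing.Theory Num.Theory.
Import numFieldNormedType.Exports.
Local Open Scope classical_set_scope.
Local Open Scope ring_scope.

Section row_vector_sigma_algebra.
Context {R : realType} (n : nat).

Let coord (i : 'I_n) (x : 'rV[R]_n) : R := x 0 i.

Let rV_set0 : g_sigma_preimage coord set0.
Proof. exact: sigma_algebra0. Qed.

Let rV_setC A : g_sigma_preimage coord A -> g_sigma_preimage coord (~` A).
Proof. exact: sigma_algebraC. Qed.

Let rV_bigcup (F : _^nat) : (forall i, g_sigma_preimage coord (F i)) ->
  g_sigma_preimage coord (\bigcup_i (F i)).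
Proof. exact: sigma_algebra_bigcup. Qed.

HB.instance Definition _ := @isMeasurable.Build default_measure_display
  'rV[R]_n (g_sigma_preimage coord) rV_set0 rV_setC rV_bigcup.

Lemma measurable_rV_coord (i : 'I_n) :
  measurable_fun [set: 'rV[R]_n] (fun x : 'rV[R]_n => x 0 i).
Proof.
move=> _ Y mY; rewrite setTI; apply: sub_sigma_algebra => /=.
rewrite -bigcup_seq/=; exists i => /=; first by rewrite mem_index_enum.
by exists Y => //; rewrite setTI.
Qed.

Lemma measurable_fun_rVP d (T : measurableType d) (f : T -> 'rV[R]_n) :
  (forall i, measurable_fun [set: T] (fun x => f x 0 i)) ->
  measurable_fun [set: T] f.
Proof.
move=> mf _ A mA; rewrite setTI.
pose G : set_system 'rV[R]_n := [set B | measurable (f @^-1` B)].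
suff : @measurable _ 'rV[R]_n `<=` G by exact.
apply: smallest_sub.
  split; rewrite /G/=.
  - by rewrite preimage_set0; exact: measurable0.
  - by move=> B mB; rewrite setTD preimage_setC; exact: measurableC.
  - by move=> F mF; rewrite preimage_bigcup; exact: bigcup_measurable.
move=> B; rewrite -bigcup_seq/= => -[i _ [C mC <-]].
by rewrite /G/= setTI; have := mf i measurableT C mC; rewrite setTI.
Qed.

End row_vector_sigma_algebra.

Section lebesgue_rV.
Context {R : realType}.

Definition rV_cons n (tx : measurableTypeR R * 'rV[R]_n) : 'rV[R]_n.+1 :=
  row_mx (tx.1%:M : 'rV[R]_1) tx.2.

Definition rV_uncons n (x : 'rV[R]_n.+1) : measurableTypeR R * 'rV[R]_n :=
  (x 0 ord0, \row_i x 0 (lift ord0 i)).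

Lemma rV_cons0 n tx : @rV_cons n tx 0 ord0 = tx.1.
Proof.
rewrite /rV_cons; have -> : ord0 = lshift n (ord0 : 'I_1) by apply/val_inj.
by rewrite (@row_mxEl _ 1 1 n) !mxE eqxx mulr1n.
Qed.

Lemma rV_consS n tx i : @rV_cons n tx 0 (lift ord0 i) = tx.2 0 i.
Proof.
rewrite /rV_cons; have -> : lift ord0 i = rshift 1 i by apply/val_inj.
by rewrite (@row_mxEr _ 1 1 n).
Qed.

Lemma rV_unconsK n : cancel (@rV_uncons n) (@rV_cons n).
Proof.
move=> x; apply/rowP => i; case: (unliftP ord0 i) => [j|] ->.
  by rewrite rV_consS mxE.
by rewrite rV_cons0.
Qed.

Lemma rV_consK n : cancel (@rV_cons n) (@rV_uncons n).
Proof.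
move=> [t x]; rewrite /rV_uncons rV_cons0; congr pair.
by apply/rowP => i; rewrite mxE rV_consS.
Qed.

Lemma measurable_rV_cons n : measurable_fun setT (@rV_cons n).
Proof.
apply: measurable_fun_rVP => i; case: (unliftP ord0 i) => [j|] ->.
  rewrite (_ : (fun _ => _) = (fun y : 'rV[R]_n => y 0 j) \o snd); last first.
    by apply/funext => tx /=; rewrite rV_consS.
  by apply: measurableT_comp => //; exact: measurable_rV_coord.
rewrite (_ : (fun _ => _) = fst)//.
by apply/funext => tx /=; rewrite rV_cons0.
Qed.

Lemma measurable_rV_uncons n : measurable_fun setT (@rV_uncons n).
Proof.
apply/measurable_fun_pairP; split => /=; first exact: measurable_rV_coord.
apply: measurable_fun_rVP => i /=.
rewrite (_ : (fun _ => _) = fun x : 'rV[R]_n.+1 => x 0 (lift ord0 i)).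
  exact: measurable_rV_coord.
by apply/funext => x; rewrite mxE.
Qed.

End lebesgue_rV.

(* One step of the recursion: the measure [lebesgue_measure \x mu] on
   [R * R^n], carried to [R^(n+1)]. *)
Section lebesgue_rV_step.
Context {R : realType} (n : nat).
Variable mu : {sigma_finite_measure set 'rV[R]_n -> \bar R}.

Definition lebesgue_rV_step : set 'rV[R]_n.+1 -> \bar R :=
  pushforward (@lebesgue_measure R \x mu)%E (@rV_cons R n).

Let mcons := @measurable_rV_cons R n.

Let step0 : lebesgue_rV_step set0 = 0%E.
Proof. exact: (measure0 (pushforward (@lebesgue_measure R \x mu)%E _)). Qed.

Let step_ge0 A : (0 <= lebesgue_rV_step A)%E.
Proof. exact: measure_ge0. Qed.

Let step_sigma_additive : semi_sigma_additive lebesgue_rV_step.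
Proof. exact: measure_semi_sigma_additive. Qed.

HB.instance Definition _ := isMeasure.Build _ _ _ lebesgue_rV_step
  step0 step_ge0 step_sigma_additive.

Let step_sigma_finite : sigma_finite setT lebesgue_rV_step.
Proof.
have /sigma_finiteP[F [TF ndF Foo]] := sigma_finiteT (@lebesgue_measure R).
have /sigma_finiteP[G [TG ndG Goo]] := sigma_finiteT mu.
exists (fun k => @rV_uncons R n @^-1` (F k `*` G k)).
  rewrite -preimage_bigcup -(preimage_setT (@rV_uncons R n)); congr (_ @^-1` _).
  rewrite -setXTT TF TG predeqE => -[x y]; split.
    move=> [/= [j _ Fjx] [k _ Gky]]; exists (maxn j k) => //; split.
    - by move: x Fjx; exact/subsetPset/ndF/leq_maxl.
    - by move: y Gky; exact/subsetPset/ndG/leq_maxr.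
  by move=> [j _ []/= ? ?]; split; exists j.
move=> k; have [mF Fk] := Foo k; have [mG Gk] := Goo k; split.
  rewrite -[X in measurable X]setTI.
  by apply: measurable_rV_uncons => //; exact: measurableX.
rewrite /lebesgue_rV_step /pushforward -comp_preimage.
rewrite (_ : _ \o _ = id) ?preimage_id; last first.
  by apply/funext => x /=; rewrite rV_consK.
by rewrite product_measure1E// lte_mul_pinfty// ge0_fin_numE.
Qed.

HB.instance Definition _ := Measure_isSigmaFinite.Build _ _ _ lebesgue_rV_step
  step_sigma_finite.

End lebesgue_rV_step.

Fixpoint lebesgue_rV (R : realType) (n : nat) :
    {sigma_finite_measure set 'rV[R]_n -> \bar R} :=
  if n is m.+1 then lebesgue_rV_step (lebesgue_rV R m)
  else \d_(0 : 'rV[R]_0).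

Definition eucl_norm (R : realType) n (x : 'rV[R]_n) : R :=
  Num.sqrt (\sum_(i < n) x 0 i ^+ 2).

(* For [s = d - 1] this is, up to the usual normalizing constant (omitted here),
   the surface measure on smooth hypersurfaces of [R^d]. *)

Section hausdorff.
Context {R : realType} (n : nat).
Implicit Types (S A : set 'rV[R]_n) (s : nat).
Local Open Scope ereal_scope.

Definition diameter S : \bar R :=
  ereal_sup [set (eucl_norm (xy.1 - xy.2))%:E | xy in S `*` S].

(* [set0] is treated apart because [0 ^+ 0 = 1]. *)
Definition diam_pow s S : \bar R :=
  if S == set0 then 0 else diameter S ^+ s.

Definition delta_cover (delta : R) A : set ((set 'rV[R]_n)^nat) :=
  [set C | A `<=` \bigcup_k C k /\ forall k, diameter (C k) <= delta%:E].

Definition hausdorff_content s (delta : R) A : \bar R :=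
  ereal_inf [set \sum_(k <oo) diam_pow s (C k) | C in delta_cover delta A].

Definition hausdorff s A : \bar R :=
  ereal_sup [set hausdorff_content s delta A | delta in [set r : R | (0 < r)%R]].

Lemma diam_pow_ge0 s S : 0 <= diam_pow s S.
Proof.
rewrite /diam_pow; case: eqP => // /eqP/set0P[x Sx].
rewrite expe_ge0//; apply: le_trans (ereal_sup_ubound _) => /=; last first.
  by exists (x, x).
by rewrite lee_fin sqrtr_ge0.
Qed.

Lemma diam_pow0 s : diam_pow s set0 = 0.
Proof. by rewrite /diam_pow eqxx. Qed.

Lemma diameter0 : diameter set0 = -oo.
Proof. by rewrite /diameter setX0 image_set0 ereal_sup0. Qed.

Lemma hausdorff_content_ge0 s delta A : 0 <= hausdorff_content s delta A.
Proof.
by apply: le_ereal_inf_tmp => _ [C _ <-]; apply: nneseries_ge0 => *;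
  exact: diam_pow_ge0.
Qed.

Lemma hausdorff_content0 s delta : hausdorff_content s delta set0 = 0.
Proof.
apply/eqP; rewrite eq_le hausdorff_content_ge0 andbT.
apply: ereal_inf_lbound; exists (fun=> set0).
  by split => // k; rewrite diameter0 leNye.
by rewrite eseries0// => *; exact: diam_pow0.
Qed.

Lemma le_hausdorff_content s delta :
  {homo hausdorff_content s delta : A B / A `<=` B >-> A <= B}.
Proof.
move=> A B AB; apply/ereal_inf_le_tmp => _ [C [BC Cd] <-].
by exists C => //; split => //; exact: subset_trans BC.
Qed.

Lemma hausdorff_content_sigma_subadditive s delta :
  sigma_subadditive (hausdorff_content s delta).
Proof.
move=> A; set H := hausdorff_content s delta.
have H0 := hausdorff_content_ge0 s delta.
have [[i ioo]|] := pselect (exists i, H (A i) = +oo).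
  rewrite (eseries_pinfty _ _ ioo) ?leey// => k _.
  by rewrite -ltNye (lt_le_trans _ (H0 _)).
rewrite -forallNE => Aoo.
suff add2e (e : {posnum R}) :
    H (\bigcup_n A n) <= \sum_(i <oo) H (A i) + e%:num%:E.
  by apply/lee_addgt0Pr => _/posnumP[].
rewrite (le_trans _ (epsilon_trick _ _ _))//.
pose P k (B : (set 'rV[R]_n)^nat) := delta_cover delta (A k) B /\
  \sum_(j <oo) diam_pow s (B j) <= H (A k) + (e%:num / (2 ^ k.+1)%:R)%:E.
have [G PG] : {G : ((set 'rV[R]_n)^nat)^nat & forall k, P k (G k)}.
  apply: (@choice _ _ P) => k.
  have en1 : (0 < e%:num / (2 ^ k.+1)%:R)%R by [].
  have Hfin : H (A k) \is a fin_num.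
    by rewrite ge0_fin_numE ?H0// ltey; apply/eqP; exact: Aoo.
  have [_ [B cB <-] /ltW] := lb_ereal_inf_adherent en1 Hfin.
  by exists B; split.
have dG_ge0 x : 0 <= (diam_pow s \o uncurry G) x by exact: diam_pow_ge0.
apply: (@le_trans _ _ (\esum_(i in setT) (diam_pow s \o uncurry G) i)).
  apply: ereal_inf_lbound => /=.
  have /card_esym/ppcard_eqP[f] := card_nat2.
  exists (uncurry G \o f).
    split => [t [i _ Ait]|k /=]; last first.
      by case: (f k) => i j; exact: (PG i).1.2.
    have [j _ Gijt] := (PG i).1.1 t Ait.
    by exists (f^-1%FUN (i, j)) => //=; rewrite invK ?inE.
  rewrite -(esum_pred_image (diam_pow s \o uncurry G) _ xpredT) ?[fun=> _]set_true//.
  by rewrite image_eq.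
rewrite (_ : esum _ _ = \sum_(i <oo) \sum_(j <oo) diam_pow s (G i j)); last first.
  pose J : nat -> set (nat * nat) := fun i => [set (i, j) | j in setT].
  rewrite (_ : setT = \bigcup_k J k); last first.
    by rewrite predeqE => -[a b]; split => // _; exists a => //; exists b.
  rewrite esum_bigcupT /=; last 2 first.
    - apply/trivIsetP => i j _ _ ij.
      rewrite predeqE => -[p m] /=; split => //= -[] [_] _ [<-{p} _].
      by move=> [m' _] [] /esym/eqP; rewrite (negbTE ij).
    - by move=> /= [p m]; exact: diam_pow_ge0.
  rewrite -(image_id [set: nat]) -fun_true esum_pred_image//; last first.
    by move=> p _; apply: esum_ge0 => ? _; exact: diam_pow_ge0.
  apply: eq_eseriesr => /= j _.
  rewrite -(esum_pred_image (diam_pow s \o uncurry G) (pair j) predT)//=; last first.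
    by move=> ? ? _ _; exact: (@can_inj _ _ _ snd).
    by move=> ? _; exact: diam_pow_ge0.
  by congr esum; rewrite predeqE => -[a b]; split; move=> [i _ <-]; exists i.
apply: lee_nneseries.
- by move=> i _ _; apply: nneseries_ge0 => m *; exact: (dG_ge0 (i, m)).
- by move=> i _; exact: (PG i).2.
Qed.

Lemma hausdorff_content_le s delta A : (0 < delta)%R ->
  hausdorff_content s delta A <= hausdorff s A.
Proof. by move=> d0; apply: ereal_sup_ubound; exists delta. Qed.

Lemma hausdorff_ge0 s A : 0 <= hausdorff s A.
Proof.
exact: le_trans (hausdorff_content_ge0 s 1 A) (hausdorff_content_le _ _ _).
Qed.

Lemma hausdorff0 s : hausdorff s set0 = 0.
Proof.
apply/eqP; rewrite eq_le hausdorff_ge0 andbT.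
by apply: ge_ereal_sup => _ [delta _ <-]; rewrite hausdorff_content0.
Qed.

Lemma le_hausdorff s : {homo hausdorff s : A B / A `<=` B >-> A <= B}.
Proof.
move=> A B AB; apply: ge_ereal_sup => _ [delta d0 <-].
exact: le_trans (le_hausdorff_content _ _ AB) (hausdorff_content_le _ _ d0).
Qed.

Lemma hausdorff_sigma_subadditive s : sigma_subadditive (hausdorff s).
Proof.
move=> A; apply: ge_ereal_sup => _ [delta d0 <-].
apply: le_trans (hausdorff_content_sigma_subadditive _ _ _) _.
apply: lee_nneseries => [i _ _|i _]; first exact: hausdorff_content_ge0.
exact: hausdorff_content_le.
Qed.

HB.instance Definition _ s := isOuterMeasure.Build R 'rV[R]_n (hausdorff s)
  (hausdorff0 s) (hausdorff_ge0 s) (@le_hausdorff s)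
  (@hausdorff_sigma_subadditive s).

End hausdorff.

Definition hausdorff_outer (R : realType) (n s : nat) :
  {outer_measure set 'rV[R]_n -> \bar R} := @hausdorff R n s.

(* Restricted by Caratheodory's theorem to the sets measurable for it. *)
Definition hausdorff_measure (R : realType) (n s : nat) :
    {measure set (caratheodory_type (hausdorff_outer R n s)) -> \bar R} :=
  (hausdorff_outer R n s :
     set (caratheodory_type (hausdorff_outer R n s)) -> \bar R).

Section calculus.
Context {R : realType} (d : nat).
Local Notation V := 'rV[R]_d.

Definition partial (i : 'I_d) (f : V -> R) : V -> R :=
  'D_(delta_mx 0 i : V) f.

(* Meant for [U] open. *)
Fixpoint is_Ck (k : nat) (U : set V) (f : V -> R) : Prop :=
  (forall x, U x -> {for x, continuous f}) /\
  (if k is m.+1 then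
     forall i, (forall x, U x -> derivable f x (delta_mx 0 i)) /\
               is_Ck m U (partial i f)
   else True).

Definition smooth (f : V -> R) : Prop := forall k, is_Ck k setT f.

Definition boundary (A : set V) : set V := closure A `\` interior A.

(* Near each boundary point, after relabeling (choice of [i]) and reorienting
   (choice of [s]) the axes, [Omega] is the region above the graph of a smooth
   function [gamma] of the coordinates other than the [i]-th one. *)
Definition smooth_boundary (Omega : set V) : Prop :=
  forall x, boundary Omega x ->
    exists (i : 'I_d) (s : bool) (gamma : V -> R),
      [/\ smooth gamma,
          (forall y t, gamma (y + t *: delta_mx 0 i) = gamma y) &
          \forall y \near x, Omega y <-> 0 < (-1) ^+ s * (y 0 i - gamma y)].

Definition bounded_smooth_domain (Omega : set V) : Prop :=
  [/\ open Omega, connected Omega, Omega !=set0, bounded_set Omega &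
      smooth_boundary Omega].

End calculus.

(* Functions that agree almost everywhere are not identified, and the weak
   gradient is kept as a separate argument. *)

Section sobolev.
Context {R : realType} (d : nat) (Omega : set 'rV[R]_d).
Local Notation V := 'rV[R]_d.
Local Notation mu := (lebesgue_rV R d).

Definition in_Lp (p : R) (f : V -> R) : Prop :=
  measurable_fun Omega f /\
  (\int[mu]_(x in Omega) (`|f x| `^ p)%:E < +oo)%E.

Definition test_function (phi : V -> R) : Prop :=
  smooth phi /\
  exists K, [/\ compact K, K `<=` Omega & forall x, ~ K x -> phi x = 0].

Definition weak_gradient (v : V -> R) (G : V -> V) : Prop :=
  forall (i : 'I_d) phi, test_function phi ->
    \int[mu]_(x in Omega) (v x * partial i phi x) =
    - \int[mu]_(x in Omega) (G x 0 i * phi x).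

Definition sobolev_grad (p : R) (v : V -> R) (G : V -> V) : Prop :=
  [/\ in_Lp p v, (forall i, in_Lp p (fun x => G x 0 i)) & weak_gradient v G].

Definition sobolev (p : R) (v : V -> R) : Prop := exists G, sobolev_grad p v G.

Definition dirichlet (p : R) (G : V -> V) : \bar R :=
  \int[mu]_(x in Omega) (eucl_norm (G x) `^ p)%:E.

Definition sobolev_norm (p : R) (v : V -> R) (G : V -> V) : R :=
  fine (\int[mu]_(x in Omega) (`|v x| `^ p)%:E + dirichlet p G)%E `^ p^-1.

(* [f] is the value at [v] of the trace operator, i.e. of the continuous
   extension to [W^{1,p}(Omega)], with values in [L^p] of the surface measure
   of the boundary, of the restriction of functions continuous on the closure. *)
Definition has_trace (p : R) (v f : V -> R) : Prop :=
  exists (G : V -> V) (w : nat -> V -> R) (H : nat -> V -> V),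
  [/\ sobolev_grad p v G,
      (forall k, sobolev_grad p (w k) (H k) /\
                 {within closure Omega, continuous (w k)}),
      sobolev_norm p (w k \- v) (H k \- G) @[k --> \oo] --> 0 &
      (\int[hausdorff_measure R d d.-1]_(x in boundary Omega)
         (`|w k x - f x| `^ p)%:E)%E @[k --> \oo] --> 0%E].

Definition bounded_linear_functional (p : R) (L : (V -> R) -> R) : Prop :=
  (forall (a : R) v w, sobolev p v -> sobolev p w ->
     L (fun x => a * v x + w x) = a * L v + L w) /\
  exists C : R, forall v G, sobolev_grad p v G ->
    `|L v| <= C * sobolev_norm p v G.

(* The first terms of the sequence may lie outside [W^{1,p}(Omega)]. *)
Definition sobolev_weak_cvg (p : R) (v : nat -> V -> R) (w : V -> R) : Prop :=
  [/\ \forall j \near \oo, sobolev p (v j), sobolev p w &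
      forall L, bounded_linear_functional p L -> L (v j) @[j --> \oo] --> L w].

End sobolev.

Section obstacle.
Context {R : realType} (d : nat) (Omega : set 'rV[R]_d).
Local Notation V := 'rV[R]_d.
Variables (F Psi : V -> R).

Definition p_admissible (p : R) (v : V -> R) : Prop :=
  [/\ sobolev Omega p v, has_trace Omega p v F &
      {ae lebesgue_rV R d, forall x, Omega x -> Psi x <= v x}].

Definition p_minimizer (p : R) (u : V -> R) : Prop :=
  p_admissible p u /\
  forall Gu v Gv, sobolev_grad Omega p u Gu ->
    p_admissible p v -> sobolev_grad Omega p v Gv ->
    (dirichlet Omega p Gu <= dirichlet Omega p Gv)%E.

Definition infinity_laplacian (u : V -> R) (x : V) : R :=
  \sum_(i < d) \sum_(j < d)
    partial i u x * partial j u x * partial j (partial i u) x.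

Definition touches_below (phi v : V -> R) (x : V) (U : set V) : Prop :=
  phi x = v x /\ forall y, U y -> phi y <= v y.

Definition infinity_superharmonic (v : V -> R) : Prop :=
  forall x phi (U : set V),
    open U -> U `<=` Omega -> U x -> is_Ck 2 U phi ->
    touches_below phi v x U -> 0 <= - infinity_laplacian phi x.

(* Functions are total; only their values on the closure of [Omega] matter. *)
Definition obstacle_supersolutions : set (V -> R) :=
  [set v | [/\ {within closure Omega, continuous v},
               infinity_superharmonic v,
               (forall x, Omega x -> Psi x <= v x) &
               (forall x, boundary Omega x -> v x = F x)]].

End obstacle.

(* Main.v *)
(* Every statement about [u_p] is used only through its continuous representative,
   for which integration against weak gradients is replaced by limits of difference
   quotients.

   Viscosity inequalities for [u_oo]: if a [C^2] function [phi] touches [u_oo]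
   strictly from below at a point with positive infinity Laplacian, then near that
   point [psi = phi + delta] has positive [p]-Laplacian for large [p], and moving
   [u_p] towards [psi] by a small multiple of a cutoff of [(psi - u_p)^+ ^ 2]
   decreases the [p]-energy by convexity.  Moving upwards keeps the obstacle
   constraint; moving downwards does so where [u_oo > Psi].  Hence [u_oo] is infinity
   superharmonic, and infinity subharmonic in [{u_oo > Psi}].

   Boundary values: in a boundary chart, integrating the derivative of
   [((u_p - w_k)^+)^2] across a layer of height [eps] bounds, uniformly in [eps], its
   average over the layer by the Sobolev distance of [u_p] and [w_k], while the part of
   the layer above the boundary points where [w_k] is far from [F] has measure at most
   [C eps] times their surface measure.  Letting [k] tend to infinity gives [u_p = F].

   Minimality: [u_oo <= v] on the boundary of [{u_oo > Psi}], and comparison inside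
   follows Armstrong and Smart: sub- and supersolutions enjoy comparison with cones,
   hence one-step mean inequalities over balls, which exclude a triple of points [x],
   [y], [z] with [|x - y|, |x - z| <= e] that maximizes [u y - v z], then [u y], then
   a coordinate of [x]. *)

From HB Require Import structures.
Require Import Defs.
From mathcomp Require Import all_boot all_order all_algebra.
From mathcomp Require Import all_classical all_reals all_analysis.
From mathcomp Require Import measurable_realfun ring lra.
Set Implicit Arguments.
Unset Strict Implicit.
Unset Printing Implicit Defensive.
Import Order.TTheory GRing.Theory Num.Theory.
Import numFieldNormedType.Exports.
Local Open Scope classical_set_scope.
Local Open Scope ring_scope.

(** * Lebesgue measure on row vectors *)

(** No Euler-Lagrange equation is derived. Minimality is used against one competitor only, and the
    convexity inequality is linearized at the smooth end [D psi] of the segment of gradients, not at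
    [D u_p]. Its first-order term then contains the flux [|D psi|^(p-2) D psi], which is C^1 because
    [D psi] does not vanish; integrating by parts produces the p-Laplacian [|D psi|^(p-4) ((p-2)
    Delta_oo psi + |D psi|^2 Delta psi)], whose first summand wins for large [p]. The flux is only
    C^1 while weak gradients are tested with smooth functions: hence a weak derivative with merely
    continuous tests. The positive part is squared because [(t^+)^2] is C^1 with a quadratic
    remainder, so that its chain rule needs no almost everywhere argument.

    In the trace argument, [L^p] convergence on the boundary controls [w_k - F] only off a set of
    small surface measure, and nothing is known above that set. The averaging kernel has size
    [1 / eps] there, which exactly compensates the factor [eps] in the volume of the layer above
    it. *)

Section rV_norm.
Context {R : realType} {n : nat}.
Implicit Types (x y : 'rV[R]_n) (e : R).

Lemma rV_norm_ltP x e : 0 < e -> reflect (forall i, `|x 0 i| < e) (`|x| < e).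
Proof.
move=> e0; apply: (iffP idP) => [xe i|xe].
  have : ball (0 : 'rV[R]_n) e x by rewrite mx_norm_ball /ball_/= sub0r normrN.
  by move=> [_ /(_ 0 i)]; rewrite mxE /ball/= sub0r normrN.
suff : ball (0 : 'rV[R]_n) e x by rewrite mx_norm_ball /ball_/= sub0r normrN.
split=> // i j; rewrite mxE /ball/= sub0r normrN ord1; exact: xe.
Qed.

Lemma rV_norm_leP x e : 0 <= e -> reflect (forall i, `|x 0 i| <= e) (`|x| <= e).
Proof.
move=> e0; apply: (iffP idP) => [xe i|xe].
  apply/ler_addgt0Pr => d d0; apply: ltW.
  by apply/rV_norm_ltP; [rewrite ltr_wpDl|rewrite (le_lt_trans xe)// ltrDl].
apply/ler_addgt0Pr => d d0; apply: ltW; apply/rV_norm_ltP; first by rewrite ltr_wpDl.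
by move=> i; rewrite (le_lt_trans (xe i))// ltrDl.
Qed.

Lemma rV_coord_le_norm x i : `|x 0 i| <= `|x|.
Proof. by move: i; apply/rV_norm_leP. Qed.

Lemma ball_rVP x y e : 0 < e -> ball x e y <-> forall i, `|x 0 i - y 0 i| < e.
Proof.
move=> e0; rewrite mx_norm_ball /ball_/=; split.
  by move=> /rV_norm_ltP => /(_ e0) h i; have := h i; rewrite !mxE.
by move=> h; apply/rV_norm_ltP => // i; rewrite !mxE.
Qed.

Lemma delta_rV_norm (i : 'I_n) : `|delta_mx 0 i : 'rV[R]_n| = 1.
Proof.
apply/eqP; rewrite eq_le; apply/andP; split.
  apply/rV_norm_leP => // j; rewrite mxE eqxx/=.
  by case: eqP => _; rewrite ?normr1 ?normr0.
by have := rV_coord_le_norm (delta_mx 0 i) i; rewrite mxE !eqxx normr1.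
Qed.

Lemma norm_shift_delta (t : R) (i : 'I_n) :
  `|t *: (delta_mx 0 i : 'rV[R]_n)| = `|t|.
Proof. by rewrite normrZ delta_rV_norm mulr1. Qed.

End rV_norm.

Section rV_measurable.
Context {R : realType} {n : nat}.

(** The sigma-algebra is generated by the coordinates, so [U] is exhibited as a countable union of
    cubes with rational center and radius [1 / k.+1] contained in [U]. *)
Lemma open_measurable_rV (U : set 'rV[R]_n) : open U -> measurable U.
Proof.
move=> oU.
pose q2x (q : 'rV[rat]_n) : 'rV[R]_n := map_mx (@ratr R) q.
pose F (qk : 'rV[rat]_n * nat) :=
  [set x | ball (q2x qk.1) (qk.2.+1%:R^-1) x /\
           ball (q2x qk.1) (qk.2.+1%:R^-1) `<=` U].
suff -> : U = \bigcup_qk F qk.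
  apply: countable_bigcupT_measurable => // -[q k].
  have [h|h] := pselect (ball (q2x q) (k.+1%:R^-1) `<=` U); last first.
    by rewrite (_ : F _ = set0)//; apply/seteqP; split=> x //= -[].
  rewrite (_ : F _ = \bigcap_(i in [set: 'I_n])
      ((fun x : 'rV[R]_n => x 0 i) @^-1` ball (q2x q 0 i) (k.+1%:R^-1))).
    apply: fin_bigcap_measurable; first exact: finite_finset.
    move=> i _; rewrite -[X in measurable X]setTI.
    by apply: measurable_rV_coord => //; exact: measurable_ball.
  apply/seteqP; split=> x /=.
    by move=> [/ball_rVP hx _] i _; apply: hx; rewrite invr_gt0.
  by move=> hx; split=> //; apply/ball_rVP; [rewrite invr_gt0|move=> i; exact: hx].
apply/seteqP; split=> x; last by move=> [[q k] _ [bx]]; exact.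
move=> Ux; have /nbhs_ballP[e/= e0 eU] := open_nbhs_nbhs (conj oU Ux).
(* This makes [1 / k.+1 < e / 2], so a rational cube of that radius containing [x] stays in the ball
   of radius [e] around [x]. *)
pose k := Num.truncn (2 / e).
have kP : k.+1%:R^-1 < e / 2.
  rewrite -[e / 2]invrK ltf_pV2 ?posrE ?invr_gt0 ?divr_gt0//.
  by rewrite invf_div truncnS_gt.
have /choice[q hq] : forall i, exists q : rat, `|ratr q - x 0 i| < k.+1%:R^-1.
  move=> i; have [|q] := @rat_in_itvoo R (x 0 i - k.+1%:R^-1) (x 0 i + k.+1%:R^-1).
    by rewrite ltrD2l gtrN// invr_gt0.
  by rewrite in_itv/= => h; exists q; rewrite ltr_distl.
exists (\row_i q i, k) => //; split.
  by apply/ball_rVP; [rewrite invr_gt0|move=> i; rewrite !mxE].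
move=> y /ball_rVP hy; apply: eU; apply/ball_rVP => // i.
have := hy; rewrite invr_gt0 => /(_ _ i); rewrite ltr0n => /(_ isT).
rewrite !mxE => h1; have h2 := hq i.
have := ler_distD (ratr (q i)) (x 0 i) (y 0 i).
rewrite [X in _ <= X + _]distrC; move: h1 h2 kP; set K := _^-1; lra.
Qed.

Lemma closed_measurable_rV (U : set 'rV[R]_n) : closed U -> measurable U.
Proof.
by move=> cU; rewrite -[U]setCK; apply: measurableC; apply: open_measurable_rV;
  exact: closed_openC.
Qed.

Lemma continuous_on_measurable_rV (U : set 'rV[R]_n) (f : 'rV[R]_n -> R) :
  open U -> (forall x, U x -> {for x, continuous f}) -> measurable_fun U f.
Proof.
move=> oU cf; apply: (measurability _ (RGenOpens.measurableE R)) => //.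
move=> _ [_ [a [b ->] <-]]; apply: open_measurable_rV.
rewrite openE => x [Ux] /= fx; rewrite /interior.
apply: filterI; first exact: open_nbhs_nbhs.
by apply: (cf _ Ux); apply: open_nbhs_nbhs; split=> //; exact: interval_open.
Qed.

Lemma continuous_measurable_rV (f : 'rV[R]_n -> R) :
  continuous f -> measurable_fun setT f.
Proof. by move=> cf; apply: continuous_on_measurable_rV => [|x _]; [exact: openT|exact: cf]. Qed.

End rV_measurable.

Section lebesgue_translation.
Context {R : realType}.
Local Open Scope ereal_scope.

(** The image of Lebesgue measure under translation has the same value on half-open intervals, hence
    coincides with it by uniqueness. *)
Lemma ge0_integral_translate (c : R) (f : R -> \bar R) :
  measurable_fun setT f -> (forall x, 0 <= f x) ->
  \int[@lebesgue_measure R]_x f (x + c)%R = \int[@lebesgue_measure R]_x f x.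
Proof.
move=> mf f0.
have mc : measurable_fun setT (fun x : measurableTypeR R => x + c : measurableTypeR R)%R.
  by apply: measurable_funD.
have := @ge0_integral_pushforward _ _ _ _ R _ mc lebesgue_measure setT f measurableT mf
  (fun x _ => f0 x).
rewrite preimage_setT => <-.
apply: eq_measure_integral => A mA _; apply/esym.
apply: lebesgue_measure_unique => // X /ocitvP[->|[[a b]/= ab ->]].
  by rewrite !measure0.
rewrite /= /pushforward (_ : _ @^-1` _ = `](a - c)%R, (b - c)%R]%classic); last first.
  by apply/seteqP; split=> x /=; rewrite !in_itv/= ltrBlDr lerBrDr.
rewrite !lebesgue_measure_itv/= !lte_fin ltrD2r ab -!EFinB; congr EFin.
by rewrite opprD addrACA subrr addr0.
Qed.

Lemma ge0_integral_lebesgue_rVS n (f : 'rV[R]_n.+1 -> \bar R) :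
  measurable_fun setT f -> (forall x, 0 <= f x) ->
  \int[lebesgue_rV R n.+1]_x f x =
  \int[@lebesgue_measure R]_t \int[lebesgue_rV R n]_x f (rV_cons (t, x)).
Proof.
move=> mf f0.
have := @ge0_integral_pushforward _ _ _ _ R _ (@measurable_rV_cons R n)
  (@lebesgue_measure R \x lebesgue_rV R n) setT f measurableT mf (fun x _ => f0 x).
rewrite preimage_setT => h; rewrite [LHS]h.
have mfc : measurable_fun setT (f \o @rV_cons R n).
  by apply: measurableT_comp => //; exact: measurable_rV_cons.
rewrite (@fubini_tonelli1 _ _ _ _ _ _ _ (f \o @rV_cons R n))//.
by move=> x; exact: f0.
Qed.

Lemma rV_consD n (c : 'rV[R]_n.+1) t (x : 'rV[R]_n) :
  (rV_cons (t, x) + c = rV_cons (t + (rV_uncons c).1, x + (rV_uncons c).2))%R.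
Proof.
apply/rowP => i; rewrite mxE; case: (unliftP ord0 i) => [j|] ->.
  by rewrite !rV_consS !mxE.
by rewrite !rV_cons0.
Qed.

(** Induction on the dimension through Tonelli: the tail of [c] is absorbed by the induction
    hypothesis, its head by the one-dimensional case. *)
Lemma ge0_integral_translate_rV n (c : 'rV[R]_n) (f : 'rV[R]_n -> \bar R) :
  measurable_fun setT f -> (forall x, 0 <= f x) ->
  \int[lebesgue_rV R n]_x f (x + c)%R = \int[lebesgue_rV R n]_x f x.
Proof.
elim: n => [|n IH] in c f *.
  by move=> _ _; apply: eq_integral => x _; rewrite [c]thinmx0 addr0.
move=> mf f0.
have mc : measurable_fun setT (fun x : 'rV[R]_n.+1 => x + c)%R.
  apply: measurable_fun_rVP => i.
  rewrite (_ : (fun _ => _) = (fun x : 'rV[R]_n.+1 => x 0%R i + c 0%R i)%R); last first.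
    by apply/funext => x; rewrite mxE.
  by apply: measurable_funD => //; exact: measurable_rV_coord.
rewrite !ge0_integral_lebesgue_rVS//; last exact: measurableT_comp.
under eq_integral => t _.
  under eq_integral => x _ do rewrite rV_consD.
  rewrite (IH (rV_uncons c).2 (fun x => f (rV_cons (t + (rV_uncons c).1, x)%R))); last 2 first.
  - apply: (measurableT_comp mf); apply: (measurableT_comp (@measurable_rV_cons R n)).
    exact: measurable_pair1.
  - by [].
  over.
rewrite (ge0_integral_translate _
  (f := fun t => \int[lebesgue_rV R n]_x f (rV_cons (t, x))))//.
- have mfc : measurable_fun setT (f \o @rV_cons R n).
    by apply: measurableT_comp => //; exact: measurable_rV_cons.
  have f0' x : 0 <= (f \o @rV_cons R n) x by exact: f0.
  exact: (@measurable_fun_fubini_tonelli_F _ _ _ _ _ (lebesgue_rV R n) _ mfc f0').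
- by move=> t; exact: integral_ge0.
Qed.

End lebesgue_translation.

Section lebesgue_box.
Context {R : realType}.

Definition rV_box n (a b : 'rV[R]_n) : set 'rV[R]_n :=
  [set x | forall i, a 0 i <= x 0 i <= b 0 i].

Lemma rV_box_measurable n (a b : 'rV[R]_n) : measurable (rV_box a b).
Proof.
rewrite (_ : rV_box a b = \bigcap_(i in [set: 'I_n])
    ((fun x : 'rV[R]_n => x 0 i) @^-1` `[a 0 i, b 0 i])).
  apply: fin_bigcap_measurable; first exact: finite_finset.
  by move=> i _; rewrite -[X in measurable X]setTI; exact: measurable_rV_coord.
apply/seteqP; split=> x /=.
  by move=> h i _ /=; rewrite in_itv/= h.
by move=> h i; have := h i I; rewrite /= in_itv.
Qed.

Lemma lebesgue_rV_box n (a b : 'rV[R]_n) : (forall i, a 0 i <= b 0 i) ->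
  lebesgue_rV R n (rV_box a b) = (\prod_i (b 0 i - a 0 i))%:E.
Proof.
elim: n a b => [|n IH] a b ab.
  by rewrite big_ord0 /= diracE mem_set// => -[].
transitivity (((@lebesgue_measure R) \x (lebesgue_rV R n))%E
   (`[a 0 ord0, b 0 ord0] `*` rV_box (rV_uncons a).2 (rV_uncons b).2)).
  rewrite /= /lebesgue_rV_step /pushforward; congr ((_ \x _)%E _).
  apply/seteqP; split=> [[t x]|[t x]] /=.
    move=> h; split; first by have := h ord0; rewrite in_itv/= rV_cons0.
    by move=> i; have := h (lift ord0 i); rewrite rV_consS !mxE.
  rewrite in_itv/= => -[h1 h2] i; case: (unliftP ord0 i) => [j|] ->.
    by rewrite rV_consS; have := h2 j; rewrite !mxE.
  by rewrite rV_cons0.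
rewrite product_measure1E//; last exact: rV_box_measurable.
rewrite IH; last by move=> i; rewrite !mxE.
rewrite big_ord_recl; have := lebesgue_measure_itv (`[a 0 ord0, b 0 ord0]).
rewrite /= lte_fin => ->; have := ab ord0; rewrite le_eqVlt => /predU1P[->|h].
  by rewrite ltxx subrr mul0e mul0r.
rewrite h -EFinB -EFinM; congr (_ * _)%:E.
by apply: eq_bigr => i _; rewrite !mxE.
Qed.

Lemma lebesgue_rV_bounded n (A : set 'rV[R]_n) : measurable A -> bounded_set A ->
  (lebesgue_rV R n A < +oo)%E.
Proof.
move=> mA [M [_ hM]].
have h : A `<=` rV_box (const_mx (- (M + 1))) (const_mx (M + 1)).
  move=> x Ax i; rewrite !mxE -ler_norml.
  by rewrite (le_trans (rV_coord_le_norm x i))// hM// ltrDl.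
apply: (@le_lt_trans _ _ (lebesgue_rV R n (rV_box (const_mx (- (M + 1))) (const_mx (M + 1))))).
  by apply: le_measure; rewrite ?inE//; exact: rV_box_measurable.
(* A negative half-side makes the box empty as soon as there is a coordinate; without coordinates
   the box is a point and the product formula still applies. *)
have [M0|M0] := leP 0 (M + 1).
  by rewrite lebesgue_rV_box ?ltry// => i; rewrite !mxE; lra.
have [i0|] := pselect (exists i : 'I_n, True).
  rewrite (_ : rV_box _ _ = set0) ?measure0//; apply/seteqP; split=> x //=.
  case: i0 => i _ /(_ i).
  by rewrite !mxE => /andP[a b]; have := le_trans a b; lra.
by move=> nI; rewrite lebesgue_rV_box ?ltry// => i; exfalso; apply: nI; exists i.
Qed.

Lemma lebesgue_rV_open_gt0 n (U : set 'rV[R]_n) : open U -> U !=set0 ->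
  (0 < lebesgue_rV R n U)%E.
Proof.
move=> oU [x Ux].
have /nbhs_ballP[e/= e0 eU] := open_nbhs_nbhs (conj oU Ux).
have e20 : 0 < e / 2 by rewrite divr_gt0.
apply: (@lt_le_trans _ _ (lebesgue_rV R n (rV_box (x - const_mx (e / 2)) (x + const_mx (e/2))))).
  rewrite lebesgue_rV_box.
    by rewrite lte_fin; apply: prodr_gt0 => i _; rewrite !mxE; lra.
  by move=> i; rewrite !mxE; lra.
apply: le_measure; rewrite ?inE; [exact: rV_box_measurable|exact: open_measurable_rV|].
move=> y hy; apply: eU; apply/ball_rVP => // i; have := hy i; rewrite !mxE => h.
by rewrite ltr_distl; apply/andP; split; lra.
Qed.

End lebesgue_box.

(** Only [x] is confined to [K]: continuity at the points of [K] is meant in the whole space, so [y]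
    may leave [K]. Compactness enters as the near-covering property, applied to [t] tending to [0]
    from the right. *)
Lemma heine_compact (R : realType) (n : nat) (K : set 'rV[R]_n) (f : 'rV[R]_n -> R) :
  compact K -> (forall x, K x -> {for x, continuous f}) ->
  forall e, 0 < e -> exists2 t, 0 < t &
    forall x y, K x -> `|x - y| < t -> `|f x - f y| < e.
Proof.
move=> /compact_near_coveringP cK cf e e0.
have := cK R 0^'+ (fun t x => forall y, `|x - y| < t -> `|f x - f y| < e) _.
case=> [x Kx|t/= t0 h].
  have e20 : 0 < e / 2 by rewrite divr_gt0.
  have /cvgrPdist_lt/(_ _ e20)/nbhs_ballP[r/= r0 hr] := cf x Kx.
  have r20 : 0 < r / 2 by rewrite divr_gt0.
  exists (ball x (r / 2), [set t | t < r / 2]) => /=.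
    split; first exact: nbhsx_ballx.
    exact: nbhs_right_lt.
  move=> [y t] /= [xy tr] z yz.
  move: xy; rewrite mx_norm_ball /ball_/= => xy.
  have h1 : `|f x - f y| < e / 2.
    by apply: hr; rewrite mx_norm_ball /ball_/=; lra.
  have h2 : `|f x - f z| < e / 2.
    apply: hr; rewrite mx_norm_ball /ball_/=.
    by have := ler_distD y x z; lra.
  have := ler_distD (f x) (f y) (f z).
  by rewrite [`|f y - f x|]distrC; lra.
exists (t / 2); first by rewrite divr_gt0.
move=> x y Kx xy; apply: (h (t / 2)) => //=; last by rewrite divr_gt0.
by rewrite sub0r normrN gtr0_norm ?divr_gt0//; move: t0 => /=; lra.
Qed.

(** * Real-valued integrals over the whole space, and functions with compact support *)

Section integral_rV.
Context {R : realType} {d : nat}.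
Local Notation V := 'rV[R]_d.
Local Notation mu := (lebesgue_rV R d).
Implicit Types (f g : V -> R) (K : set V).

(** Integrals over [Omega] are handled as whole-space integrals of restrictions, which makes
    translations available without following the domain. *)
Definition intg f : R := \int[mu]_(x in setT) f x.
Definition L1 f : Prop := mu.-integrable setT (EFin \o f).

Lemma eq_L1 f g : f =1 g -> L1 f -> L1 g.
Proof. by move=> /funext ->. Qed.

Lemma L1_measurable f : L1 f -> measurable_fun setT f.
Proof. by move=> /measurable_int/measurable_EFinP. Qed.

Lemma L1D f g : L1 f -> L1 g -> L1 (fun x => f x + g x).
Proof. by move=> hf hg; have := integrableD measurableT hf hg. Qed.

Lemma L1B f g : L1 f -> L1 g -> L1 (fun x => f x - g x).
Proof. by move=> hf hg; have := integrableB measurableT hf hg. Qed.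

Lemma L1Z a f : L1 f -> L1 (fun x => a * f x).
Proof. by move=> hf; have := integrableZl measurableT a hf. Qed.

Lemma L1_norm f : L1 f -> L1 (fun x => `|f x|).
Proof. exact: integrable_norm. Qed.

Lemma L1M f g M : L1 f -> measurable_fun setT g -> (forall x, `|g x| <= M) ->
  L1 (fun x => f x * g x).
Proof.
move=> hf mg hM; apply: (@le_integrable _ _ _ _ _ _ _ (fun x => (M * f x)%:E)) => //.
- by apply/measurable_EFinP; apply: measurable_funM => //; exact: L1_measurable.
- move=> x _ /=; rewrite lee_fin !normrM mulrC ler_wpM2r//.
  by rewrite (le_trans (hM x))// ler_norm.
- exact: L1Z.
Qed.

Lemma le_L1 f g : measurable_fun setT f -> (forall x, `|f x| <= g x) -> L1 g -> L1 f.
Proof.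
move=> mf fg hg; apply: (@le_integrable _ _ _ _ _ _ _ (EFin \o g)) => //.
  exact/measurable_EFinP.
by move=> x _ /=; rewrite lee_fin (le_trans (fg x))// ler_norm.
Qed.

Lemma bounded_L1 f K M : measurable_fun setT f -> (forall x, `|f x| <= M) ->
  measurable K -> bounded_set K -> (forall x, ~ K x -> f x = 0) -> L1 f.
Proof.
move=> mf fM mK bK fK.
have -> : f = f \_ K.
  apply/funext => x; rewrite patchE; case: ifPn => //.
  by move=> /negP; rewrite inE => /fK.
rewrite /L1 -restrict_EFin; apply/integrable_restrict => //.
rewrite setTI; apply: measurable_bounded_integrable => //.
- exact: lebesgue_rV_bounded.
- exact: measurable_funTS.
- exists M; split => [|y My x _]; first exact: num_real.
  exact: le_trans (fM x) (ltW My).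
Qed.

Lemma intgD f g : L1 f -> L1 g -> intg (fun x => f x + g x) = intg f + intg g.
Proof. by move=> hf hg; exact: RintegralD. Qed.

Lemma intgB f g : L1 f -> L1 g -> intg (fun x => f x - g x) = intg f - intg g.
Proof. by move=> hf hg; exact: RintegralB. Qed.

Lemma intgZ a f : L1 f -> intg (fun x => a * f x) = a * intg f.
Proof. by move=> hf; exact: RintegralZl. Qed.

Lemma eq_intg f g : f =1 g -> intg f = intg g.
Proof. by move=> /funext ->. Qed.

Lemma intg_norm f : L1 f -> `|intg f| <= intg (fun x => `|f x|).
Proof. by move=> hf; exact: le_normr_Rintegral. Qed.

Lemma le_intg f g : L1 f -> L1 g -> (forall x, f x <= g x) -> intg f <= intg g.
Proof. by move=> hf hg fg; apply: le_Rintegral. Qed.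

Lemma intg_ge0 f : (forall x, 0 <= f x) -> 0 <= intg f.
Proof. by move=> f0; apply: Rintegral_ge0. Qed.

Lemma intgM_le f g M : L1 f -> measurable_fun setT g -> (forall x, `|g x| <= M) ->
  `|intg (fun x => f x * g x)| <= M * intg (fun x => `|f x|).
Proof.
move=> hf mg gM; have hfg := L1M hf mg gM.
rewrite (le_trans (intg_norm hfg))// -intgZ; last exact: L1_norm.
apply: le_intg; [exact: L1_norm|by apply: L1Z; exact: L1_norm|].
by move=> x; rewrite normrM mulrC ler_wpM2r.
Qed.

Lemma intg_EFin f : L1 f -> (\int[mu]_x (f x)%:E)%E = (intg f)%:E.
Proof. by move=> hf; rewrite /intg /Rintegral fineK//; exact: integrable_fin_num. Qed.

Lemma intg_gt0 f (U : set V) : L1 f -> (forall x, 0 <= f x) -> open U -> U !=set0 ->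
  (forall x, U x -> 0 < f x) -> 0 < intg f.
Proof.
move=> hf f0 oU U0 fU; rewrite lt_def intg_ge0// andbT; apply/eqP => h.
have : (\int[mu]_x `|(f x)%:E| = 0)%E.
  under eq_integral do rewrite /= ger0_norm//.
  by rewrite intg_EFin// h.
move/(ae_eq_integral_abs mu measurableT); case.
  by apply/measurable_EFinP; exact: L1_measurable.
move=> N [mN N0 hN].
have := lebesgue_rV_open_gt0 oU U0.
suff : (mu U <= 0)%E by move=> /le_lt_trans /[apply]; rewrite ltxx.
rewrite -N0; apply: le_measure; rewrite ?inE//; first exact: open_measurable_rV.
move=> x Ux; apply: hN => /= /(_ I) [fx0].
by have := fU _ Ux; rewrite fx0 ltxx.
Qed.

Lemma measurable_translate (c : V) : measurable_fun setT (fun x : V => x + c).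
Proof.
apply: measurable_fun_rVP => i.
rewrite (_ : (fun _ => _) = (fun x : 'rV[R]_d => x 0 i + c 0 i)); last first.
  by apply/funext => x; rewrite mxE.
by apply: measurable_funD => //; exact: measurable_rV_coord.
Qed.

Lemma intg_translate f c : L1 f -> intg (fun x => f (x + c)) = intg f.
Proof.
move=> /L1_measurable mf; rewrite /intg /Rintegral; congr fine.
rewrite integralE [RHS]integralE; congr (_ - _)%E.
  rewrite -(ge0_integral_translate_rV c (f := (EFin \o f)^\+%E))//.
    by apply: eq_integral => x _; rewrite !funeposE.
  by apply: measurable_funepos; exact/measurable_EFinP.
rewrite -(ge0_integral_translate_rV c (f := (EFin \o f)^\-%E))//.
  by apply: eq_integral => x _; rewrite !funenegE.
by apply: measurable_funeneg; exact/measurable_EFinP.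
Qed.

Lemma L1_translate f c : L1 f -> L1 (fun x => f (x + c)).
Proof.
move=> hf; have mf := L1_measurable hf; apply/integrableP; split.
  by apply/measurable_EFinP; apply: measurableT_comp => //; exact: measurable_translate.
have /integrableP[_] := hf.
rewrite -(ge0_integral_translate_rV c (f := fun x => `|(f x)%:E|%E))//.
by apply: measurableT_comp => //; exact/measurable_EFinP.
Qed.


Lemma rV_compact_closed K : compact K -> closed K.
Proof. by apply: compact_closed; exact: norm_hausdorff. Qed.

Lemma Cc_bounded f K : continuous f -> compact K -> (forall x, ~ K x -> f x = 0) ->
  exists2 M, 0 <= M & forall x, `|f x| <= M.
Proof.
move=> cf cK fK.
have [K0|K0] := pselect (K !=set0); last first.
  exists 0 => // x; rewrite fK ?normr0// => Kx; by apply: K0; exists x.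
have [|c _ hc] := @compact_EVT_max _ R (fun x => `|f x|) K K0 cK.
  apply: continuous_subspaceT => x.
  by apply: (@continuous_comp _ _ _ f (fun r : R => `|r|)); [exact: cf|exact: norm_continuous].
exists `|f c| => // x; have [Kx|nKx] := pselect (K x).
  by apply: hc; rewrite inE.
by rewrite fK// normr0.
Qed.

Lemma Cc_L1 f K : continuous f -> compact K -> (forall x, ~ K x -> f x = 0) -> L1 f.
Proof.
move=> cf cK fK; have [M M0 fM] := Cc_bounded cf cK fK.
apply: (bounded_L1 _ fM _ _ fK); first exact: continuous_measurable_rV.
  by apply: closed_measurable_rV; exact: rV_compact_closed.
exact: compact_bounded.
Qed.

Lemma Cc_unif f K : continuous f -> compact K -> (forall x, ~ K x -> f x = 0) ->
  forall e, 0 < e -> exists2 t, 0 < t & forall x y, `|x - y| < t -> `|f x - f y| < e.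
Proof.
move=> cf cK fK e e0.
have [t t0 h] := heine_compact cK (fun x _ => cf x) e0.
exists t => // x y xy; have [Kx|nKx] := pselect (K x); first exact: h.
have [Ky|nKy] := pselect (K y); first by rewrite distrC; apply: h => //; rewrite distrC.
by rewrite !fK// subrr normr0.
Qed.

End integral_rV.

(** * Smooth functions *)

Section line_derivative.
Context {R : realType} {V : normedModType R}.
Implicit Types (F G : V -> R) (x v : V).

Lemma is_derive_line F x v l :
  is_derive x v F l <-> is_derive (0:R) (1:R) (fun h : R => F (h *: v + x)) l.
Proof.
have h : 'D_v F x = 'D_1 (fun h : R => F (h *: v + x)) 0.
  rewrite /derive; congr (lim _); set g1 := fun h => h^-1 *: _.
  set g2 := fun h => h^-1 *: _.
  suff -> : g1 = g2 by [].
  by rewrite funeqE /g1 /g2 => t /=; rewrite addr0 scale0r add0r [_%:A]mulr1.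
split=> -[dF DF]; split.
- by move/derivable1P : dF.
- by rewrite -h.
- by apply/derivable1P.
- by rewrite h.
Qed.

Lemma is_derive_line_at F x v l (t : R) :
  is_derive (t *: v + x) v F l <-> is_derive t (1:R) (fun h : R => F (h *: v + x)) l.
Proof.
rewrite is_derive_line; split => hd.
  have hs : is_derive t (1:R) (fun s : R => s - t) 1.
    by have := is_derive_shift t 1 (- t).
  have := @is_derive1_comp _ (fun h : R => F (h *: v + (t *: v + x))) (fun s => s - t) t l 1.
  rewrite subrr mulr1 => /(_ hd hs).
  congr (is_derive _ _ _ _); apply/funext => s /=.
  by rewrite addrA -scalerDl subrK.
have hs : is_derive (0:R) (1:R) (fun s : R => s + t) 1.
  by have := is_derive_shift (0:R) 1 t.
have := @is_derive1_comp _ (fun h : R => F (h *: v + x)) (fun s => s + t) 0 l 1.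
rewrite add0r mulr1 => /(_ hd hs).
congr (is_derive _ _ _ _); apply/funext => s /=.
by rewrite addrA -scalerDl.
Qed.

Lemma is_derive_comp1 (g : R -> R) F x v a l :
  is_derive (F x) (1:R) g a -> is_derive x v F l -> is_derive x v (g \o F) (a * l).
Proof.
move=> hg /is_derive_line hF; apply/is_derive_line.
apply: (@is_derive1_comp _ g (fun h => F (h *: v + x))) => //.
by rewrite scale0r add0r.
Qed.

Lemma is_derive_MVT F v (dF : V -> R) x (t : R) : 0 <= t ->
  (forall s : R, 0 <= s <= t -> is_derive (s *: v + x) v F (dF (s *: v + x))) ->
  exists2 s, 0 <= s <= t & F (t *: v + x) - F x = dF (s *: v + x) * t.
Proof.
move=> t0 hd.
have hd' s : s \in `]0, t[ -> is_derive s (1:R) (fun h => F (h *: v + x)) (dF (s *: v + x)).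
  by rewrite in_itv/= => /andP[s0 st]; apply/is_derive_line_at; apply: hd; rewrite !ltW.
have [|s] := MVT_segment t0 hd'; last first.
  by rewrite in_itv/= => sI; rewrite scale0r add0r subr0 => h; exists s.
apply: derivable_within_continuous => s; rewrite in_itv/= => sI.
by have /is_derive_line_at[] := hd s sI.
Qed.

End line_derivative.

Section smooth_step.
Context {R : realType}.
Implicit Types (f g : R -> R) (P : {poly R}).

Fixpoint Ck1 (k : nat) f : Prop :=
  if k is m.+1 then exists2 g, (forall x, is_derive x (1:R) f (g x)) & Ck1 m g
  else continuous f.

Lemma Ck1_continuous k f : Ck1 k f -> continuous f.
Proof.
case: k => [//|k] [g fg _] x.
by apply/differentiable_continuous/derivable1_diffP; have [] := fg x.
Qed.

Lemma Ck1S k f : Ck1 k.+1 f -> Ck1 k f.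
Proof.
elim: k f => [|k IH] f; first exact: Ck1_continuous.
by move=> [g fg /IH gk]; exists g.
Qed.

Lemma Ck1_cst k (a : R) : Ck1 k (cst a).
Proof.
elim: k a => [|k IH] a /=; first exact: cst_continuous.
by exists (cst 0) => // x; exact: is_derive_cst.
Qed.

Lemma Ck1D k f g : Ck1 k f -> Ck1 k g -> Ck1 k (f \+ g).
Proof.
elim: k f g => [|k IH] f g /=.
  by move=> cf cg x; apply: continuousD; [exact: cf|exact: cg].
move=> [f' ff' hf] [g' gg' hg]; exists (f' \+ g'); last exact: IH.
by move=> x; apply: is_deriveD.
Qed.

Lemma Ck1M k f g : Ck1 k f -> Ck1 k g -> Ck1 k (f \* g).
Proof.
elim: k f g => [|k IH] f g.
  by move=> cf cg x; apply: continuousM; [exact: cf|exact: cg].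
move=> hf hg; have fk := Ck1S hf; have gk := Ck1S hg.
move: hf hg => [f' ff' hf] [g' gg' hg]; exists ((f \* g') \+ (g \* f')).
  by move=> x; exact: is_deriveM.
by apply: Ck1D; apply: IH.
Qed.

Lemma Ck1N k f : Ck1 k f -> Ck1 k (\- f).
Proof.
elim: k f => [|k IH] f /=.
  by move=> cf x; apply: continuousN; exact: cf.
move=> [f' ff' hf]; exists (\- f'); last exact: IH.
by move=> x; apply: is_deriveN.
Qed.

Lemma Ck1V k f : (forall x, f x != 0) -> Ck1 k f -> Ck1 k (fun x => (f x)^-1).
Proof.
move=> f0; elim: k => [|k IH] /=.
  by move=> cf x; apply: cvgV; [exact: f0|exact: cf].
move=> hf; have fk := Ck1S hf; case: hf => f' ff' hf.
exists (\- ((fun x => (f x)^-1) \* ((fun x => (f x)^-1) \* f'))).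
  move=> x; apply: (is_derive_eq (is_deriveV (f0 x) (ff' x))).
  by rewrite /GRing.scale/= mulNr mulrA expr2 invfM.
by apply: Ck1N; apply: Ck1M; [exact: IH|apply: Ck1M => //; exact: IH].
Qed.

Lemma Ck1_affine k f a b : Ck1 k f -> Ck1 k (fun x => f (a * x + b)).
Proof.
elim: k f => [|k IH] f /=.
  move=> cf x; apply: (@continuous_comp _ _ _ (fun x => a * x + b) f); last exact: cf.
  by apply: continuousD; [exact: mulrl_continuous|exact: cst_continuous].
move=> [f' ff' hf]; exists ((cst a) \* (fun x => f' (a * x + b))).
  move=> x; rewrite /= mulrC; apply: (@is_derive1_comp _ f (fun x => a * x + b)) => //.
  have ha := is_deriveD (is_deriveZ a (is_derive_id x (1:R))) (is_derive_cst b x (1:R)).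
  by apply: (is_derive_eq ha); rewrite addr0 /GRing.scale/= mulr1.
by apply: Ck1M; [exact: Ck1_cst|exact: IH].
Qed.


(** The polynomial parameter makes the family closed under differentiation, so that all derivatives
    of [exp (-1/x)] are reached by one induction. *)
Definition flat P (x : R) : R := if 0 < x then P.[x^-1] * expR (- x^-1) else 0.

Let flat_pos P x : 0 < x -> flat P x = P.[x^-1] * expR (- x^-1).
Proof. by rewrite /flat => ->. Qed.

Let flat_neg P x : x <= 0 -> flat P x = 0.
Proof. by rewrite /flat leNgt => /negbTE ->. Qed.

Let horner_bound P : exists2 C, 0 <= C &
  forall y : R, 1 <= y -> `|P.[y]| <= C * y ^+ size P.
Proof.
exists (\sum_(i < size P) `|P`_i|); first exact: sumr_ge0.
move=> y y1; rewrite horner_coef mulr_suml (le_trans (ler_norm_sum _ _ _))//.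
apply: ler_sum => i _; rewrite normrM ler_wpM2l// normrX ger0_norm; last by lra.
by apply: ler_weXn2l => //; exact: ltnW.
Qed.

Let flat_bound P : exists2 C, 0 <= C & forall x, 0 < x <= 1 -> `|flat P x| <= C * x ^+ 2.
Proof.
have [C C0 hC] := horner_bound P.
(* From [exp y >= y^N / N!] with [y = 1/x], the two extra powers leave a factor [x^2]; this is what
   makes the difference quotient at [0] tend to [0]. *)
set N := (size P).+2.
exists (C * N`!%:R); first by rewrite mulr_ge0.
move=> x /andP[x0 x1]; rewrite flat_pos// normrM [`|expR _|]ger0_norm ?expR_ge0//.
have y1 : 1 <= x^-1 by rewrite invf_ge1.
have y0 : 0 < x^-1 by rewrite invr_gt0.
rewrite expRN.
have hE : x^-1 ^+ N / N`!%:R <= expR x^-1.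
  by have := expR_ge1Dxn (size P).+1 (ltW y0); rewrite -/N; lra.
have hE0 : 0 < x^-1 ^+ N / N`!%:R by rewrite divr_gt0 ?exprn_gt0// ltr0n fact_gt0.
apply: (@le_trans _ _ ((C * x^-1 ^+ size P) * (x^-1 ^+ N / N`!%:R)^-1)).
  by apply: ler_pM; rewrite ?invr_ge0 ?expR_ge0 ?hC// lef_pV2// posrE expR_gt0.
rewrite invf_div /N !exprVn invrK -addn2 exprD.
have xn0 : x ^+ size P != 0 by rewrite expf_neq0// gt_eqF.
by rewrite le_eqVlt; apply/orP; left; apply/eqP; field.
Qed.

(** With [y = 1/x], the derivative of [P(y) exp(-y)] in [x] is [y^2 (P(y) - P'(y)) exp(-y)]. *)
Definition flat_deriv P : {poly R} := 'X^2 * (P - P^`()).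

Let is_derive_flat P x : is_derive x (1:R) (flat P) (flat (flat_deriv P) x).
Proof.
have [x0|x0|->] := ltgtP x 0.
- rewrite (flat_neg (flat_deriv P) (ltW x0)).
  have hn : \near x, cst 0 x = flat P x.
    near=> z; rewrite flat_neg//; apply: ltW.
    by near: z; exact: lt_nbhsl.
  exact: (near_eq_is_derive hn (is_derive_cst (0:R) x (1:R))).
- rewrite flat_pos//.
  have hn : \near x, (fun z => P.[z^-1] * expR (- z^-1)) x = flat P x.
    near=> z; rewrite flat_pos//.
    by near: z; exact: lt_nbhsr.
  apply: (near_eq_is_derive hn).
  have xn0 : x != 0 by rewrite gt_eqF.
  have hV : is_derive x (1:R) (fun z : R => z^-1) (- x ^- 2).
    have := @is_deriveV _ id x _ _ xn0 (is_derive_id x (1:R)).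
    by rewrite /GRing.scale/= mulr1.
  have h1 := @is_derive1_comp _ (horner P) _ x _ _ (is_derive_poly P x^-1) hV.
  have h2 := @is_derive1_comp _ expR (fun z => - z^-1) x _ _ (is_derive_expR (- x^-1)) (is_deriveN hV).
  apply: (is_derive_eq (is_deriveM h1 h2)).
  rewrite /flat_deriv !hornerE /GRing.scale/= exprVn; ring.
- rewrite flat_neg//.
  have [C C0 hC] := flat_bound P.
  apply/is_derive1_caratheodory; exists (fun z => flat P z / z); split.
  + move=> z; rewrite [flat P 0]flat_neg// !subr0.
    have [->|z0] := eqVneq z 0; first by rewrite flat_neg// mulr0.
    by rewrite divfK.
  + rewrite /prop_for/= /continuous_at invr0 mulr0; apply/cvgrPdist_lt => e e0.
    near=> z; rewrite sub0r normrN.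
    have [z0|z0] := leP z 0; first by rewrite flat_neg// mul0r normr0.
    have z1 : z <= 1 by apply: ltW; near: z; apply: lt_nbhsl.
    have ze : z < e / (C + 1) by near: z; apply: lt_nbhsl; rewrite divr_gt0// ltr_wpDl.
    have hz := hC z _; rewrite z0 z1 in hz.
    rewrite normrM normfV [`|z|]gtr0_norm// ltr_pdivrMr//.
    rewrite (le_lt_trans (hz isT))// expr2 mulrA ltr_pM2r//.
    have : z * (C + 1) < e by rewrite -ltr_pdivlMr// ltr_wpDl.
    by rewrite mulrC; nra.
  + by rewrite invr0 mulr0.
Unshelve. all: by end_near. Qed.

Let Ck1_flat k P : Ck1 k (flat P).
Proof.
elim: k P => [|k IH] P; last by exists (flat (flat_deriv P)).
move=> x; apply/differentiable_continuous/derivable1_diffP.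
by have [] := is_derive_flat P x.
Qed.

Let e (x : R) := flat 1 x.

Let e_pos x : 0 < x -> 0 < e x.
Proof. by move=> x0; rewrite /e flat_pos// hornerC mul1r expR_gt0. Qed.

Let e_ge0 x : 0 <= e x.
Proof. by have [x0|x0] := leP x 0; [rewrite /e flat_neg|exact/ltW/e_pos]. Qed.

Let e_homo x y : x <= y -> e x <= e y.
Proof.
move=> xy; have [x0|x0] := leP x 0; first by rewrite {1}/e flat_neg// e_ge0.
have y0 := lt_le_trans x0 xy.
rewrite /e !flat_pos// !hornerC !mul1r ler_expR lerN2.
by rewrite lef_pV2.
Qed.

Let den_gt0 x : 0 < e x + e (1 - x).
Proof.
have [x0|x0] := leP x 0; first by rewrite ltr_wpDl// e_pos//; lra.
by rewrite ltr_pwDl// e_pos.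
Qed.

Definition sstep (x : R) : R := e x / (e x + e (1 - x)).

Lemma Ck1_sstep k : Ck1 k sstep.
Proof.
apply: (@Ck1M k e (fun x => (e x + e (1 - x))^-1)); first exact: (Ck1_flat k 1).
apply: Ck1V; first by move=> x; rewrite gt_eqF.
rewrite (_ : (fun x => _) = e \+ (fun x => e (-1 * x + 1))); last first.
  by apply/funext => x /=; rewrite mulN1r [- x + 1]addrC.
by apply: Ck1D; [exact: (Ck1_flat k 1)|apply: Ck1_affine; exact: (Ck1_flat k 1)].
Qed.

Lemma sstep_le0 x : x <= 0 -> sstep x = 0.
Proof. by move=> x0; rewrite /sstep /e flat_neg// mul0r. Qed.

Lemma sstep_ge1 x : 1 <= x -> sstep x = 1.
Proof.
move=> x1; rewrite /sstep (_ : e (1 - x) = 0); last by rewrite /e flat_neg//; lra.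
by rewrite addr0 divff// gt_eqF// e_pos//; lra.
Qed.

Lemma sstep_homo x y : x <= y -> sstep x <= sstep y.
Proof.
move=> xy; rewrite /sstep ler_pdivrMr// mulrAC ler_pdivlMr//.
have h1 := e_homo xy; have h2 : e (1 - y) <= e (1 - x) by apply: e_homo; lra.
rewrite !mulrDr [e y * e x]mulrC lerD2l.
by apply: ler_pM.
Qed.

Lemma sstep_ge0 x : 0 <= sstep x.
Proof. by rewrite divr_ge0// ltW. Qed.

Lemma sstep_le1 x : sstep x <= 1.
Proof. by rewrite ler_pdivrMr// mul1r lerDl. Qed.

End smooth_step.

Lemma compact_margin (R : realType) (n : nat) (K O : set 'rV[R]_n) :
  compact K -> open O -> K `<=` O ->
  exists2 r, 0 < r & forall x y, K x -> `|x - y| <= r -> O y.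
Proof.
move=> /compact_near_coveringP cK oO KO.
have := cK R 0^'+ (fun t x => forall y, `|x - y| <= t -> O y) _.
case=> [x Kx|t/= t0 h].
  have /nbhs_ballP[r/= r0 hr] := open_nbhs_nbhs (conj oO (KO _ Kx)).
  have r20 : 0 < r / 2 by rewrite divr_gt0.
  exists (ball x (r / 2), [set t | t < r / 2]) => /=.
    split; first exact: nbhsx_ballx.
    exact: nbhs_right_lt.
  move=> [y t] /= [xy tr] z yz; apply: hr.
  move: xy; rewrite mx_norm_ball /ball_/= => xy.
  by have := ler_distD y x z; lra.
exists (t / 2); first by rewrite divr_gt0.
move=> x y Kx xy; apply: (h (t / 2) _ _ x) => //=; last by rewrite divr_gt0.
by rewrite sub0r normrN gtr0_norm ?divr_gt0//; move: t0 => /=; lra.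
Qed.

Section enlarge.
Context {R : realType} {n : nat}.
Implicit Types K : set 'rV[R]_n.

Definition enlarge K (r : R) : set 'rV[R]_n :=
  [set x | exists2 z, K z & `|z - x| <= r].

Lemma compact_enlarge K r : compact K -> compact (enlarge K r).
Proof.
move=> cK.
have -> : enlarge K r = (fun p : 'rV[R]_n * 'rV[R]_n => p.1 - p.2) @`
    (K `*` [set x | `|x| <= r]).
  apply/seteqP; split=> x /=.
    by move=> [z Kz zx]; exists (z, z - x) => //=; rewrite subKr.
  by move=> [[z y]/= [Kz yr] <-]; exists z => //; rewrite subKr.
apply: continuous_compact.
  apply: continuous_subspaceT => p.
  by apply: continuousB; [exact: cvg_fst|exact: cvg_snd].
apply: compact_setX => //; apply: bounded_closed_compact.
  exists r; split; first exact: num_real.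
  by move=> M rM x /= xr; rewrite (le_trans xr)// ltW.
rewrite (_ : [set _ | _] = (fun x : 'rV[R]_n => `|x|) @^-1` [set t | t <= r])//.
by apply: closed_comp; [move=> x _; exact: norm_continuous|exact: closed_le].
Qed.

Lemma sub_enlarge K r : 0 <= r -> K `<=` enlarge K r.
Proof. by move=> r0 x Kx; exists x => //; rewrite subrr normr0. Qed.

End enlarge.

Section is_Ck_theory.
Context {R : realType} {d : nat}.
Local Notation V := 'rV[R]_d.
Implicit Types (U : set V) (f g : V -> R).
Local Notation e_ i := (delta_mx 0 i : V).

Lemma is_CkS_elim k U f : is_Ck k.+1 U f -> forall i,
  (forall x, U x -> is_derive x (e_ i) f (partial i f x)) /\ is_Ck k U (partial i f).
Proof.
move=> [_ h] i; have [h1 h2] := h i; split=> // x Ux.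
exact/derivableP/h1.
Qed.

Lemma is_Ck_continuous k U f : is_Ck k U f -> forall x, U x -> {for x, continuous f}.
Proof. by case: k => [|k] []. Qed.

Lemma is_CkW k U f : is_Ck k.+1 U f -> is_Ck k U f.
Proof.
elim: k f => [|k IH] f; first by case.
by move=> [cf h]; split=> // i; have [h1 h2] := h i; split=> //; exact: IH.
Qed.

Lemma is_Ck_eq k U f g : open U -> (forall x, U x -> f x = g x) ->
  is_Ck k U f -> is_Ck k U g.
Proof.
move=> oU; elim: k f g => [|k IH] f g fg.
  move=> [cf _]; split=> // x Ux.
  have nfg : \near x, f x = g x.
    by apply: filterS (open_nbhs_nbhs (conj oU Ux)) => y Uy; exact: fg.
  rewrite /prop_for /continuous_at -fg//.
  by apply: cvg_trans (cf x Ux); exact: (near_eq_cvg nfg).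
have nfg x : U x -> \near x, f x = g x.
  by move=> Ux; apply: filterS (open_nbhs_nbhs (conj oU Ux)) => y Uy; exact: fg.
move=> hf; split.
  by move=> x Ux; exact: (is_Ck_continuous (IH f g fg (is_CkW hf))) Ux.
move=> i; have [h1 h2] := is_CkS_elim hf i; split.
  by move=> x Ux; have [] := near_eq_is_derive (nfg x Ux) (h1 x Ux).
apply: IH h2 => x Ux.
by have [_ /esym] := near_eq_is_derive (nfg x Ux) (h1 x Ux).
Qed.

(** Regularity from explicit candidates for the derivatives: as [U] is open, a candidate agrees with
    [partial i f] near each point of [U], hence has the same derivatives there. *)
Lemma is_CkS_intro k U f : open U -> (forall x, U x -> {for x, continuous f}) ->
  (forall i, exists2 g, (forall x, U x -> is_derive x (e_ i) f (g x)) & is_Ck k U g) ->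
  is_Ck k.+1 U f.
Proof.
move=> oU cf h; split=> // i; have [g g1 g2] := h i; split.
  by move=> x Ux; have [] := g1 x Ux.
by apply: is_Ck_eq g2 => // x Ux; have [_ /esym] := g1 x Ux.
Qed.

Lemma is_Ck_cst k U a : open U -> is_Ck k U (cst a).
Proof.
move=> oU; elim: k a => [|k IH] a.
  by split=> // x _; exact: cst_continuous.
apply: is_CkS_intro => //; first by move=> x _; exact: cst_continuous.
by move=> i; exists (cst 0) => // x _; exact: is_derive_cst.
Qed.

Lemma is_CkD k U f g : open U -> is_Ck k U f -> is_Ck k U g -> is_Ck k U (f \+ g).
Proof.
move=> oU; elim: k f g => [|k IH] f g hf hg.
  split=> // x Ux; apply: continuousD; [exact: (is_Ck_continuous hf)|exact: (is_Ck_continuous hg)].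
apply: is_CkS_intro => //.
  move=> x Ux; apply: continuousD; [exact: (is_Ck_continuous hf)|exact: (is_Ck_continuous hg)].
move=> i; have [f1 f2] := is_CkS_elim hf i; have [g1 g2] := is_CkS_elim hg i.
exists (partial i f \+ partial i g); last exact: IH.
by move=> x Ux; apply: is_deriveD; [exact: f1|exact: g1].
Qed.

Lemma is_CkM k U f g : open U -> is_Ck k U f -> is_Ck k U g -> is_Ck k U (f \* g).
Proof.
move=> oU; elim: k f g => [|k IH] f g hf hg.
  split=> // x Ux; apply: continuousM; [exact: (is_Ck_continuous hf)|exact: (is_Ck_continuous hg)].
apply: is_CkS_intro => //.
  move=> x Ux; apply: continuousM; [exact: (is_Ck_continuous hf)|exact: (is_Ck_continuous hg)].
move=> i; have [f1 f2] := is_CkS_elim hf i; have [g1 g2] := is_CkS_elim hg i.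
exists ((f \* partial i g) \+ (g \* partial i f)).
  by move=> x Ux; apply: is_deriveM; [exact: f1|exact: g1].
by apply: is_CkD => //; apply: IH => //; exact: is_CkW.
Qed.

Lemma is_Ck_sum k U (I : Type) (s : seq I) (F : I -> V -> R) : open U ->
  (forall i, is_Ck k U (F i)) -> is_Ck k U (fun x => \sum_(i <- s) F i x).
Proof.
move=> oU hF; elim: s => [|i s IH].
  rewrite (_ : (fun _ => _) = cst 0); first exact: is_Ck_cst.
  by apply/funext => x; rewrite big_nil.
rewrite (_ : (fun _ => _) = F i \+ (fun x => \sum_(i <- s) F i x)).
  exact: is_CkD.
by apply/funext => x; rewrite big_cons.
Qed.

Lemma is_Ck_prod k U (I : Type) (s : seq I) (F : I -> V -> R) : open U ->
  (forall i, is_Ck k U (F i)) -> is_Ck k U (fun x => \prod_(i <- s) F i x).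
Proof.
move=> oU hF; elim: s => [|i s IH].
  rewrite (_ : (fun _ => _) = cst 1); first exact: is_Ck_cst.
  by apply/funext => x; rewrite big_nil.
rewrite (_ : (fun _ => _) = F i \* (fun x => \prod_(i <- s) F i x)).
  exact: is_CkM.
by apply/funext => x; rewrite big_cons.
Qed.

Lemma is_derive_coord (j i : 'I_d) (x : V) :
  is_derive x (e_ i) (fun x : V => x 0 j) (j == i)%:R.
Proof.
apply/is_derive_line.
rewrite (_ : (fun h : R => _) = (fun h : R => (j == i)%:R * h + x 0 j)); last first.
  by apply/funext => h; rewrite !mxE eqxx/= mulrC.
have ha := is_deriveD (is_deriveZ ((j == i)%:R : R) (is_derive_id (0:R) (1:R)))
  (is_derive_cst (x 0 j) (0:R) (1:R)).
by apply: (is_derive_eq ha); rewrite addr0 /GRing.scale/= mulr1.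
Qed.

Lemma is_Ck_coord k (f : R -> R) (j : 'I_d) : Ck1 k f ->
  is_Ck k setT (fun x : V => f (x 0 j)).
Proof.
have ccoord (x : V) : {for x, continuous (fun x : V => x 0 j)}.
  exact: coord_continuous.
elim: k f => [|k IH] f.
  move=> cf; split=> // x _.
  by apply: (@continuous_comp _ _ _ (fun x : V => x 0 j) f); [exact: ccoord|exact: cf].
move=> hf; have cf := Ck1_continuous hf; move: hf => [g fg gk].
apply: is_CkS_intro; first exact: openT.
  by move=> x _; apply: (@continuous_comp _ _ _ (fun x : V => x 0 j) f); [exact: ccoord|exact: cf].
move=> i; exists ((fun x => g (x 0 j)) \* cst (j == i)%:R).
  by move=> x _; apply: (@is_derive_comp1 _ _ f (fun x : V => x 0 j)) => //; exact: is_derive_coord.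
by apply: is_CkM; [exact: openT|exact: IH|exact/is_Ck_cst/openT].
Qed.

Lemma smooth_continuous f : smooth f -> continuous f.
Proof. by move=> /(_ 0%N) /is_Ck_continuous h x; exact: h. Qed.

Lemma smooth_partial f i : smooth f -> smooth (partial i f).
Proof. by move=> sf k; have [_] := is_CkS_elim (sf k.+1) i. Qed.

Lemma smooth_is_derive f i x : smooth f -> is_derive x (e_ i) f (partial i f x).
Proof. by move=> sf; have [h _] := is_CkS_elim (sf 1%N) i; exact: h. Qed.

Lemma is_derive_shifted f v (x c : V) l :
  is_derive (x + c) v f l -> is_derive x v (fun x => f (x + c)) l.
Proof.
move=> /is_derive_line h; apply/is_derive_line.
rewrite (_ : (fun _ => _) = (fun h : R => f (h *: v + (x + c))))//.
by apply/funext => t; rewrite addrA.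
Qed.

Lemma is_Ck_shift k f (c : V) : is_Ck k setT f -> is_Ck k setT (fun x => f (x + c)).
Proof.
have cshift (g : V -> R) : continuous g -> continuous (fun x : V => g (x + c)).
  move=> cg x; apply: (@continuous_comp _ _ _ (fun x : V => x + c) g).
    by apply: continuousD; [exact: cvg_id|exact: cst_continuous].
  exact: cg.
elim: k f => [|k IH] f hf.
  by split=> // x _; apply: cshift => y; exact: (is_Ck_continuous hf).
apply: is_CkS_intro; first exact: openT.
  by move=> x _; apply: cshift => y; exact: (is_Ck_continuous hf).
move=> i; have [f1 f2] := is_CkS_elim hf i.
exists (fun x => partial i f (x + c)); last exact: IH.
by move=> x _; apply: is_derive_shifted; exact: f1.
Qed.

Lemma smooth_shift f (c : V) : smooth f -> smooth (fun x => f (x + c)).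
Proof. by move=> sf k; exact: is_Ck_shift. Qed.

Lemma partial_shift f (c : V) i x : smooth f ->
  partial i (fun x => f (x + c)) x = partial i f (x + c).
Proof.
by move=> sf; have [_] := is_derive_shifted (smooth_is_derive i (x + c) sf).
Qed.

End is_Ck_theory.

(** * Uniform approximation by smooth functions with nearby support *)

Section smooth_approximation.
Context {R : realType} {d : nat}.
Local Notation V := 'rV[R]_d.

Let bump (t a : R) := sstep (t - a) - sstep (t - a - 1).

Let bump_ge0 t a : 0 <= bump t a.
Proof. by rewrite subr_ge0 sstep_homo//; lra. Qed.

Let bump_supp t a : bump t a != 0 -> `|t - a| <= 2.
Proof.
rewrite /bump => h; rewrite ler_norml; apply/andP; split.
  rewrite leNgt; apply/negP => h1; move: h; rewrite !sstep_le0 ?subrr ?eqxx//; lra.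
rewrite leNgt; apply/negP => h1; move: h; rewrite !sstep_ge1 ?subrr ?eqxx//; lra.
Qed.

Let sum_bump (t : R) (N M : nat) :
  \sum_(j < M) bump t (j%:R - N%:R) = sstep (t + N%:R) - sstep (t + N%:R - M%:R).
Proof.
elim: M => [|M IH]; first by rewrite big_ord0 subr0 subrr.
rewrite big_ord_recr/= IH /bump opprB addrA.
rewrite (_ : t + N%:R - M.+1%:R = t + N%:R - M%:R - 1); last by rewrite -natr1; lra.
by rewrite addrA subrK.
Qed.

(* Quasi-interpolation on a cubic grid: products of one-dimensional smooth bumps
   whose integer translates add up to [1]. *)
Lemma smooth_approx (B : V -> R) (K : set V) (e r : R) :
  continuous B -> compact K -> (forall x, ~ K x -> B x = 0) -> 0 < e -> 0 < r ->
  exists phi : V -> R, [/\ smooth phi, (forall x, `|phi x - B x| <= e) &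
    forall x, ~ enlarge K r x -> phi x = 0].
Proof.
move=> cB cK BK e0 r0.
have [t t0 ht] := Cc_unif cB cK BK e0.
(* Mesh of the grid. A bump reaches at most [2 * D] from its node: this is below [t], so [B] varies
   by less than [e] there, and at most [r], so the support stays in [enlarge K r]. *)
pose D := Num.min t r / 3.
have D0 : 0 < D by rewrite divr_gt0// lt_min t0 r0.
have Dt : 2 * D < t.
  have : Num.min t r <= t by rewrite ge_min lexx.
  by rewrite /D; lra.
have Dr : 2 * D <= r.
  have : Num.min t r <= r by rewrite ge_min lexx orbT.
  by rewrite /D; lra.
have [L L0 KL] : exists2 L, 0 <= L & forall x, K x -> `|x| <= L.
  have [L [_ hL]] := compact_bounded cK.
  exists (`|L| + 1); first by rewrite addr_ge0.
  by move=> x Kx; apply: hL => //; rewrite (le_lt_trans (ler_norm _))// ltrDl.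
(* The grid must exceed [K] by [3 * D]: the weights add up to [1] only up to distance [D] from its
   edge, and beyond that no bump whose node lies in [K] may be felt. *)
pose N := (Num.truncn (L / D) + 4)%N.
have NL : L + 3 * D <= N%:R * D.
  have : L / D < (Num.truncn (L / D)).+1%:R by exact: truncnS_gt.
  rewrite ltr_pdivrMr// /N -natr1 natrD => h; nra.
pose M := (N + N)%N.
pose node (j : {ffun 'I_d -> 'I_M}) : V := \row_i (D * ((j i)%:R - N%:R)).
pose w (j : {ffun 'I_d -> 'I_M}) (x : V) := \prod_i bump (x 0 i / D) ((j i)%:R - N%:R).
pose phi x := \sum_j B (node j) * w j x.
have w_ge0 j x : 0 <= w j x by apply: prodr_ge0 => i _.
have w_supp j x : w j x != 0 -> `|node j - x| <= 2 * D.
  move=> wn0; apply/rV_norm_leP; first by rewrite mulr_ge0// ltW.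
  move=> i; rewrite !mxE.
  have /bump_supp : bump (x 0 i / D) ((j i)%:R - N%:R) != 0.
    by apply: contra_neq wn0 => h0; rewrite /w (bigD1 i)//= h0 mul0r.
  rewrite distrC => h.
  have -> : D * ((j i)%:R - N%:R) - x 0 i = D * ((j i)%:R - N%:R - x 0 i / D).
    by field; rewrite gt_eqF.
  by rewrite normrM gtr0_norm// mulrC ler_pM2r.
have w_sum (x : V) : (forall i, `|x 0 i| <= N%:R * D - D) -> \sum_j w j x = 1.
  move=> hx; transitivity (\prod_(i < d) \sum_(j < M) bump (x 0 i / D) (j%:R - N%:R)).
    by rewrite bigA_distr_bigA.
  apply: big1 => i _; rewrite (sum_bump (x 0 i / D) N M).
  have := hx i; rewrite ler_norml => /andP[h1 h2].
  have h3 : - N%:R + 1 <= x 0 i / D by rewrite ler_pdivlMr//; lra.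
  have h4 : x 0 i / D <= N%:R - 1 by rewrite ler_pdivrMr//; lra.
  rewrite sstep_ge1; last by lra.
  by rewrite sstep_le0 ?subr0// /M natrD; lra.
have phi_out x : ~ enlarge K (2 * D) x -> phi x = 0.
  move=> nx; apply: big1 => j _.
  have [->|wn0] := eqVneq (w j x) 0; first by rewrite mulr0.
  rewrite BK ?mul0r// => Kj; apply: nx; exists (node j) => //; exact: w_supp.
exists phi; split.
- move=> k; apply: is_Ck_sum; first exact: openT.
  move=> j; apply: is_CkM; [exact: openT|exact/is_Ck_cst/openT|].
  apply: is_Ck_prod; first exact: openT.
  move=> i; apply: (is_Ck_coord (f := fun t => bump (t / D) ((j i)%:R - N%:R))).
  rewrite /bump; apply: (@Ck1D _ _ (fun t => sstep (t / D - ((j i)%:R - N%:R)))).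
    rewrite (_ : (fun _ => _) = (fun x => sstep (D^-1 * x + (- ((j i)%:R - N%:R))))).
      by apply: Ck1_affine; exact: Ck1_sstep.
    by apply/funext => x; rewrite [x / D]mulrC.
  apply: Ck1N.
  rewrite (_ : (fun _ => _) = (fun x => sstep (D^-1 * x + (- ((j i)%:R - N%:R) - 1)))).
    by apply: Ck1_affine; exact: Ck1_sstep.
  by apply/funext => x; rewrite [x / D]mulrC addrA.
- move=> x; have [hx|hx] := pselect (forall i, `|x 0 i| <= N%:R * D - D).
    rewrite -[B x]mulr1 -(w_sum x hx) mulr_sumr /phi -sumrB.
    rewrite (le_trans (ler_norm_sum _ _ _))// -[e]mulr1 -(w_sum x hx) mulr_sumr.
    apply: ler_sum => j _; rewrite -mulrBl normrM [`|w j x|]ger0_norm//.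
    have [->|wn0] := eqVneq (w j x) 0; first by rewrite !mulr0.
    rewrite ler_wpM2r// ltW// ht//.
    by rewrite (le_lt_trans (w_supp _ _ wn0)).
  have nx : ~ enlarge K (2 * D) x.
    move=> [z Kz zx]; apply: hx => i.
    have h1 := le_trans (rV_coord_le_norm z i) (KL _ Kz).
    have := le_trans (rV_coord_le_norm (z - x) i) zx; rewrite !mxE => h2.
    have := ler_distD (z 0 i) 0 (x 0 i); rewrite !sub0r !normrN => h3.
    by lra.
  rewrite phi_out// BK ?subrr ?normr0 ?ltW// => Kx.
  by apply: nx; apply: sub_enlarge => //; rewrite mulr_ge0// ltW.
- move=> x nx; apply: phi_out => -[z Kz zx]; apply: nx; exists z => //.
  exact: le_trans zx Dr.
Qed.

End smooth_approximation.

(** * Weak derivatives as limits of difference quotients *)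

Section difference_quotient.
Context {R : realType} {d : nat}.
Local Notation V := 'rV[R]_d.
Local Notation e_ i := (delta_mx 0 i : V).
Implicit Types (O K : set V) (f g h B : V -> R).

Definition Cc O B := continuous B /\
  exists K, [/\ compact K, K `<=` O & forall x, ~ K x -> B x = 0].

Lemma contM f g : continuous f -> continuous g -> continuous (fun x => f x * g x).
Proof. by move=> cf cg x; apply: continuousM; [exact: cf|exact: cg]. Qed.

Lemma contD f g : continuous f -> continuous g -> continuous (fun x => f x + g x).
Proof. by move=> cf cg x; apply: continuousD; [exact: cf|exact: cg]. Qed.

Lemma contB f g : continuous f -> continuous g -> continuous (fun x => f x - g x).
Proof. by move=> cf cg x; apply: continuousB; [exact: cf|exact: cg]. Qed.

Lemma cont_cst (a : R) : continuous (fun _ : V => a).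
Proof. exact: cst_continuous. Qed.

Lemma contV f : (forall x, f x != 0) -> continuous f -> continuous (fun x => (f x)^-1).
Proof. by move=> f0 cf x; exact: (@cvgV _ _ _ _ f (f x) (f0 x) (cf x)). Qed.

Lemma cont_norm f : continuous f -> continuous (fun x => `|f x|).
Proof.
move=> cf x; apply: (@continuous_comp _ _ _ f (fun r : R => `|r|)); first exact: cf.
exact: norm_continuous.
Qed.

Lemma Cc_continuous O B : Cc O B -> continuous B.
Proof. by case. Qed.

Lemma Cc_is_L1 O B : Cc O B -> L1 B.
Proof. by move=> [cB [K [cK _ BK]]]; exact: Cc_L1 BK. Qed.

Lemma CcW O O' B : O `<=` O' -> Cc O B -> Cc O' B.
Proof. by move=> OO [cB [K [cK KO BK]]]; split=> //; exists K; split=> // x /KO /OO. Qed.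

Lemma CcMl O f B : open O -> (forall x, O x -> {for x, continuous f}) -> Cc O B ->
  Cc O (fun x => f x * B x).
Proof.
move=> oO cf [cB [K [cK KO BK]]]; split; last first.
  by exists K; split=> // x /BK ->; rewrite mulr0.
move=> x; have [Kx|nKx] := pselect (K x).
  by apply: continuousM; [exact/cf/KO|exact: cB].
have nK : nbhs x (~` K).
  by apply: open_nbhs_nbhs; split=> //; apply: closed_openC; exact: rV_compact_closed.
rewrite /continuous_at BK// mulr0.
have h : \near x, cst 0 x = f x * B x.
  by apply: filterS nK => y /= nKy; rewrite BK// mulr0.
by apply: cvg_trans (near_eq_cvg h) _; exact: cvg_cst.
Qed.

Lemma continuous_shift f (c : V) : continuous f -> continuous (fun x : V => f (x + c)).
Proof.
move=> cf x; apply: (@continuous_comp _ _ _ (fun x : V => x + c) f); last exact: cf.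
by apply: continuousD; [exact: cvg_id|exact: cst_continuous].
Qed.

Definition dq (i : 'I_d) h (t : R) (x : V) : R := (h (x + t *: e_ i) - h x) / t.

Lemma dq_continuous i h t : continuous h -> continuous (dq i h t).
Proof.
have -> : dq i h t = (fun x => h (x + t *: e_ i) - h x) \* cst t^-1 by [].
move=> ch x; apply: continuousM; last exact: cst_continuous.
by apply: continuousB; [exact: (@continuous_shift h (t *: e_ i) ch)|exact: ch].
Qed.

(* [H] is the weak [i]-th derivative of [h] on [O], seen as a limit of difference
   quotients.  Tests need only be continuous, and the bound of the last clause
   makes the notion stable under [h |-> (h^+)^2]. *)
Definition has_dq O (i : 'I_d) h (H : V -> R) : Prop :=
  [/\ continuous h,
      forall B, Cc O B -> L1 (fun x => H x * B x),
      forall B, Cc O B -> forall e, 0 < e -> exists2 t0, 0 < t0 &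
        forall t, 0 < t < t0 ->
          `|intg (fun x => dq i h t x * B x) - intg (fun x => H x * B x)| <= e &
      forall B, Cc O B -> (forall x, 0 <= B x) -> exists C, exists2 t0, 0 < t0 &
        forall t, 0 < t < t0 -> intg (fun x => `|dq i h t x| * B x) <= C].

Lemma dq_Cc O i h t B : continuous h -> Cc O B -> Cc O (fun x => dq i h t x * B x).
Proof.
move=> ch [cB [K [cK KO BK]]]; split.
  by move=> x; apply: continuousM; [exact: dq_continuous|exact: cB].
by exists K; split=> // x /BK ->; rewrite mulr0.
Qed.

(** Discrete integration by parts: translation invariance moves the shift from [h] to [B]. *)
Lemma intg_dq i h t B : continuous h -> Cc setT B ->
  intg (fun x => dq i h t x * B x) =
  intg (fun x => h x * ((B (x - t *: e_ i) - B x) / t)).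
Proof.
move=> ch CB; have cB := Cc_continuous CB.
have L (f : V -> R) : continuous f -> L1 (fun x => f x * B x).
  by move=> cf; apply: (@Cc_is_L1 setT); apply: CcMl; [exact: openT|move=> x _; exact: cf|].
pose F x := h (x + t *: e_ i) * B x.
have LF : L1 F by apply: L; exact: continuous_shift.
have LhB : L1 (fun x => h x * B x) by exact: L.
have -> : (fun x => dq i h t x * B x) = (fun x => t^-1 * (F x - h x * B x)).
  by apply/funext => x; rewrite /dq /F; ring.
have -> : (fun x => h x * ((B (x - t *: e_ i) - B x) / t)) =
    (fun x => t^-1 * (F (x - t *: e_ i) - h x * B x)).
  by apply/funext => x; rewrite /F subrK; ring.
have LF' : L1 (fun x => F (x - t *: e_ i)) by exact: L1_translate.
rewrite intgZ; last exact: L1B.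
rewrite [RHS]intgZ; last exact: L1B.
by rewrite intgB// intgB// intg_translate.
Qed.

(** [C] is the integral of [|f|] over [K]. Being independent of [g], it turns uniform smallness of
    tests supported in [K] into smallness of integrals. *)
Lemma intg_supp_bound f K : continuous f -> compact K -> exists2 C, 0 <= C &
  forall g c, measurable_fun setT g -> (forall x, `|g x| <= c) ->
    (forall x, ~ K x -> g x = 0) ->
    L1 (fun x => f x * g x) /\ `|intg (fun x => f x * g x)| <= c * C.
Proof.
move=> cf cK.
have mK : measurable K by apply: closed_measurable_rV; exact: rV_compact_closed.
pose fK x : R := f x * \1_K x.
have mfK : measurable_fun setT fK.
  by apply: measurable_funM; [exact: continuous_measurable_rV|exact: measurable_indic].
have [M M0 fM] : exists2 M, 0 <= M & forall x, `|fK x| <= M.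
  have [K0|K0] := pselect (K !=set0); last first.
    exists 0 => // x; rewrite /fK indicE memNset ?mulr0 ?normr0// => Kx.
    by apply: K0; exists x.
  have [|c _ hc] := @compact_EVT_max _ R (fun x => `|f x|) K K0 cK.
    apply: continuous_subspaceT => x.
    by apply: (@continuous_comp _ _ _ f (fun r : R => `|r|)); [exact: cf|exact: norm_continuous].
  exists `|f c| => // x; rewrite /fK indicE; case: (boolP (x \in K)) => Kx.
    by rewrite mulr1; exact: hc.
  by rewrite mulr0 normr0.
have LfK : L1 fK.
  apply: (bounded_L1 mfK fM mK); first exact: compact_bounded.
  by move=> x nK; rewrite /fK indicE memNset ?mulr0.
exists (intg (fun x => `|fK x|)); first exact: intg_ge0.
move=> g c mg gc gK.
have -> : (fun x => f x * g x) = (fun x => fK x * g x).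
  apply/funext => x; rewrite /fK indicE; case: (boolP (x \in K)) => Kx.
    by rewrite mulr1.
  by rewrite gK ?mulr0//; move/negP: Kx; rewrite inE.
by split; [exact: L1M gc|exact: intgM_le].
Qed.

(** Mean value theorem along [e_ i], with [B'] uniformly continuous. A negative [t] is reduced to a
    positive one by starting from the shifted point. *)
Lemma unif_diff (i : 'I_d) B (B' : V -> R) K :
  (forall x, is_derive x (e_ i) B (B' x)) -> continuous B' -> compact K ->
  (forall x, ~ K x -> B' x = 0) ->
  forall e, 0 < e -> exists2 t0, 0 < t0 & forall (x : V) t, `|t| < t0 ->
    `|B (x + t *: e_ i) - B x - t * B' x| <= e * `|t|.
Proof.
move=> dB cB' cK BK e e0.
have [t0 t00 ht] := Cc_unif cB' cK BK e0.
have pos (x : V) t s : 0 <= t -> t < t0 -> 0 <= s <= t ->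
    `|B (x + t *: e_ i) - B x - t * B' (x + s *: e_ i)| <= e * t.
  move=> tge tt0 /andP[s0 st].
  have [s' /andP[s'0 s't] hs] := @is_derive_MVT _ _ B (e_ i) B' x t tge (fun s _ => dB _).
  rewrite [x + t *: _]addrC hs mulrC -mulrBr normrM (ger0_norm tge) mulrC ler_wpM2r//.
  apply/ltW/ht.
  rewrite [s' *: _ + x]addrC opprD addrACA subrr add0r -scalerBl norm_shift_delta.
  by rewrite ltr_norml; apply/andP; split; lra.
exists t0 => // x t tt0.
have [tge|tlt] := leP 0 t.
  have := pos x t 0 tge; rewrite scale0r addr0 lexx tge (ger0_norm tge).
  by apply => //; move: tt0; rewrite ger0_norm.
have nt0 : 0 <= - t by lra.
have := pos (x + t *: e_ i) (- t) (- t) nt0.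
rewrite scaleNr addrK lexx nt0/= -(ltr0_norm tlt).
move=> /(_ tt0 isT); rewrite -normrN; congr (`|_| <= _).
by rewrite (ltr0_norm tlt); ring.
Qed.

Lemma partial_supp (i : 'I_d) B (B' : V -> R) K : (forall x, is_derive x (e_ i) B (B' x)) ->
  closed K -> (forall x, ~ K x -> B x = 0) -> forall x, ~ K x -> B' x = 0.
Proof.
move=> dB cK BK x nKx.
have nK : nbhs x (~` K) by apply: open_nbhs_nbhs; split=> //; exact: closed_openC.
have h : \near x, B x = cst 0 x by apply: filterS nK => y /= nKy; rewrite BK.
have [_ h1] := near_eq_is_derive h (dB x).
by have [_ h2] := is_derive_cst (0:R) x (e_ i); rewrite -h1 h2.
Qed.

(** After [intg_dq] the quotients of [B] converge uniformly to [- B'] with supports in a fixed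
    compact set. The test needs a single continuous partial derivative, which is all that the flux
    of the p-Laplacian offers. *)
Lemma has_dq_ibp O i g (Gm : V -> R) B (B' : V -> R) : has_dq O i g Gm -> Cc O B ->
  (forall x, is_derive x (e_ i) B (B' x)) -> continuous B' ->
  intg (fun x => g x * B' x) = - intg (fun x => Gm x * B x).
Proof.
move=> [cg _ hconv _] CB dB cB'.
have CBT : Cc setT B by exact: CcW CB.
have [cB [K [cK KO BK]]] := CB.
have B'K := partial_supp dB (rV_compact_closed cK) BK.
have CB'T : Cc setT B' by split=> //; exists K.
pose K1 := enlarge K 1.
have cK1 : compact K1 by exact: compact_enlarge.
have [C C0 hC] := intg_supp_bound cg cK1.
apply/eqP; rewrite -subr_eq0 -normr_le0; apply/ler_addgt0Pr => e e0; rewrite add0r.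
have e1 : 0 < e / (2 * (C + 1)) by rewrite divr_gt0// mulr_gt0// ltr_wpDl.
have e2 : 0 < e / 2 by rewrite divr_gt0.
have [t1 t10 ht1] := unif_diff dB cB' cK B'K e1.
have [t2 t20 ht2] := hconv B CB _ e2.
pose t := Num.min 1 (Num.min t1 t2) / 2.
have m0 : 0 < Num.min 1 (Num.min t1 t2) by rewrite !lt_min ltr01 t10 t20.
have t0 : 0 < t by rewrite divr_gt0.
have tm : t < Num.min 1 (Num.min t1 t2) by rewrite /t; lra.
have [tl1 tl2 tl3] : [/\ t < 1, t < t1 & t < t2].
  by move: tm; rewrite !lt_min => /and3P[].
have := ht2 t; rewrite t0 tl3 => /(_ isT); rewrite (intg_dq i t cg CBT).
set A := intg _; set D := intg _ => hAD; rewrite opprK.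
set G' := intg _.
have hG : `|A + G'| <= e / 2.
  pose f x := (B (x - t *: e_ i) - B x) / t + B' x.
  have mf : measurable_fun setT f.
    apply: continuous_measurable_rV => x.
    have -> : f = ((fun x => B (x - t *: e_ i) - B x) \* cst t^-1) \+ B' by [].
    apply: continuousD; last exact: cB'.
    apply: continuousM; last exact: cst_continuous.
    by apply: continuousB; [exact: (@continuous_shift B (- (t *: e_ i)) cB)|exact: cB].
  have fe x : `|f x| <= e / (2 * (C + 1)).
    have -> : f x = (B (x + (- t) *: e_ i) - B x - (- t) * B' x) / t.
      by rewrite /f scaleNr; field; rewrite gt_eqF.
    rewrite normrM normfV (gtr0_norm t0) ler_pdivrMr//.
    by have := ht1 x (- t); rewrite normrN (gtr0_norm t0); apply.
  have fK x : ~ K1 x -> f x = 0.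
    move=> nK; rewrite /f BK; last first.
      move=> Kx; apply: nK; exists (x - t *: e_ i) => //.
      by rewrite addrAC subrr add0r normrN norm_shift_delta gtr0_norm// ltW.
    have nKx : ~ K x by move=> Kx; apply: nK; apply: sub_enlarge.
    by rewrite BK// B'K// subrr mul0r addr0.
  have [_ hb] := hC f _ mf fe fK.
  have -> : A + G' = intg (fun x => g x * f x).
    rewrite /A /G' -intgD.
    - by apply: eq_intg => x; rewrite /f mulrDr.
    - apply: (@Cc_is_L1 setT); split.
        apply: contM => //; apply: contM; last exact: cont_cst.
        by apply: contB => //; exact: continuous_shift.
      exists K1; split=> // x nK; have := fK x nK; rewrite /f B'K ?addr0; last first.
        by move=> Kx; apply: nK; apply: sub_enlarge.
      by move=> ->; rewrite mulr0.
    - by apply: (@Cc_is_L1 setT); apply: CcMl; [exact: openT|move=> x _; exact: cg|].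
  apply: (le_trans hb); rewrite mulrAC ler_pdivrMr ?mulr_gt0 ?ltr_wpDl//.
  have -> : e / 2 * (2 * (C + 1)) = e * C + e by field.
  by rewrite lerDl ltW.
have -> : G' + D = (A + G') - (A - D) by ring.
by rewrite (le_trans (ler_normB _ _))//; lra.
Qed.

End difference_quotient.

Lemma is_derive_eps (R : realType) (F : R -> R) (x l : R) :
  (forall e, 0 < e -> exists2 t0, 0 < t0 & forall t, `|t| < t0 ->
     `|F (x + t) - F x - t * l| <= e * `|t|) -> is_derive x (1:R) F l.
Proof.
move=> h.
have hc : h^-1 *: (F (h *: (1:R) + x) - F x) @[h --> 0^'] --> l.
  apply/cvgrPdist_le => e e0; have [t0 t00 ht] := h e e0.
  near=> t.
  have tn0 : t != 0 by near: t; exact: nbhs_dnbhs_neq.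
  have tt0 : `|t| < t0 by near: t; apply: dnbhs0_lt.
  rewrite distrC [t *: _]mulr1 [t + x]addrC /GRing.scale/=.
  have -> : t^-1 * (F (x + t) - F x) - l = (F (x + t) - F x - t * l) / t by field.
  by rewrite normrM normfV ler_pdivrMr ?normr_gt0// ht.
by split; [apply/cvg_ex; exists l|exact: cvg_lim].
Unshelve. all: by end_near. Qed.

Section has_dq_theory.
Context {R : realType} {d : nat}.
Local Notation V := 'rV[R]_d.
Local Notation e_ i := (delta_mx 0 i : V).
Implicit Types (O K : set V) (f g h B u : V -> R).

Lemma Cc_shift O K f c : continuous f -> compact K -> (forall x, ~ K x -> f x = 0) ->
  (forall x y, K x -> `|x - y| <= `|c| -> O y) -> Cc O (fun x => f (x - c)).
Proof.
move=> cf cK fK hO; split; first exact: continuous_shift.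
exists (enlarge K `|c|); split; first exact: compact_enlarge.
  by move=> x [z Kz zx]; exact: hO zx.
move=> x nx; apply: fK => Kx; apply: nx; exists (x - c) => //.
by rewrite addrAC subrr add0r normrN.
Qed.

Lemma continuous_Cc_L1 f B O : continuous f -> Cc O B -> L1 (fun x => f x * B x).
Proof.
move=> cf CB; apply: (@Cc_is_L1 _ _ setT).
by apply: CcMl; [exact: openT|move=> x _; exact: cf|exact: CcW CB].
Qed.

Section weak.
Variables (O : set V) (i : 'I_d) (u G : V -> R).
Hypotheses (oO : open O) (cu : continuous u) (LG : L1 G).
Hypothesis weak : forall phi, smooth phi -> Cc O phi ->
  intg (fun x => u x * partial i phi x) = - intg (fun x => G x * phi x).

Let L1G phi : Cc O phi -> L1 (fun x => G x * phi x).
Proof.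
move=> [cp [K [cK _ pK]]]; have [M _ hM] := Cc_bounded cp cK pK.
by apply: L1M hM => //; exact: continuous_measurable_rV.
Qed.

(** As a function of [s], the integral of [u] against [phi] shifted by [s *: e_ i] is
    differentiable, and the weak equation tested with the shifted [phi] computes its derivative; the
    mean value theorem then gives [s]. *)
Lemma weak_dq_smooth phi K r : smooth phi -> compact K -> (forall x, ~ K x -> phi x = 0) ->
  (forall x y, K x -> `|x - y| <= r -> O y) -> forall t, 0 <= t < r ->
  exists2 s, 0 <= s <= t &
    intg (fun x => u x * (phi (x - t *: e_ i) - phi x)) =
    t * intg (fun x => G x * phi (x - s *: e_ i)).
Proof.
move=> sphi cK phiK hr t /andP[t0 tr].
have cphi := smooth_continuous sphi.
have r0 : 0 < r by exact: le_lt_trans tr.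
have Cshift (s : R) : `|s| <= r -> Cc O (fun x => phi (x - s *: e_ i)).
  move=> sr; apply: (Cc_shift cphi cK phiK) => x y Kx.
  by rewrite norm_shift_delta => xy; apply: (hr x) => //; exact: le_trans sr.
pose Phi (s : R) := intg (fun x => u x * phi (x - s *: e_ i)).
have dPhi (s : R) : 0 <= s <= t ->
    is_derive s (1:R) Phi (intg (fun x => G x * phi (x - s *: e_ i))).
  move=> /andP[s0 st]; apply: is_derive_eps => e e0.
  have sr : `|s| <= r by rewrite ger0_norm// (le_trans st)// ltW.
  pose K2 := enlarge K (r + r).
  have cK2 : compact K2 by exact: compact_enlarge.
  have [C C0 hC] := intg_supp_bound cu cK2.
  have e1 : 0 < e / (C + 1) by rewrite divr_gt0// ltr_wpDl.
  have dphi x := smooth_is_derive i x sphi.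
  have cdphi := smooth_continuous (smooth_partial i sphi).
  have dphiK := partial_supp dphi (rV_compact_closed cK) phiK.
  have [t1 t10 ht1] := unif_diff dphi cdphi cK dphiK e1.
  exists (Num.min t1 r); first by rewrite lt_min t10 r0.
  move=> y; rewrite lt_min => /andP[yt1 yr].
  have hL : intg (fun x => G x * phi (x - s *: e_ i)) =
      - intg (fun x => u x * partial i phi (x - s *: e_ i)).
    have hw := weak (smooth_shift (- (s *: e_ i)) sphi) (Cshift s sr).
    have heq : intg (fun x => u x * partial i (fun x => phi (x + - (s *: e_ i))) x) =
        intg (fun x => u x * partial i phi (x - s *: e_ i)).
      by apply: eq_intg => x; congr (_ * _); exact: partial_shift.
    exact: etrans (esym (opprK _)) (congr1 -%R (etrans (esym hw) heq)).
  pose f x := phi (x - (s + y) *: e_ i) - phi (x - s *: e_ i) + y * partial i phi (x - s *: e_ i).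
  have fE x : f x = phi (x - s *: e_ i + (- y) *: e_ i) - phi (x - s *: e_ i)
      - (- y) * partial i phi (x - s *: e_ i).
    by rewrite /f mulNr opprK scalerDl opprD addrA scaleNr.
  have cf : continuous f.
    apply: contD; first by apply: contB; exact: continuous_shift.
    by apply: contM; [exact: cont_cst|exact: (@continuous_shift _ _ (partial i phi) (- (s *: e_ i)) cdphi)].
  have fe x : `|f x| <= e / (C + 1) * `|y|.
    by rewrite fE; have := ht1 (x - s *: e_ i) (- y); rewrite normrN; exact.
  have nK2 (c x : V) : `|c| <= r + r -> ~ K2 x -> ~ K (x - c).
    move=> cr nx Kx; apply: nx; exists (x - c) => //.
    by rewrite addrAC subrr add0r normrN.
  have sr2 : `|s *: e_ i| <= r + r by rewrite norm_shift_delta; lra.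
  have syr2 : `|(s + y) *: e_ i| <= r + r.
    by rewrite norm_shift_delta (le_trans (ler_normD _ _))//; lra.
  have fK x : ~ K2 x -> f x = 0.
    move=> nx; rewrite /f phiK; last exact: nK2.
    by rewrite phiK ?dphiK ?subrr ?mulr0 ?addr0//; exact: nK2.
  have [_ hb] := hC f _ (continuous_measurable_rV cf) fe fK.
  have CT (g : V -> R) : continuous g -> (forall x, ~ K2 x -> g x = 0) -> L1 (fun x => u x * g x).
    by move=> cg gK; apply: (@continuous_Cc_L1 _ _ setT) => //; split=> //; exists K2.
  have A1 : L1 (fun x => u x * phi (x - (s + y) *: e_ i)).
    by apply: CT; [exact: continuous_shift|move=> x nx; rewrite phiK//; exact: nK2].
  have A2 : L1 (fun x => u x * phi (x - s *: e_ i)).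
    by apply: CT; [exact: continuous_shift|move=> x nx; rewrite phiK//; exact: nK2].
  have A3 : L1 (fun x => u x * partial i phi (x - s *: e_ i)).
    by apply: CT; [exact: (@continuous_shift _ _ (partial i phi) (- (s *: e_ i)) cdphi)|move=> x nx; rewrite dphiK//; exact: nK2].
  have -> : Phi (s + y) - Phi s - y * intg (fun x => G x * phi (x - s *: e_ i)) =
      intg (fun x => u x * f x).
    rewrite hL mulrN opprK -intgZ// /Phi -intgB// -intgD; first last.
    - exact: L1Z.
    - exact: L1B.
    - by apply: eq_intg => x; rewrite /f; ring.
  apply: (le_trans hb); rewrite -mulrA mulrCA mulrC ler_wpM2r//.
  by rewrite mulrAC ler_pdivrMr ?ltr_wpDl// ler_wpM2l ?ltW// ltrDl.
have dPhi' (s : R) : s \in `]0, t[ ->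
    is_derive s (1:R) Phi (intg (fun x => G x * phi (x - s *: e_ i))).
  by rewrite in_itv/= => /andP[s0 st]; apply: dPhi; rewrite !ltW.
have [|s] := MVT_segment t0 dPhi'.
  apply: derivable_within_continuous => s; rewrite in_itv/= => sI.
  by have [] := dPhi s sI.
rewrite in_itv/= subr0 => sI hs; exists s => //.
rewrite mulrC -hs /Phi -intgB.
- by apply: eq_intg => x; rewrite scale0r subr0 mulrBr.
- apply: (continuous_Cc_L1 cu (Cshift t _)); rewrite ger0_norm//; exact: ltW.
- by apply: (continuous_Cc_L1 cu (Cshift 0 _)); rewrite normr0 ltW.
Qed.

(** The constant depends neither on [t] nor on [e], so [e] can be sent to [0] with [t] fixed. The
    shift [s] depends on the approximation, which is why it has to be estimated away afterwards. *)
Lemma weak_dq_approx B K r : continuous B -> compact K -> (forall x, ~ K x -> B x = 0) ->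
  0 < r -> (forall x y, K x -> `|x - y| <= r + r -> O y) ->
  exists2 C, 0 <= C & forall t e, 0 <= t < r -> 0 < e ->
    exists phi s, [/\ Cc O (fun x => phi (x - s *: e_ i)),
      (forall x, `|phi x - B x| <= e), 0 <= s <= t &
    `|intg (fun x => u x * (B (x - t *: e_ i) - B x)) -
      t * intg (fun x => G x * phi (x - s *: e_ i))| <= e * C].
Proof.
move=> cB cK BK r0 hr.
pose K1 := enlarge K r; pose K2 := enlarge K (r + r).
have cK1 : compact K1 by exact: compact_enlarge.
have cK2 : compact K2 by exact: compact_enlarge.
have [C C0 hC] := intg_supp_bound cu cK2.
exists (2 * C); first by rewrite mulr_ge0.
move=> t e tr e0; have /andP[t0 ltr] := tr.
have [phi [sphi phiB phiK]] := smooth_approx cB cK BK e0 r0.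
have hr1 x y : K1 x -> `|x - y| <= r -> O y.
  move=> [z Kz zx] xy; apply: (hr z) => //.
  by rewrite (le_trans (ler_distD x _ _))// lerD.
have [s sI hs] := weak_dq_smooth sphi cK1 phiK hr1 tr.
have cphi := smooth_continuous sphi.
exists phi, s; split=> //.
  apply: (Cc_shift cphi cK1 phiK) => x y Kx; rewrite norm_shift_delta => xy.
  apply: (hr1 x) => //; rewrite (le_trans xy)//.
  by have /andP[s0 st] := sI; rewrite ger0_norm// (le_trans st)// ltW.
rewrite -hs.
pose f x := (B (x - t *: e_ i) - phi (x - t *: e_ i)) - (B x - phi x).
have cf : continuous f.
  by apply: contB; apply: contB => //; exact: continuous_shift.
have fe x : `|f x| <= 2 * e.
  rewrite (le_trans (ler_normB _ _))// mulr_natl mulr2n.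
  by apply: lerD; rewrite distrC.
have nK2 (x : V) : ~ K2 x -> ~ K1 (x - t *: e_ i) /\ ~ K1 x.
  move=> nx; split => -[z Kz zx]; apply: nx; exists z => //.
    rewrite (le_trans (ler_distD (x - t *: e_ i) _ _))// lerD//.
    by rewrite addrAC subrr add0r normrN norm_shift_delta ger0_norm// ltW.
  by rewrite (le_trans zx)// lerDl ltW.
have BK1 x : ~ K1 x -> B x = 0.
  by move=> nx; apply: BK => Kx; apply: nx; apply: sub_enlarge => //; exact: ltW.
have fK x : ~ K2 x -> f x = 0.
  by move=> /nK2[n1 n2]; rewrite /f !BK1// !phiK// !subrr.
have [_ hb] := hC f _ (continuous_measurable_rV cf) fe fK.
have CT (g : V -> R) : continuous g -> (forall x, ~ K2 x -> g x = 0) -> L1 (fun x => u x * g x).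
  by move=> cg gK; apply: (@continuous_Cc_L1 _ _ setT) => //; split=> //; exists K2.
rewrite -intgB.
- have -> : (fun x => u x * (B (x - t *: e_ i) - B x) - u x * (phi (x - t *: e_ i) - phi x))
    = (fun x => u x * f x) by apply/funext => x; rewrite /f; ring.
  by rewrite (le_trans hb)//; rewrite le_eqVlt; apply/orP; left; apply/eqP; ring.
- apply: CT; first by apply: contB => //; exact: continuous_shift.
  by move=> x /nK2[n1 n2]; rewrite !BK1// subrr.
- apply: CT; first by apply: contB => //; exact: continuous_shift.
  by move=> x /nK2[n1 n2]; rewrite !phiK// subrr.
Qed.

Let IG : R := intg (fun x => `|G x|).

Let IG0 : 0 <= IG. Proof. exact: intg_ge0. Qed.

(* The error depends on [B] only through its oscillation, which lets the estimate
   pass from smooth tests to continuous ones. *)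
Lemma weak_dq_osc B K r : continuous B -> compact K -> (forall x, ~ K x -> B x = 0) ->
  0 < r -> (forall x y, K x -> `|x - y| <= r + r -> O y) ->
  forall t w, 0 <= t < r -> (forall x s, 0 <= s <= t -> `|B (x - s *: e_ i) - B x| <= w) ->
  `|intg (fun x => u x * (B (x - t *: e_ i) - B x)) - t * intg (fun x => G x * B x)|
    <= t * (w * IG).
Proof.
move=> cB cK BK r0 hr t w tr hw; have /andP[t0 _] := tr.
have [C C0 hC] := weak_dq_approx cB cK BK r0 hr.
have CB : Cc O B.
  split=> //; exists K; split=> // x Kx; apply: (hr x) => //.
  by rewrite subrr normr0 addr_ge0// ltW.
apply/ler_addgt0Pr => e e0.
have D0 : 0 < C + t * IG + 1 by rewrite ltr_wpDl// addr_ge0// mulr_ge0.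
have e1 : 0 < e / (C + t * IG + 1) by rewrite divr_gt0.
have [phi [s [Cphi phiB sI hs]]] := hC t _ tr e1.
set e' := e / _ in e1 phiB hs.
have e'E : e' * (C + t * IG + 1) = e by rewrite /e' divfK// gt_eqF.
have h2 : `|t * intg (fun x => G x * phi (x - s *: e_ i)) - t * intg (fun x => G x * B x)|
    <= t * ((w + e') * IG).
  rewrite -mulrBr normrM (ger0_norm t0) ler_wpM2l//.
  rewrite -intgB; [|exact: L1G|exact: L1G].
  have -> : (fun x => G x * phi (x - s *: e_ i) - G x * B x) =
     (fun x => G x * (phi (x - s *: e_ i) - B x)) by apply/funext => x; rewrite mulrBr.
  apply: intgM_le => //.
    apply: continuous_measurable_rV; apply: contB => //.
    exact: Cc_continuous Cphi.
  move=> x; rewrite (le_trans (ler_distD (B (x - s *: e_ i)) _ _))// addrC.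
  by apply: lerD; [exact: hw|exact: phiB].
rewrite (le_trans (ler_distD (t * intg (fun x => G x * phi (x - s *: e_ i))) _ _))//.
rewrite (le_trans (lerD hs h2))// -[X in _ <= _ + X]e'E.
have -> : t * ((w + e') * IG) = t * (w * IG) + e' * (t * IG) by ring.
by nra.
Qed.

(** Only the maximum of [B] enters. This is meant for tests that themselves depend on [t], whose
    oscillation over distance [t] is not controlled. *)
Lemma weak_dq_bound B K r M : continuous B -> compact K -> (forall x, ~ K x -> B x = 0) ->
  0 < r -> (forall x y, K x -> `|x - y| <= r + r -> O y) -> (forall x, `|B x| <= M) ->
  forall t, 0 <= t < r ->
  `|intg (fun x => u x * (B (x - t *: e_ i) - B x))| <= t * (M * IG).
Proof.
move=> cB cK BK r0 hr BM t tr; have /andP[t0 _] := tr.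
have [C C0 hC] := weak_dq_approx cB cK BK r0 hr.
apply/ler_addgt0Pr => e e0.
have D0 : 0 < C + t * IG + 1 by rewrite ltr_wpDl// addr_ge0// mulr_ge0.
have e1 : 0 < e / (C + t * IG + 1) by rewrite divr_gt0.
have [phi [s [Cphi phiB sI hs]]] := hC t _ tr e1.
set e' := e / _ in e1 phiB hs.
have e'E : e' * (C + t * IG + 1) = e by rewrite /e' divfK// gt_eqF.
have h2 : `|t * intg (fun x => G x * phi (x - s *: e_ i))| <= t * ((M + e') * IG).
  rewrite normrM (ger0_norm t0) ler_wpM2l//.
  apply: intgM_le => //.
    by apply: continuous_measurable_rV; exact: Cc_continuous Cphi.
  move=> x; have := phiB (x - s *: e_ i); have := BM (x - s *: e_ i).
  by have := ler_distD (B (x - s *: e_ i)) (phi (x - s *: e_ i)) 0; rewrite !subr0; lra.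
rewrite -[intg _](subrK (t * intg (fun x => G x * phi (x - s *: e_ i)))).
rewrite (le_trans (ler_normD _ _))// (le_trans (lerD hs h2))// -[X in _ <= _ + X]e'E.
have -> : t * ((M + e') * IG) = t * (M * IG) + e' * (t * IG) by ring.
by nra.
Qed.

(** Convergence comes from [weak_dq_osc], as a fixed [B] oscillates little over short shifts. The
    weighted [L^1] bound on the quotients comes from [weak_dq_bound], tested with a continuous
    substitute for their sign. *)
Lemma has_dq_weak : has_dq O i u G.
Proof.
split=> //.
- move=> B CB e e0; have [cB [K [cK KO BK]]] := CB.
  have [rr rr0 hrr] := compact_margin cK oO KO.
  pose r := rr / 2.
  have r0 : 0 < r by rewrite divr_gt0.
  have hr x y : K x -> `|x - y| <= r + r -> O y.
    by move=> Kx; rewrite /r -splitr; exact: hrr.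
  have e1 : 0 < e / (IG + 1) by rewrite divr_gt0// ltr_wpDl.
  have [t1 t10 ht1] := Cc_unif cB cK BK e1.
  exists (Num.min r t1); first by rewrite lt_min r0.
  move=> t /andP[t0]; rewrite lt_min => /andP[tr tt1].
  have tr' : 0 <= t < r by rewrite ltW.
  have := @weak_dq_osc B K r cB cK BK r0 hr t (e / (IG + 1)) tr'.
  have hw (x : V) (s : R) : 0 <= s <= t -> `|B (x - s *: e_ i) - B x| <= e / (IG + 1).
    move=> /andP[s0 st]; apply/ltW/ht1.
    by rewrite addrAC subrr add0r normrN norm_shift_delta ger0_norm// (le_lt_trans st).
  move=> /(_ hw) h.
  have CBT : Cc setT B by exact: CcW CB.
  rewrite (intg_dq i t cu CBT).
  have -> : (fun x => u x * ((B (x - t *: e_ i) - B x) / t)) =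
     (fun x => t^-1 * (u x * (B (x - t *: e_ i) - B x))) by apply/funext => x; ring.
  rewrite intgZ; last first.
    apply: (continuous_Cc_L1 (O := setT) cu); split.
      by apply: contB => //; exact: continuous_shift.
    exists (enlarge K r); split=> //; first exact: compact_enlarge.
    move=> x nx; rewrite !BK ?subrr//.
      by move=> Kx; apply: nx; apply: sub_enlarge => //; exact: ltW.
    move=> Kx; apply: nx; exists (x - t *: e_ i) => //.
    by rewrite addrAC subrr add0r normrN norm_shift_delta ger0_norm ltW.
  set A := intg _ in h *; set D := intg _ in h *.
  have -> : t^-1 * A - D = (A - t * D) / t by field; rewrite gt_eqF.
  rewrite normrM normfV (gtr0_norm t0) ler_pdivrMr// (le_trans h)// [e * t]mulrC.
  apply: ler_wpM2l; first exact: ltW.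
  by rewrite mulrAC ler_pdivrMr ?ltr_wpDl// ler_wpM2l ?ltW// ltrDl.
- move=> B CB B0; have [cB [K [cK KO BK]]] := CB.
  have [M M0 BM] := Cc_bounded cB cK BK.
  have [rr rr0 hrr] := compact_margin cK oO KO.
  pose r := rr / 2.
  have r0 : 0 < r by rewrite divr_gt0.
  have hr x y : K x -> `|x - y| <= r + r -> O y.
    by move=> Kx; rewrite /r -splitr; exact: hrr.
  exists (M * IG), r => // t /andP[t0 tr].
  have tr' : 0 <= t < r by rewrite ltW.
  apply/ler_addgt0Pr => e e0.
  have IB0 : 0 <= intg B by exact: intg_ge0.
  (* The sign of [a] is replaced by [a / (|a| + y)], which is continuous in [a] and misses [|a|] by
     at most [y] after multiplication by [a]; the total loss is then at most [y * intg B <= e]. *)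
  pose y := e / (intg B + 1).
  have y0 : 0 < y by rewrite divr_gt0// ltr_wpDl.
  have cdq := @dq_continuous _ _ i u t cu.
  pose sg (a : R) := a / (`|a| + y).
  have sgd x : 0 < `|dq i u t x| + y by rewrite ltr_wpDl.
  pose B2 x := sg (dq i u t x) * B x.
  have cB2 : continuous B2.
    apply: contM => //; apply: contM => //; apply: contV => [x|].
      by rewrite gt_eqF// sgd.
    by apply: contD; [exact: cont_norm|exact: cont_cst].
  have B2K x : ~ K x -> B2 x = 0 by move=> /BK h; rewrite /B2 h mulr0.
  have B2M x : `|B2 x| <= M.
    rewrite normrM -[M]mul1r; apply: ler_pM => //.
    rewrite normrM normfV (gtr0_norm (sgd x)) ler_pdivrMr// mul1r lerDl ltW//.
  have := weak_dq_bound cB2 cK B2K r0 hr B2M tr'.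
  have CB2 : Cc O B2 by split=> //; exists K.
  have CB2T : Cc setT B2 by exact: CcW CB2.
  have hE : intg (fun x => u x * (B2 (x - t *: e_ i) - B2 x)) = t * intg (fun x => dq i u t x * B2 x).
    rewrite (intg_dq i t cu CB2T) -intgZ.
      by apply: eq_intg => x; field; rewrite gt_eqF.
    have -> : (fun x => u x * ((B2 (x - t *: e_ i) - B2 x) / t)) =
       (fun x => u x * (t^-1 * (B2 (x - t *: e_ i) - B2 x))) by apply/funext => x; ring.
    apply: (continuous_Cc_L1 (O := setT) cu); split.
      by apply: contM; [exact: cont_cst|apply: contB => //; exact: continuous_shift].
    exists (enlarge K r); split=> //; first exact: compact_enlarge.
    move=> x nx; rewrite !B2K ?subrr ?mulr0//.
      by move=> Kx; apply: nx; apply: sub_enlarge => //; exact: ltW.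
    move=> Kx; apply: nx; exists (x - t *: e_ i) => //.
    by rewrite addrAC subrr add0r normrN norm_shift_delta ger0_norm ltW.
  rewrite hE normrM (gtr0_norm t0) ler_pM2l// => hb.
  have LB := Cc_is_L1 CB.
  have L2 : L1 (fun x => dq i u t x * B2 x) by exact: (continuous_Cc_L1 cdq CB2).
  have L3 : L1 (fun x => `|dq i u t x| * B x) by exact: (continuous_Cc_L1 (cont_norm cdq) CB).
  have := le_trans (ler_norm _) hb.
  have : intg (fun x => `|dq i u t x| * B x) <= intg (fun x => dq i u t x * B2 x + y * B x).
    apply: le_intg => //; first by apply: L1D => //; exact: L1Z.
    move=> x; rewrite /B2 mulrA -mulrDl ler_wpM2r// /sg.
    set a := dq i u t x; have a0 := sgd x; rewrite -/a in a0.
    rewrite mulrA -expr2 -real_normK ?num_real//.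
    have -> : `|a| ^+ 2 / (`|a| + y) + y = (`|a| ^+ 2 + y * `|a| + y ^+ 2) / (`|a| + y).
      by field; rewrite gt_eqF.
    rewrite ler_pdivlMr//; have := normr_ge0 a; nra.
  rewrite intgD//; last exact: L1Z.
  rewrite intgZ//.
  have : y * intg B <= e.
    rewrite /y mulrAC ler_pdivrMr ?ltr_wpDl// ler_wpM2l ?ltW// ltrDl//.
  lra.
Qed.

End weak.

End has_dq_theory.

(** * Weak derivatives of C^1 functions, of linear combinations and of squared positive parts *)

Section has_dq_stability.
Context {R : realType} {d : nat}.
Local Notation V := 'rV[R]_d.
Local Notation e_ i := (delta_mx 0 i : V).
Implicit Types (O K : set V) (f g h B u : V -> R).

Lemma Cc_norm O B : Cc O B -> Cc O (fun x => `|B x|).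
Proof.
move=> [cB [K [cK KO BK]]]; split; first exact: cont_norm.
by exists K; split=> // x /BK ->; rewrite normr0.
Qed.

Lemma has_dq_C1 O i h (h' : V -> R) : open O -> continuous h ->
  (forall x, O x -> is_derive x (e_ i) h (h' x)) ->
  (forall x, O x -> {for x, continuous h'}) -> has_dq O i h h'.
Proof.
move=> oO ch dh ch'.
have Ch'B B : Cc O B -> Cc O (fun x => h' x * B x) by exact: CcMl.
have unif K e : compact K -> K `<=` O -> 0 < e -> exists2 t0, 0 < t0 &
    forall t x, 0 < t < t0 -> K x -> `|dq i h t x - h' x| <= e.
  move=> cK KO e0; have [r r0 hr] := compact_margin cK oO KO.
  have [t1 t10 ht1] := heine_compact cK (fun x Kx => ch' x (KO x Kx)) e0.
  exists (Num.min r t1); first by rewrite lt_min r0.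
  move=> t x /andP[t0]; rewrite lt_min => /andP[tr tt1] Kx.
  have inO (s : R) : 0 <= s <= t -> O (s *: e_ i + x).
    move=> /andP[s0 st]; apply: (hr x) => //.
    rewrite [_ + x]addrC opprD addrA subrr add0r normrN norm_shift_delta ger0_norm//.
    by rewrite (le_trans st)// ltW.
  have [s sI hs] := @is_derive_MVT _ _ h (e_ i) h' x t (ltW t0) (fun s sI => dh _ (inO s sI)).
  rewrite /dq [x + _]addrC hs mulfK ?gt_eqF// distrC; apply/ltW/ht1 => //.
  have /andP[s0 st] := sI.
  rewrite [_ + x]addrC opprD addrA subrr add0r normrN norm_shift_delta ger0_norm//.
  exact: le_lt_trans tt1.
split=> //.
- by move=> B /Ch'B/Cc_is_L1.
- move=> B CB e e0; have [cB [K [cK KO BK]]] := CB.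
  have LB : L1 (fun x => `|B x|) by apply: Cc_is_L1; exact: Cc_norm CB.
  have IB0 : 0 <= intg (fun x => `|B x|) by exact: intg_ge0.
  have e1 : 0 < e / (intg (fun x => `|B x|) + 1) by rewrite divr_gt0// ltr_wpDl.
  have [t0 t00 ht0] := unif K _ cK KO e1.
  exists t0 => // t tI.
  have L1' := Cc_is_L1 (dq_Cc i t ch CB).
  have L2' := Cc_is_L1 (Ch'B _ CB).
  rewrite -intgB// (le_trans (intg_norm (L1B L1' L2')))//.
  apply: (@le_trans _ _ (intg (fun x => e / (intg (fun x => `|B x|) + 1) * `|B x|))).
    apply: le_intg; [exact/L1_norm/L1B|exact: L1Z|].
    move=> x; rewrite -mulrBl normrM.
    have [Kx|/BK ->] := pselect (K x); last by rewrite normr0 !mulr0.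
    by rewrite ler_wpM2r// ht0.
  by rewrite intgZ// mulrAC ler_pdivrMr ?ltr_wpDl// ler_wpM2l ?ltW// ltrDl.
- move=> B CB B0; have [cB [K [cK KO BK]]] := CB.
  have [t0 t00 ht0] := unif K _ cK KO ltr01.
  have CaB := Cc_norm (Ch'B _ CB).
  exists (intg (fun x => `|h' x * B x| + B x)), t0 => // t tI.
  apply: le_intg.
  + apply: (@Cc_is_L1 _ _ O); apply: CcMl => // x _.
    by apply: cont_norm; exact: dq_continuous.
  + by apply: L1D; apply: Cc_is_L1; [exact: CaB|exact: CB].
  + move=> x; rewrite [X in _ <= X + _]normrM (ger0_norm (B0 x)) -[X in _ <= _ + X]mul1r -mulrDl.
    have [Kx|/BK ->] := pselect (K x); last by rewrite !mulr0.
    rewrite ler_wpM2r//; have := ht0 t x tI Kx.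
    by have := ler_distD (h' x) (dq i h t x) 0; rewrite !subr0; lra.
Qed.

Lemma has_dq_lin O i h1 (H1 : V -> R) h2 (H2 : V -> R) (a : R) :
  has_dq O i h1 H1 -> has_dq O i h2 H2 ->
  has_dq O i (fun x => h1 x - a * h2 x) (fun x => H1 x - a * H2 x).
Proof.
move=> [c1 l1 v1 b1] [c2 l2 v2 b2].
have dqE t x : dq i (fun x => h1 x - a * h2 x) t x = dq i h1 t x - a * dq i h2 t x.
  by rewrite /dq; ring.
have LH B : Cc O B -> L1 (fun x => (H1 x - a * H2 x) * B x).
  move=> CB; have := L1B (l1 _ CB) (L1Z a (l2 _ CB)); apply: eq_L1 => x.
  by rewrite mulrBl mulrA.
split=> //.
- by apply: contB => //; apply: contM => //; exact: cont_cst.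
- move=> B CB e e0.
  have e1 : 0 < e / 2 by rewrite divr_gt0.
  have e2 : 0 < e / (2 * (`|a| + 1)) by rewrite divr_gt0// mulr_gt0// ltr_wpDl.
  have [t1 t10 ht1] := v1 B CB _ e1.
  have [t2 t20 ht2] := v2 B CB _ e2.
  exists (Num.min t1 t2); first by rewrite lt_min t10.
  move=> t /andP[t0]; rewrite lt_min => /andP[tt1 tt2].
  have := ht1 t; rewrite t0 tt1 => /(_ isT) h1'.
  have := ht2 t; rewrite t0 tt2 => /(_ isT) h2'.
  have D1 := Cc_is_L1 (dq_Cc i t c1 CB); have D2 := Cc_is_L1 (dq_Cc i t c2 CB).
  have -> : intg (fun x => dq i (fun x => h1 x - a * h2 x) t x * B x) =
     intg (fun x => dq i h1 t x * B x) - a * intg (fun x => dq i h2 t x * B x).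
    rewrite -intgZ// -intgB//; last exact: L1Z.
    by apply: eq_intg => x; rewrite dqE mulrBl mulrA.
  have -> : intg (fun x => (H1 x - a * H2 x) * B x) =
     intg (fun x => H1 x * B x) - a * intg (fun x => H2 x * B x).
    have E1 := l1 _ CB; have E2 := l2 _ CB.
    rewrite -intgZ// -intgB//; last exact: L1Z.
    by apply: eq_intg => x; rewrite mulrBl mulrA.
  set A1 := intg _ in h1' *; set A2 := intg _ in h1' *.
  set A3 := intg _ in h2' *; set A4 := intg _ in h2' *.
  have -> : A1 - a * A3 - (A2 - a * A4) = (A1 - A2) - a * (A3 - A4) by ring.
  rewrite (le_trans (ler_normB _ _))// [e]splitr lerD// normrM.
  apply: (@le_trans _ _ (`|a| * (e / (2 * (`|a| + 1))))); first by rewrite ler_wpM2l.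
  rewrite mulrA ler_pdivrMr ?mulr_gt0 ?ltr_wpDl//.
  have -> : e / 2 * (2 * (`|a| + 1)) = `|a| * e + e by field.
  by rewrite lerDl ltW.
- move=> B CB B0.
  have [C1 [t1 t10 ht1]] := b1 B CB B0; have [C2 [t2 t20 ht2]] := b2 B CB B0.
  exists (C1 + `|a| * C2), (Num.min t1 t2); first by rewrite lt_min t10.
  move=> t /andP[t0]; rewrite lt_min => /andP[tt1 tt2].
  have := ht1 t; rewrite t0 tt1 => /(_ isT) h1'.
  have := ht2 t; rewrite t0 tt2 => /(_ isT) h2'.
  have CD h : continuous h -> L1 (fun x => `|dq i h t x| * B x).
    move=> ch; apply: (continuous_Cc_L1 _ CB).
    by apply: cont_norm; exact: dq_continuous.
  apply: (le_trans _ (lerD h1' (ler_wpM2l (normr_ge0 a) h2'))).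
  have E1 := CD _ c1; have E2 := CD _ c2.
  rewrite -intgZ// -intgD//; last exact: L1Z.
  apply: le_intg.
  + by apply: CD; apply: contB => //; apply: contM => //; exact: cont_cst.
  + by apply: L1D; [exact: CD|apply: L1Z; exact: CD].
  + move=> x; rewrite dqE [X in _ <= _ + X]mulrA -mulrDl ler_wpM2r// -normrM; exact: ler_normB.
Qed.

Definition posp (a : R) : R := Num.max a 0.

Lemma posp_ge0 a : 0 <= posp a.
Proof. by rewrite le_max lexx orbT. Qed.

Lemma posp_pos a : 0 <= a -> posp a = a.
Proof. by move=> a0; rewrite /posp max_l. Qed.

Lemma posp_neg a : a <= 0 -> posp a = 0.
Proof. by move=> a0; rewrite /posp max_r. Qed.

(** First-order Taylor expansion of [(t^+)^2], whose derivative [2 t^+] is Lipschitz. The positive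
    part itself has no such quadratic remainder. *)
Lemma posp_sqr_diff a b :
  `|posp b ^+ 2 - posp a ^+ 2 - 2 * posp a * (b - a)| <= (b - a) ^+ 2.
Proof.
have s1 := sqr_ge0 (b - a); have s2 := sqr_ge0 a; have s3 := sqr_ge0 b.
rewrite ler_norml; have [a0|/ltW a0] := leP 0 a; have [b0|/ltW b0] := leP 0 b.
- rewrite !posp_pos//; apply/andP; split; rewrite -subr_ge0.
    by rewrite (_ : _ - _ = 2 * (b - a) ^+ 2); [lra|ring].
  by rewrite (_ : _ - _ = 0); [|ring].
- rewrite (posp_pos a0) (posp_neg b0); apply/andP; split; nra.
- rewrite (posp_pos b0) (posp_neg a0); apply/andP; split; nra.
- rewrite !posp_neg//; apply/andP; split; nra.
Qed.

Lemma cont_posp h : continuous h -> continuous (fun x : V => posp (h x)).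
Proof.
move=> ch x; apply: (@continuous_comp _ _ _ h posp); first exact: ch.
by apply: continuous_max; [exact: cvg_id|exact: cvg_cst].
Qed.

(** By [posp_sqr_diff], the quotient of [(h^+)^2] differs from [2 h^+] times that of [h] by at most
    the latter times the oscillation of [h]. The quotients are bounded in weighted [L^1] and the
    oscillation tends to [0] uniformly on compact sets. *)
Lemma has_dq_pos2 O i h (H : V -> R) : has_dq O i h H ->
  has_dq O i (fun x => posp (h x) ^+ 2) (fun x => 2 * posp (h x) * H x).
Proof.
move=> [ch lh vh bh].
have cp := cont_posp ch.
pose P x := 2 * posp (h x).
have cP : continuous P by apply: contM => //; exact: cont_cst.
have P0 x : 0 <= P x by rewrite mulr_ge0// posp_ge0.
pose g x := posp (h x) ^+ 2.
have cg : continuous g by exact: contM.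
have CPB B : Cc O B -> Cc O (fun x => P x * B x).
  move=> [cB [K [cK KO BK]]]; split; first exact: contM.
  by exists K; split=> // x /BK ->; rewrite mulr0.
have dqg t x : 0 < t ->
    `|dq i g t x - P x * dq i h t x| <= `|dq i h t x| * `|h (x + t *: e_ i) - h x|.
  move=> t0; have := posp_sqr_diff (h x) (h (x + t *: e_ i)).
  have -> : dq i g t x - P x * dq i h t x =
     (g (x + t *: e_ i) - g x - P x * (h (x + t *: e_ i) - h x)) / t.
    by rewrite /dq; field; rewrite gt_eqF.
  rewrite /g /P /dq => h1.
  rewrite normrM [leRHS](_ : _ = `|h (x + t *: e_ i) - h x| ^+ 2 * `|t^-1|).
    by rewrite ler_wpM2r// real_normK ?num_real.
  by rewrite normrM; ring.
have unif K e : compact K -> 0 < e -> exists2 t0, 0 < t0 &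
    forall t x, 0 < t < t0 -> K x -> `|h (x + t *: e_ i) - h x| <= e.
  move=> cK e0; have [t0 t00 ht0] := heine_compact cK (fun x _ => ch x) e0.
  exists t0 => // t x /andP[tp tt0] Kx; rewrite distrC; apply/ltW/ht0 => //.
  by rewrite opprD addrA subrr add0r normrN norm_shift_delta gtr0_norm.
have CD (f : V -> R) B : continuous f -> Cc O B -> L1 (fun x => f x * B x).
  by move=> cf CB; exact: (continuous_Cc_L1 cf CB).
split=> //.
- move=> B /CPB/lh; apply: eq_L1 => x; rewrite /P; ring.
- move=> B CB e e0; have [cB [K [cK KO BK]]] := CB.
  have e1 : 0 < e / 2 by rewrite divr_gt0.
  have CnB := Cc_norm CB.
  have [C [t1 t10 ht1]] := bh _ CnB (fun x => normr_ge0 _).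
  have e2 : 0 < e / (2 * (`|C| + 1)) by rewrite divr_gt0// mulr_gt0// ltr_wpDl.
  have [t2 t20 ht2] := unif K _ cK e2.
  have [t3 t30 ht3] := vh _ (CPB _ CB) _ e1.
  exists (Num.min t1 (Num.min t2 t3)); first by rewrite !lt_min t10 t20.
  move=> t /andP[t0]; rewrite !lt_min => /and3P[tt1 tt2 tt3].
  have := ht1 t; rewrite t0 tt1 => /(_ isT) h1'.
  have h2' x : K x -> `|h (x + t *: e_ i) - h x| <= e / (2 * (`|C| + 1)).
    by move=> Kx; apply: ht2 => //; rewrite t0.
  have := ht3 t; rewrite t0 tt3 => /(_ isT) h3'.
  have cdg := dq_continuous (i := i) (t := t) cg.
  have cdh := dq_continuous (i := i) (t := t) ch.
  have -> : intg (fun x => 2 * posp (h x) * H x * B x) = intg (fun x => H x * (P x * B x)).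
    by apply: eq_intg => x; rewrite /P; ring.
  rewrite -(subrK (intg (fun x => dq i h t x * (P x * B x))) (intg (fun x => dq i g t x * B x))).
  rewrite -addrA (le_trans (ler_normD _ _))// [e]splitr lerD//.
  rewrite -intgB; [|exact: CD|exact: (CD _ _ cdh (CPB _ CB))].
  have -> : (fun x => dq i g t x * B x - dq i h t x * (P x * B x)) =
     (fun x => (dq i g t x - P x * dq i h t x) * B x) by apply/funext => x; ring.
  have cdd : continuous (fun x => dq i g t x - P x * dq i h t x).
    by apply: contB => //; exact: contM.
  rewrite (le_trans (intg_norm (CD _ _ cdd CB)))//.
  apply: (@le_trans _ _ (intg (fun x => e / (2 * (`|C| + 1)) * (`|dq i h t x| * `|B x|)))).
    apply: le_intg.
    + by apply: L1_norm; exact: CD.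
    + by apply: L1Z; apply: CD => //; exact: cont_norm.
    + move=> x; rewrite normrM.
      have [Kx|/BK ->] := pselect (K x); last by rewrite normr0 !mulr0.
      rewrite [X in _ <= X]mulrA ler_wpM2r// (le_trans (dqg t x t0))//.
      rewrite [X in _ <= X]mulrC ler_wpM2l//.
      exact: h2'.
  rewrite intgZ; last by apply: CD => //; exact: cont_norm.
  apply: (@le_trans _ _ (e / (2 * (`|C| + 1)) * `|C|)).
    by apply: ler_wpM2l; [exact: ltW|exact: le_trans h1' (ler_norm _)].
  rewrite mulrAC ler_pdivrMr ?mulr_gt0 ?ltr_wpDl//.
  have -> : e / 2 * (2 * (`|C| + 1)) = e * `|C| + e by field.
  by rewrite lerDl ltW.
- move=> B CB B0; have [cB [K [cK KO BK]]] := CB.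
  (* Once [h] oscillates by at most [1], the quotient of [(h^+)^2] is at most [P x + 1] times that
     of [h]. *)
  have CB' : Cc O (fun x => (P x + 1) * B x).
    split; first by apply: contM => //; apply: contD => //; exact: cont_cst.
    by exists K; split=> // x /BK ->; rewrite mulr0.
  have B'0 x : 0 <= (P x + 1) * B x by rewrite mulr_ge0// addr_ge0.
  have [C [t1 t10 ht1]] := bh _ CB' B'0.
  have [t2 t20 ht2] := unif K _ cK ltr01.
  exists C, (Num.min t1 t2); first by rewrite lt_min t10.
  move=> t /andP[t0]; rewrite lt_min => /andP[tt1 tt2].
  have := ht1 t; rewrite t0 tt1 => /(_ isT); apply: le_trans.
  apply: le_intg.
  + by apply: CD => //; apply: cont_norm; exact: dq_continuous.
  + by apply: CD => //; apply: cont_norm; exact: dq_continuous.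
  + move=> x; rewrite [X in _ <= X]mulrA.
    have [Kx|/BK ->] := pselect (K x); last by rewrite !mulr0.
    rewrite ler_wpM2r//.
    have h1 := dqg t x t0.
    have h2 : `|h (x + t *: e_ i) - h x| <= 1 by apply: ht2 => //; rewrite t0.
    have h3 := ler_distD (P x * dq i h t x) (dq i g t x) 0.
    have h4 : `|P x * dq i h t x| = P x * `|dq i h t x| by rewrite normrM ger0_norm.
    have h5 : `|dq i h t x| * `|h (x + t *: e_ i) - h x| <= `|dq i h t x| by rewrite ler_piMr.
    have -> : `|dq i h t x| * (P x + 1) = P x * `|dq i h t x| + `|dq i h t x| by ring.
    by rewrite !subr0 h4 in h3; rewrite (le_trans h3)// addrC lerD2l (le_trans h1).
Qed.

End has_dq_stability.

(** * Comparison with cones *)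

Section eucl_norm_theory.
Context {R : realType} {d : nat}.
Local Notation V := 'rV[R]_d.
Implicit Types x y z : V.

Definition dotv x y : R := \sum_(i < d) x 0 i * y 0 i.

Lemma dotv_xx x : dotv x x = eucl_norm x ^+ 2.
Proof.
rewrite /eucl_norm sqr_sqrtr; last by apply: sumr_ge0 => i _; exact: sqr_ge0.
by apply: eq_bigr => i _; rewrite expr2.
Qed.

Lemma eucl_norm_ge0 x : 0 <= eucl_norm x.
Proof. exact: sqrtr_ge0. Qed.

Lemma cauchy_schwarz x y : dotv x y <= eucl_norm x * eucl_norm y.
Proof.
have h : dotv x y ^+ 2 <= dotv x x * dotv y y.
  have Y0 : 0 <= dotv y y by rewrite dotv_xx sqr_ge0.
  have s : 0 <= \sum_(i < d) (x 0 i * dotv y y - y 0 i * dotv x y) ^+ 2.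
    by apply: sumr_ge0 => i _; exact: sqr_ge0.
  have sE : \sum_(i < d) (x 0 i * dotv y y - y 0 i * dotv x y) ^+ 2 =
      dotv y y * (dotv x x * dotv y y - dotv x y ^+ 2).
    set P := dotv x y; set Y := dotv y y.
    transitivity (\sum_(i < d) (x 0 i * x 0 i * Y ^+ 2 - x 0 i * y 0 i * (2 * P * Y)
      + y 0 i * y 0 i * P ^+ 2)); first by apply: eq_bigr => i _; ring.
    rewrite big_split/= sumrB -!mulr_suml -/(dotv x x) -/(dotv x y) -/(dotv y y) -/P -/Y; ring.
  rewrite sE in s; move: Y0; rewrite le_eqVlt => /predU1P[Y0|Y0]; last first.
    by move: s; rewrite pmulr_rge0// subr_ge0.
  have y0 i : y 0 i = 0.
    have /eqP := esym Y0; rewrite psumr_eq0; last by move=> j _; rewrite -expr2 sqr_ge0.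
    by move=> /allP/(_ i); rewrite mem_index_enum => /(_ isT)/=; rewrite mulf_eq0 orbb => /eqP.
  rewrite -Y0 mulr0 [dotv x y]big1 ?expr0n// => i _; by rewrite y0 mulr0.
rewrite !dotv_xx -exprMn in h.
have e0 : 0 <= eucl_norm x * eucl_norm y by rewrite mulr_ge0// eucl_norm_ge0.
by rewrite (le_trans (ler_norm _))// -ler_sqr ?nnegrE// real_normK ?num_real.
Qed.

Lemma eucl_normD x y : eucl_norm (x + y) <= eucl_norm x + eucl_norm y.
Proof.
rewrite -ler_sqr ?nnegrE ?addr_ge0 ?eucl_norm_ge0// -dotv_xx.
have -> : dotv (x + y) (x + y) = dotv x x + 2 * dotv x y + dotv y y.
  rewrite /dotv mulr_sumr -!big_split/=; apply: eq_bigr => i _; rewrite !mxE; ring.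
by rewrite !dotv_xx; have := cauchy_schwarz x y; nra.
Qed.

Lemma eucl_normZ a x : eucl_norm (a *: x) = `|a| * eucl_norm x.
Proof.
rewrite /eucl_norm -sqrtr_sqr -sqrtrM ?sqr_ge0// mulr_sumr; congr Num.sqrt.
by apply: eq_bigr => i _; rewrite mxE exprMn.
Qed.

Lemma eucl_normN x : eucl_norm (- x) = eucl_norm x.
Proof. by rewrite -scaleN1r eucl_normZ normrN1 mul1r. Qed.

Lemma eucl_distC x y : eucl_norm (x - y) = eucl_norm (y - x).
Proof. by rewrite -eucl_normN opprB. Qed.

Lemma eucl_dist_tri z x y : eucl_norm (x - y) <= eucl_norm (x - z) + eucl_norm (z - y).
Proof. by rewrite (le_trans _ (eucl_normD _ _))// addrA subrK. Qed.

Lemma eucl_norm0 : eucl_norm (0 : V) = 0.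
Proof. by rewrite -(scale0r (0 : V)) eucl_normZ normr0 mul0r. Qed.

Lemma coord_le_eucl x i : `|x 0 i| <= eucl_norm x.
Proof.
rewrite -ler_sqr ?nnegrE ?eucl_norm_ge0// -dotv_xx real_normK ?num_real//.
rewrite /dotv (bigD1 i)//= -expr2 lerDl; apply: sumr_ge0 => j _.
by rewrite -expr2 sqr_ge0.
Qed.

Lemma norm_le_eucl x : `|x| <= eucl_norm x.
Proof. by apply/rV_norm_leP => [|i]; [exact: eucl_norm_ge0|exact: coord_le_eucl]. Qed.

Lemma eucl_norm_eq0 x : eucl_norm x = 0 -> x = 0.
Proof.
move=> h; apply/eqP; rewrite -normr_le0; by rewrite (le_trans (norm_le_eucl x))// h.
Qed.

Lemma eucl_le_norm x : eucl_norm x <= d%:R * `|x|.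
Proof.
rewrite -ler_sqr ?nnegrE ?eucl_norm_ge0 ?mulr_ge0// -dotv_xx.
apply: (@le_trans _ _ (\sum_(i < d) `|x| ^+ 2)).
  apply: ler_sum => i _; rewrite -expr2 -real_normK ?num_real//.
  by rewrite ler_sqr ?nnegrE// rV_coord_le_norm.
have -> : \sum_(i < d) `|x| ^+ 2 = d%:R * `|x| ^+ 2 by rewrite sumr_const card_ord mulr_natl.
rewrite exprMn ler_wpM2r ?sqr_ge0// -natrX ler_nat.
by case: (d) => // n; rewrite leq_pmulr.
Qed.

Lemma eucl_delta i : eucl_norm (delta_mx 0 i : V) = 1.
Proof.
apply/eqP; rewrite -(@eqrXn2 _ 2)// ?eucl_norm_ge0// -dotv_xx expr1n.
rewrite /dotv (bigD1 i)//= mxE !eqxx mulr1 big1 ?addr0// => j ji.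
by rewrite mxE (negbTE ji) andbF mulr0.
Qed.

Lemma cont_sum (I : Type) (s : seq I) (F : I -> V -> R) : (forall i, continuous (F i)) ->
  continuous (fun x => \sum_(i <- s) F i x).
Proof.
move=> hF; elim: s => [|i s IH].
  rewrite (_ : (fun _ => _) = cst 0); first exact: cont_cst.
  by apply/funext => x; rewrite big_nil.
rewrite (_ : (fun _ => _) = fun x => F i x + \sum_(i <- s) F i x); first exact: contD.
by apply/funext => x; rewrite big_cons.
Qed.

Lemma continuous_eucl (a : V) : continuous (fun x : V => eucl_norm (x - a)).
Proof.
have cq : continuous (fun x : V => \sum_(i < d) (x - a) 0 i ^+ 2).
  apply: cont_sum => i.
  have -> : (fun x : V => (x - a) 0 i ^+ 2) = (fun x : V => (x 0 i - a 0 i) * (x 0 i - a 0 i)).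
    by apply/funext => y; rewrite !mxE expr2.
  have cc : continuous (fun x : V => x 0 i - a 0 i).
    by apply: contB; [exact: coord_continuous|exact: cont_cst].
  exact: (contM cc cc).
move=> x; apply: (@continuous_comp _ _ _ (fun x : V => \sum_(i < d) (x - a) 0 i ^+ 2) Num.sqrt).
  exact: cq.
exact: sqrt_continuous.
Qed.

Lemma closed_eucl_ball (a : V) r : closed [set x | eucl_norm (x - a) <= r].
Proof.
rewrite (_ : [set _ | _] = (fun x : V => eucl_norm (x - a)) @^-1` [set t | t <= r])//.
by apply: closed_comp; [move=> x _; exact: continuous_eucl|exact: closed_le].
Qed.

Lemma compact_eucl_ball (a : V) r : compact [set x | eucl_norm (x - a) <= r].
Proof.
apply: bounded_closed_compact; last exact: closed_eucl_ball.
exists (`|a| + r); split; first exact: num_real.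
move=> M rM x /= xr; rewrite -(subrK a x) (le_trans (ler_normD _ _))//.
by rewrite (le_trans _ (ltW rM))// addrC lerD2l (le_trans (norm_le_eucl _)).
Qed.

End eucl_norm_theory.

Section cone.
Context {R : realType} {d : nat}.
Local Notation V := 'rV[R]_d.
Local Notation e_ i := (delta_mx 0 i : V).
Implicit Types (x y z : V) (U W : set V) (u v phi : V -> R).

(* All that is kept of comparison with cones: on the half ball, [u] is at most the mean
   of its value at the center and of its maximum on the ball. *)
Definition cone_above u U := forall x0 r, 0 < r ->
  (forall y, eucl_norm (y - x0) <= r -> U y) ->
  forall y, eucl_norm (y - x0) <= r / 2 ->
  exists2 z, eucl_norm (z - x0) <= r & 2 * u y <= u x0 + u z.

Definition infinity_subharmonic U u := forall x phi W, open W -> W `<=` U -> W x ->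
  is_Ck 2 W phi -> phi x = u x -> (forall y, W y -> u y <= phi y) ->
  0 <= infinity_laplacian phi x.

Lemma partial2E W phi (p : V -> R) i j x l : open W -> W x ->
  (forall y, W y -> is_derive y (e_ i) phi (p y)) -> is_derive x (e_ j) p l ->
  partial j (partial i phi) x = l.
Proof.
move=> oW Wx dphi dp.
have h : \near x, p x = partial i phi x.
  apply: filterS (open_nbhs_nbhs (conj oW Wx)) => y /dphi[_ h].
  by rewrite /partial h.
by have [_] := near_eq_is_derive h dp.
Qed.

Lemma is_Ck_sub k W W' phi : W `<=` W' -> is_Ck k W' phi -> is_Ck k W phi.
Proof.
move=> WW; elim: k phi => [|k IH] phi.
  by move=> [h _]; split=> // x /WW; exact: h.
move=> [h1 h2]; split; first by move=> x /WW; exact: h1.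
by move=> i; have [h3 h4] := h2 i; split; [move=> x /WW; exact: h3|exact: IH].
Qed.

Lemma is_derive_sqdist x0 i x : is_derive x (e_ i) (fun x => \sum_(j < d) (x - x0) 0 j ^+ 2)
  (2 * (x - x0) 0 i).
Proof.
have -> : (fun x => \sum_(j < d) (x - x0) 0 j ^+ 2) =
    \sum_(j < d) (fun x : V => (x - x0) 0 j ^+ 2).
  by apply/funext => y; rewrite fct_sumE.
have h j : is_derive x (e_ i) (fun x : V => (x - x0) 0 j ^+ 2) (2 * (x - x0) 0 j * (j == i)%:R).
  have -> : (fun x : V => (x - x0) 0 j ^+ 2) = ((fun x : V => x 0 j) \+ cst (- x0 0 j)) ^+ 2.
    by apply/funext => y; rewrite !mxE.
  apply: (is_derive_eq (is_deriveX 2 (is_deriveD (is_derive_coord j i x)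
    (is_derive_cst (- x0 0 j) x (e_ i))))).
  by rewrite addr0 /GRing.scale/= expr1 !mxE.
apply: (is_derive_eq (@is_derive_sum _ _ _ _ (fun j (x : V) => (x - x0) 0 j ^+ 2) x (e_ i) _ h)).
rewrite (bigD1 i)//= eqxx mulr1 big1 ?addr0// => j /negbTE ->.
by rewrite mulr0.
Qed.

Section radial.
Variables (x0 : V) (a A D : R).

Let rho x := eucl_norm (x - x0).
Let w x := (rho x)^-1.
Let phi x := a + A * rho x - D * rho x ^+ 2.
Let W : set V := [set x | 0 < rho x].

Let oW : open W.
Proof.
rewrite (_ : W = rho @^-1` [set t | 0 < t])//.
by apply: open_comp; [move=> x _; exact: continuous_eucl|exact: open_gt].
Qed.

Let is_derive_rho i x : W x -> is_derive x (e_ i) rho ((x - x0) 0 i * w x).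
Proof.
move=> Wx; have q0 : 0 < \sum_(j < d) (x - x0) 0 j ^+ 2 by rewrite -sqrtr_gt0.
apply: (is_derive_eq (is_derive_comp1 (is_derive1_sqrt q0) (is_derive_sqdist x0 i x))).
rewrite /w /rho /eucl_norm; field.
by rewrite gt_eqF// sqrtr_gt0.
Qed.

Let is_derive_w i x : W x -> is_derive x (e_ i) w (- ((x - x0) 0 i * w x ^+ 3)).
Proof.
move=> Wx; have rn0 : rho x != 0 by rewrite gt_eqF.
have hV := @is_deriveV _ id (rho x) 1 1 rn0 (is_derive_id (rho x) (1:R)).
apply: (is_derive_eq (is_derive_comp1 hV (is_derive_rho i Wx))).
by rewrite /GRing.scale/= /w; field.
Qed.

Let zc i x : R := (x - x0) 0 i.

Let is_derive_zc i j x : is_derive x (e_ j) (zc i) (i == j)%:R.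
Proof.
have -> : zc i = (fun x : V => x 0 i) \+ cst (- x0 0 i).
  by apply/funext => y; rewrite /zc !mxE.
apply: (is_derive_eq (is_deriveD (is_derive_coord i j x) (is_derive_cst (- x0 0 i) x (e_ j)))).
by rewrite addr0.
Qed.

Let c x := A * w x - 2 * D.

Let is_derive_phi i x : W x -> is_derive x (e_ i) phi (c x * zc i x).
Proof.
move=> Wx; have hr := is_derive_rho i Wx.
have -> : phi = (cst a \+ A *: rho) \- D *: rho ^+ 2 by [].
apply: (is_derive_eq (is_deriveB (is_deriveD (is_derive_cst a x (e_ i)) (is_deriveZ A hr))
  (is_deriveZ D (is_deriveX 2 hr)))).
rewrite /GRing.scale/= expr1 /c /w /zc; field.
by rewrite gt_eqF.
Qed.

Let phi2 i j x : R := c x * (i == j)%:R - A * zc i x * zc j x * w x ^+ 3.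

Let is_derive_phi2 i j x : W x -> is_derive x (e_ j) (fun x => c x * zc i x) (phi2 i j x).
Proof.
move=> Wx.
have hc : is_derive x (e_ j) c (A * (- (zc j x * w x ^+ 3))).
  have -> : c = A *: w \- cst (2 * D) by [].
  apply: (is_derive_eq (is_deriveB (is_deriveZ A (is_derive_w j Wx)) (is_derive_cst (2 * D) x (e_ j)))).
  by rewrite subr0.
apply: (is_derive_eq (is_deriveM hc (is_derive_zc i j x))).
rewrite /GRing.scale/= /phi2; ring.
Qed.

Let crho : continuous rho. Proof. exact: continuous_eucl. Qed.

Let cw x : W x -> {for x, continuous w}.
Proof.
move=> Wx; have rn0 : rho x != 0 by rewrite gt_eqF.
exact: (@cvgV _ _ _ _ rho (rho x) rn0 (@crho x)).
Qed.

Let czc i : continuous (zc i).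
Proof.
have -> : zc i = fun x : V => x 0 i - x0 0 i by apply/funext => y; rewrite /zc !mxE.
by apply: contB; [exact: coord_continuous|exact: cont_cst].
Qed.

Let cc x : W x -> {for x, continuous c}.
Proof.
move=> Wx; have -> : c = (cst A \* w) \- cst (2 * D) by [].
apply: continuousB; last exact: cst_continuous.
by apply: continuousM; [exact: cst_continuous|exact: cw].
Qed.

Lemma radial_Ck2 : is_Ck 2 W phi.
Proof.
apply: is_CkS_intro => //.
  move=> x _; have : continuous phi; last by apply.
  apply: contB.
    by apply: contD; [exact: cont_cst|apply: contM; [exact: cont_cst|exact: crho]].
  by apply: contM; [exact: cont_cst|apply: contM; exact: crho].
move=> i; exists (fun x => c x * zc i x); first by move=> x Wx; exact: is_derive_phi.
apply: is_CkS_intro => //.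
  by move=> x Wx; apply: continuousM; [exact: cc|exact: czc].
move=> j; exists (phi2 i j); first by move=> x Wx; exact: is_derive_phi2.
split=> // x Wx.
have -> : phi2 i j = (c \* cst (i == j)%:R) \- (((cst A \* zc i) \* zc j) \* (w \* (w \* w))).
  by apply/funext => y; rewrite /phi2 /=; ring.
apply: continuousB; first by apply: continuousM; [exact: cc|exact: cst_continuous].
apply: continuousM.
  apply: continuousM; last exact: czc.
  by apply: continuousM; [exact: cst_continuous|exact: czc].
by apply: continuousM; [exact: cw|apply: continuousM; exact: cw].
Qed.

(** For a radial function the infinity Laplacian is the squared radial derivative times the second
    radial derivative, here [(A - 2 D rho)^2] times [- 2 D]. *)
Lemma radial_laplacian x : W x ->
  infinity_laplacian phi x = - 2 * D * rho x ^+ 2 * (A / rho x - 2 * D) ^+ 2.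
Proof.
move=> Wx; have rn0 : rho x != 0 by rewrite gt_eqF.
have hp i : partial i phi x = c x * zc i x by have [_] := is_derive_phi i Wx.
have hp2 i j : partial j (partial i phi) x = phi2 i j x.
  by apply: (partial2E oW Wx (is_derive_phi i)); exact: is_derive_phi2.
have sz : \sum_(i < d) zc i x ^+ 2 = rho x ^+ 2.
  by rewrite /rho -dotv_xx; apply: eq_bigr => i _; rewrite expr2.
have inner i : \sum_(j < d) partial i phi x * partial j phi x * partial j (partial i phi) x =
    zc i x ^+ 2 * (c x ^+ 3 - A * c x ^+ 2 * w x ^+ 3 * rho x ^+ 2).
  transitivity (\sum_(j < d) (c x ^+ 3 * zc i x * (zc j x * (i == j)%:R)
     - A * c x ^+ 2 * w x ^+ 3 * zc i x ^+ 2 * zc j x ^+ 2)).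
    by apply: eq_bigr => j _; rewrite !hp hp2 /phi2; ring.
  rewrite sumrB -!mulr_sumr sz (bigD1 i)//= eqxx mulr1 big1 ?addr0; first by ring.
  by move=> j; rewrite eq_sym => /negbTE ->; rewrite mulr0.
rewrite /infinity_laplacian (eq_bigr _ (fun i _ => inner i)) -mulr_suml sz /c /w.
by field.
Qed.

End radial.

(** If the inequality fails at [y], a concave perturbation of the cone with vertex [x0] lies above
    [u] at [x0] and on the sphere but below it at [y]. Raised to the maximum of the difference, it
    touches [u] from above in the punctured ball, where its infinity Laplacian is negative. *)
Lemma subharmonic_cone_above U u : open U -> continuous u -> infinity_subharmonic U u ->
  cone_above u U.
Proof.
move=> oU cu hu x0 r r0 BU y yr.
pose Bc : set V := [set x | eucl_norm (x - x0) <= r].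
have cBc : compact Bc by exact: compact_eucl_ball.
have Bx0 : Bc x0 by rewrite /Bc/= subrr eucl_norm0 ltW.
have Bn0 : Bc !=set0 by exists x0.
have [z Bz hz] := @compact_EVT_max _ R u Bc Bn0 cBc (continuous_subspaceT cu).
rewrite inE in Bz; exists z => //.
rewrite leNgt; apply/negP => hlt.
have ux0z : u x0 <= u z by apply: hz; rewrite inE.
have uyz : u y <= u z by apply: hz; rewrite inE /Bc/= (le_trans yr)// ler_pdivrMr// ler_pMr//; lra.
(* [b] is the slope of the cone from [u x0] to the maximum [u z]. With [D * r ^+ 2 = gap / 4] and
   [A = b + 2 * D * r], the perturbed cone equals [u z + gap / 4] on the sphere, stays below [u y]
   by at least [gap / 4] at [y], and has radial slope [A - 2 * D * rho > 0] inside. *)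
pose b := (u z - u x0) / r.
have b0 : 0 <= b by rewrite divr_ge0 ?subr_ge0// ltW.
pose gap := 2 * u y - (u x0 + u z).
have gap0 : 0 < gap by rewrite subr_gt0.
pose D := gap / (4 * r ^+ 2).
have D0 : 0 < D by rewrite divr_gt0// mulr_gt0// exprn_gt0.
have Dr : D * r ^+ 2 = gap / 4 by rewrite /D; field; rewrite gt_eqF.
pose A := b + 2 * D * r.
have br : b * r = u z - u x0 by rewrite /b divfK// gt_eqF.
pose rho x := eucl_norm (x - x0).
pose phi x := u x0 + A * rho x - D * rho x ^+ 2.
have cphi : continuous phi.
  have crho : continuous rho by exact: continuous_eucl.
  apply: contB.
    by apply: contD; [exact: cont_cst|apply: contM; [exact: cont_cst|exact: crho]].
  by apply: contM; [exact: cont_cst|apply: contM; exact: crho].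
have [x1 Bx1 hx1] := @compact_EVT_max _ R (fun x => u x - phi x) Bc Bn0 cBc
  (continuous_subspaceT (contB cu cphi)).
rewrite inE in Bx1.
have rho0 x : 0 <= rho x by exact: eucl_norm_ge0.
have hy : 0 < u y - phi y.
  have A0 : 0 <= A by rewrite /A; nra.
  have h1 : A * rho y <= A * (r / 2) by rewrite ler_wpM2l.
  have h2 : 0 <= D * rho y ^+ 2 by rewrite mulr_ge0 ?sqr_ge0// ltW.
  have h3 : A * (r / 2) = (u z - u x0) / 2 + gap / 4 by rewrite -br -Dr /A; field.
  by rewrite /phi; move: gap0 h3; rewrite /gap; lra.
pose m := u x1 - phi x1.
have m0 : 0 < m.
  apply: (lt_le_trans hy); apply: hx1; rewrite inE /Bc/= (le_trans yr)//.
  by rewrite ler_pdivrMr// ler_pMr//; lra.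
have x1r : rho x1 < r.
  rewrite lt_neqAle Bx1 andbT; apply/eqP => h.
  move: m0; rewrite /m /phi h.
  have -> : u x0 + A * r - D * r ^+ 2 = u z + D * r ^+ 2 by rewrite -[u z](subrK (u x0)) -br /A; ring.
  have : u x1 <= u z by apply: hz; rewrite inE.
  by rewrite Dr; lra.
have x1p : 0 < rho x1.
  rewrite lt_def rho0 andbT; apply/eqP => h.
  have x10 : x1 = x0 by apply/eqP; rewrite -subr_eq0; apply/eqP; exact: eucl_norm_eq0 h.
  by move: m0; rewrite /m /phi h x10; lra.
pose W : set V := [set x | 0 < rho x /\ rho x < r].
have oW : open W.
  rewrite (_ : W = rho @^-1` [set t | 0 < t] `&` rho @^-1` [set t | t < r])//.
  by apply: openI; apply: open_comp; [move=> x _; exact: continuous_eucl|exact: open_gt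
     |move=> x _; exact: continuous_eucl|exact: open_lt].
have WU : W `<=` U by move=> x [_ xr]; apply: BU; exact: ltW.
have Wx1 : W x1 by [].
pose psi x := (m + u x0) + A * eucl_norm (x - x0) - D * eucl_norm (x - x0) ^+ 2.
have psiE x : psi x = phi x + m by rewrite /psi /phi /rho; ring.
have CkW : is_Ck 2 W psi.
  by apply: (is_Ck_sub _ (radial_Ck2 x0 (m + u x0) A D)) => x [].
have := hu x1 psi W oW WU Wx1 CkW.
rewrite (radial_laplacian _ _ _ x1p) psiE /m addrC subrK => /(_ erefl).
have touch z' : W z' -> u z' <= psi z'.
  move=> [_ zr]; rewrite psiE -lerBlDl; apply: hx1; rewrite inE; exact: ltW.
move=> /(_ touch); apply/negP; rewrite -ltNge.
have c0 : 0 < A / rho x1 - 2 * D.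
  rewrite subr_gt0 ltr_pdivlMr// /A.
  have : D * rho x1 < D * r by rewrite ltr_pM2l.
  by lra.
have : 0 < D * rho x1 ^+ 2 * (A / rho x1 - 2 * D) ^+ 2.
  by apply: mulr_gt0; [apply: mulr_gt0 => //|]; exact: exprn_gt0.
rewrite -/(rho x1); nra.
Qed.

End cone.

(** * Comparison of sub- and supersolutions through maximizing triples *)

Section comparison.
Context {R : realType} {d : nat}.
Local Notation V := 'rV[R]_d.
Implicit Types (x y z : V) (U Om : set V) (u v : V -> R).

Lemma closure_bounded Om : bounded_set Om -> compact (closure Om).
Proof.
move=> [M [_ hM]]; apply: bounded_closed_compact; last exact: closed_closure.
exists (M + 1); split; first exact: num_real.
move=> N MN x clx; apply/ler_addgt0Pr => e e0.
have [y [Omy]] := clx _ (nbhsx_ballx x e e0).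
rewrite mx_norm_ball /ball_/= => xy.
have := hM (M + 1); rewrite ltrDl ltr01 => /(_ isT _ Omy) yM.
rewrite -(subrK y x) (le_trans (ler_normD _ _))// addrC lerD//; last exact: ltW.
by rewrite (le_trans yM)// ltW.
Qed.

(** Connectedness of [[0, 1]]: the parameters whose point lies in [Om] form an open set, also closed
    because limit points lie in the closure, from which the hypothesis returns to [Om]. *)
Lemma segment_in Om (K : set V) x y : open Om -> Om x ->
  (forall t : R, 0 <= t <= 1 -> closure Om (x + t *: (y - x)) -> Om (x + t *: (y - x))) ->
  Om y.
Proof.
move=> oOm Omx h.
pose A : set R := `[0, 1]%classic.
pose f (t : R) := x + t *: (y - x).
have cf : continuous f.
  move=> t; apply: (@cvgD _ _ _ _ _ (fun=> x) (fun t => t *: (y - x))); first exact: cvg_cst.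
  exact: scalel_continuous.
have cA : connected A by exact: segment_connected.
pose B := A `&` f @^-1` Om.
have BA : B = A.
  apply: cA.
  - exists 0; split; first by rewrite /A/= in_itv/= lexx ler01.
    by rewrite /f/= scale0r addr0.
  - exists (f @^-1` Om) => //; apply: open_comp => // t _; exact: cf.
  - exists (f @^-1` closure Om).
      by apply: closed_comp; [move=> t _; exact: cf|exact: closed_closure].
    apply/seteqP; split=> t [At ft]; split=> //; first exact: subset_closure.
    by apply: h => //; move: At; rewrite /A/= in_itv.
have : B 1 by rewrite BA /A/= in_itv/= lexx ler01.
by rewrite /B/f/= scale1r addrC subrK => -[].
Qed.

Lemma cone_comparison (i0 : 'I_d) Om U u v : open Om -> bounded_set Om ->
  continuous u -> continuous v -> U `<=` Om ->
  cone_above u U -> cone_above (fun x => - v x) Om ->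
  (forall x, closure Om x -> ~ U x -> u x <= v x) ->
  forall x, closure Om x -> u x <= v x.
Proof.
move=> oOm bOm cu cv UOm hu hv hb xs Kxs; rewrite leNgt; apply/negP => hlt.
set K := closure Om in hb Kxs *.
have cK : compact K by exact: closure_bounded.
(* The maximum over triples is at least [4 * m], while [u] and [v] change by less than [m] over
   distance [3 * e]. A point [w] of the closure within [2 * e] of [x0] therefore has [u w > v w],
   hence lies in [U]. *)
pose m := (u xs - v xs) / 4.
have m0 : 0 < m by rewrite divr_gt0// subr_gt0.
have [tu tu0 htu] := heine_compact cK (fun x _ => cu x) m0.
have [tv tv0 htv] := heine_compact cK (fun x _ => cv x) m0.
pose e := Num.min tu tv / 4.
have mt0 : 0 < Num.min tu tv by rewrite lt_min tu0.
have e0 : 0 < e by rewrite divr_gt0.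
have eu x y : K x -> eucl_norm (x - y) <= 3 * e -> `|u x - u y| < m.
  move=> Kx xy; apply: htu => //; rewrite (le_lt_trans (norm_le_eucl _))// (le_lt_trans xy)//.
  have : Num.min tu tv <= tu by rewrite ge_min lexx.
  by rewrite /e; lra.
have ev x y : K x -> eucl_norm (x - y) <= 3 * e -> `|v x - v y| < m.
  move=> Kx xy; apply: htv => //; rewrite (le_lt_trans (norm_le_eucl _))// (le_lt_trans xy)//.
  have : Num.min tu tv <= tv by rewrite ge_min lexx orbT.
  by rewrite /e; lra.
pose T0 : set (V * (V * V)) := K `*` (K `*` K).
have cT0 : compact T0 by apply: compact_setX => //; exact: compact_setX.
have c1 : continuous (fun p : V * (V * V) => p.1) by move=> p; exact: cvg_fst.
have c2 : continuous (fun p : V * (V * V) => p.2.1).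
  move=> p; apply: (@continuous_comp _ _ _ (fun p : V * (V * V) => p.2) fst).
    exact: cvg_snd.
  exact: cvg_fst.
have c3 : continuous (fun p : V * (V * V) => p.2.2).
  move=> p; apply: (@continuous_comp _ _ _ (fun p : V * (V * V) => p.2) snd).
    exact: cvg_snd.
  exact: cvg_snd.
have cn (q : V * (V * V) -> V) : continuous q ->
    continuous (fun p : V * (V * V) => eucl_norm (p.1 - q p)).
  move=> cq p.
  apply: (@continuous_comp _ _ _ (fun p : V * (V * V) => p.1 - q p) (fun x => eucl_norm x)).
    by apply: continuousB; [exact: c1|exact: cq].
  have h : (fun x : V => eucl_norm (x - 0)) = (fun x => eucl_norm x).
    by apply/funext => x; rewrite subr0.
  by have := @continuous_eucl R d 0; rewrite h => ce; exact: ce.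
pose near2 (q : V * (V * V) -> V) := [set p : V * (V * V) | eucl_norm (p.1 - q p) <= e].
have cl_near (q : V * (V * V) -> V) : continuous q -> closed (near2 q).
  move=> cq; rewrite (_ : near2 q = (fun p : V * (V * V) => eucl_norm (p.1 - q p)) @^-1` [set t | t <= e])//.
  by apply: closed_comp; [move=> p _; exact: cn|exact: closed_le].
pose T := T0 `&` (near2 (fun p => p.2.1) `&` near2 (fun p => p.2.2)).
have cT : compact T.
  by apply: compact_closedI => //; apply: closedI; exact: cl_near.
have TP x y z : K x -> K y -> K z -> eucl_norm (x - y) <= e -> eucl_norm (x - z) <= e ->
  T (x, (y, z)) by [].
pose f (p : V * (V * V)) := u p.2.1 - v p.2.2.
have cuf : continuous (fun p : V * (V * V) => u p.2.1).
  by move=> p; apply: (@continuous_comp _ _ _ (fun p : V * (V * V) => p.2.1) u); [exact: c2|exact: cu].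
have cvf : continuous (fun p : V * (V * V) => v p.2.2).
  by move=> p; apply: (@continuous_comp _ _ _ (fun p : V * (V * V) => p.2.2) v); [exact: c3|exact: cv].
have cf : continuous f by move=> p; apply: continuousB; [exact: cuf|exact: cvf].
have e00 : eucl_norm (xs - xs) <= e by rewrite subrr eucl_norm0 ltW.
have Txs : T (xs, (xs, xs)) by exact: TP.
(* Among the triples maximizing [u y - v z], those maximizing [u y], and among these
   one maximizing the coordinate [x 0 i0], which moving [x] then contradicts. *)
have [pM TpM hM] : exists2 p, T p & forall q, T q -> f q <= f p.
  have [|p Tp hp] := @compact_EVT_max _ R f T _ cT (continuous_subspaceT cf); first by exists (xs, (xs, xs)).
  by exists p; [move: Tp; rewrite inE|move=> q Tq; apply: hp; rewrite inE].
pose T1 := T `&` [set p | f pM <= f p].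
have cT1 : compact T1.
  apply: compact_closedI => //.
  rewrite (_ : [set _ | _] = f @^-1` [set t | f pM <= t])//.
  by apply: closed_comp; [move=> p _; exact: cf|exact: closed_ge].
have T1pM : T1 pM by split=> //=.
have [pN T1pN hN] : exists2 p, T1 p & forall q, T1 q -> u q.2.1 <= u p.2.1.
  have [|p Tp hp] := @compact_EVT_max _ R (fun p : V * (V * V) => u p.2.1) T1 _ cT1 (continuous_subspaceT cuf); first by exists pM.
  by exists p; [move: Tp; rewrite inE|move=> q Tq; apply: hp; rewrite inE].
pose T2 := T1 `&` [set p | u pN.2.1 <= u p.2.1].
have cT2 : compact T2.
  apply: compact_closedI => //.
  rewrite (_ : [set _ | _] = (fun p : V * (V * V) => u p.2.1) @^-1` [set t | u pN.2.1 <= t])//.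
  by apply: closed_comp; [move=> p _; exact: cuf|exact: closed_ge].
have T2pN : T2 pN by split=> //=.
have cc0 : continuous (fun p : V * (V * V) => p.1 0 i0).
  move=> p; apply: (@continuous_comp _ _ _ (fun p : V * (V * V) => p.1) (fun x : V => x 0 i0)).
    exact: c1.
  exact: coord_continuous.
have [[x0 [y0 z0]] T2p0 h0] : exists2 p, T2 p & forall q, T2 q -> q.1 0 i0 <= p.1 0 i0.
  have [|p Tp hp] := @compact_EVT_max _ R (fun p : V * (V * V) => p.1 0 i0) T2 _ cT2 (continuous_subspaceT cc0); first by exists pN.
  by exists p; [move: Tp; rewrite inE|move=> q Tq; apply: hp; rewrite inE].
have [[Tp0 /= fM] /= uN] := T2p0.
have [[Kx0 [Ky0 Kz0]] [/= xy0 xz0]] := Tp0.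
rewrite /= in Kx0 Ky0 Kz0.
have {}xy0 : eucl_norm (x0 - y0) <= e by exact: xy0.
have {}xz0 : eucl_norm (x0 - z0) <= e by exact: xz0.
have fmax q : T q -> f q <= u y0 - v z0 by move=> /hM h; exact: le_trans fM.
have umax q : T q -> u y0 - v z0 <= f q -> u q.2.1 <= u y0.
  move=> Tq hq; apply: le_trans uN; apply: hN; split=> //=; exact: le_trans fM hq.
have xmax q : T q -> u y0 - v z0 <= f q -> u y0 <= u q.2.1 -> q.1 0 i0 <= x0 0 i0.
  move=> Tq hq uq; apply: h0; split; last exact: le_trans uN uq.
  by split=> //=; exact: le_trans fM hq.
have big : 4 * m <= u y0 - v z0.
  have : 4 * m = f (xs, (xs, xs)) by rewrite /m /f/=; field.
  by move=> ->; exact: fmax.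
have nearU w : K w -> eucl_norm (w - x0) <= 2 * e -> U w.
  move=> Kw wx; apply: contrapT => nU; have := hb w Kw nU.
  have d1 : eucl_norm (w - y0) <= 3 * e by have := eucl_dist_tri x0 w y0; lra.
  have d2 : eucl_norm (w - z0) <= 3 * e by have := eucl_dist_tri x0 w z0; lra.
  have := eu _ _ Kw d1; have := ev _ _ Kw d2; rewrite !ltr_norml => /andP[a1 a2] /andP[a3 a4].
  lra.
have Ox0 : Om x0 by apply: UOm; apply: nearU => //; rewrite subrr eucl_norm0 mulr_ge0// ltW.
(* [nearU] only speaks of points of the closure; walking from [x0] along the segment excludes that
   the ball leaves [Om]. *)
have ballOm w : eucl_norm (w - x0) <= 2 * e -> Om w.
  move=> wx; apply: (@segment_in Om K x0) => // t /andP[t0 t1] clt.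
  apply/UOm/nearU => //; rewrite addrC addKr eucl_normZ (ger0_norm t0).
  by rewrite (le_trans _ wx)// ler_piMl// eucl_norm_ge0.
have OmK w : Om w -> K w by move=> ?; exact: subset_closure.
have ballK w : eucl_norm (w - x0) <= 2 * e -> K w by move=> /ballOm/OmK.
have ballU w : eucl_norm (w - x0) <= 2 * e -> U w by move=> h; apply: nearU => //; exact: ballK.
have e20 : 0 < 2 * e by rewrite mulr_gt0.
have e2e : 2 * e / 2 = e by field.
have xx0 : eucl_norm (x0 - x0) <= e by rewrite subrr eucl_norm0 ltW.
have mid w : eucl_norm (w - x0) <= 2 * e -> exists x1, [/\ K x1,
    eucl_norm (x1 - x0) <= e & eucl_norm (x1 - w) <= e].
  move=> wx; exists (x0 + 2^-1 *: (w - x0)).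
  have h1 : eucl_norm (x0 + 2^-1 *: (w - x0) - x0) <= e.
    by rewrite [x0 + _]addrC addrK eucl_normZ ger0_norm//; lra.
  have h2 : eucl_norm (x0 + 2^-1 *: (w - x0) - w) <= e.
    rewrite (_ : _ - w = - (2^-1 *: (w - x0))); first by rewrite eucl_normN eucl_normZ ger0_norm//; lra.
    by apply/rowP => i; rewrite !mxE; field.
  by split=> //; apply: ballK; rewrite (le_trans h1)//; lra.
have y0x : eucl_norm (y0 - x0) <= 2 * e / 2 by rewrite e2e eucl_distC.
have z0x : eucl_norm (z0 - x0) <= 2 * e / 2 by rewrite e2e eucl_distC.
(* The mean inequalities at [x0] add up to [2 (u y0 - v z0) <= (u w - v x0) + (u x0 - v w')].
   Midpoints [x1], [x2] make both brackets values of [f] on [T], so neither exceeds the maximum and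
   both equal it. *)
have [w wx uw] := hu x0 (2 * e) e20 ballU y0 y0x.
have [w' w'x vw] := hv x0 (2 * e) e20 ballOm z0 z0x.
have [x1 [Kx1 x1x x1w]] := mid w wx.
have [x2 [Kx2 x2x x2w]] := mid w' w'x.
have Kw := ballK w wx; have Kw' := ballK w' w'x.
have := fmax _ (TP x2 x0 w' Kx2 Kx0 Kw' x2x x2w); rewrite /f/= => f2.
(* If [u w > u y0], the triple [(x1, (w, x0))] maximizes [f] with a larger [u], against the second
   choice. Otherwise the mean inequalities force [u x0 = u y0] and [v x0 <= v z0], so
   [(x, (x0, x0))] is optimal for every [x] of the closure within [e] of [x0]; moving [x] by [e]
   along [i0] contradicts the third choice. *)
have [uwle|uwgt] := leP (u w) (u y0).
  have := fmax _ (TP x0 x0 z0 Kx0 Kx0 Kz0 xx0 xz0); rewrite /f/= => f1.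
  have := fmax _ (TP x0 x0 x0 Kx0 Kx0 Kx0 xx0 xx0); rewrite /f/= => f3.
  pose x3 := x0 + e *: delta_mx 0 i0.
  have x3x : eucl_norm (x3 - x0) <= e.
    by rewrite /x3 [x0 + _]addrC addrK eucl_normZ eucl_delta mulr1 gtr0_norm.
  have Kx3 : K x3 by apply: ballK; rewrite (le_trans x3x)//; lra.
  have := xmax _ (TP x3 x0 x0 Kx3 Kx0 Kx0 x3x x3x); rewrite /f/= !mxE !eqxx mulr1.
  have a1 : u y0 - v z0 <= u x0 - v x0 by lra.
  have a2 : u y0 <= u x0 by lra.
  by move=> /(_ a1 a2); lra.
have T1w := TP x1 w x0 Kx1 Kw Kx0 x1w x1x.
have [le1|lt1] := leP (u y0 - v z0) (u w - v x0); last by lra.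
by have := umax _ T1w le1; rewrite /= leNgt uwgt.
Qed.

End comparison.

(** * Sobolev functions *)

Section power_inequalities.
Context {R : realType}.
Implicit Types a b p : R.

Lemma powR_add_le a b p : 0 <= a -> 0 <= b -> 0 <= p ->
  (a + b) `^ p <= 2 `^ p * (a `^ p + b `^ p).
Proof.
move=> a0 b0 p0.
have h c : 0 <= c -> (2 * c) `^ p = 2 `^ p * c `^ p by move=> c0; rewrite powRM.
have [ab|/ltW ba] := leP a b.
  apply: (@le_trans _ _ ((2 * b) `^ p)).
    by apply: ge0_ler_powR; rewrite ?nnegrE ?addr_ge0 ?mulr_ge0//; lra.
  by rewrite h// ler_wpM2l ?powR_ge0// lerDr powR_ge0.
apply: (@le_trans _ _ ((2 * a) `^ p)).
  by apply: ge0_ler_powR; rewrite ?nnegrE ?addr_ge0 ?mulr_ge0//; lra.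
by rewrite h// ler_wpM2l ?powR_ge0// lerDl powR_ge0.
Qed.

Lemma le_1_powR a p : 0 <= a -> 1 <= p -> a <= 1 + a `^ p.
Proof.
move=> a0 p1; have [a1|/ltW a1] := leP a 1; first by rewrite (le_trans a1)// lerDl powR_ge0.
rewrite (@le_trans _ _ (a `^ p))//; last by rewrite lerDr.
by rewrite -{1}[a]powRr1// ler_powR.
Qed.

End power_inequalities.

(** * Sobolev functions and traces in terms of whole-space integrals *)

Section bridge.
Context {R : realType} {d : nat}.
Local Notation V := 'rV[R]_d.
Local Notation mu := (lebesgue_rV R d).
Local Notation e_ i := (delta_mx 0 i : V).
Variable Om : set V.
Hypotheses (oOm : open Om) (bOm : bounded_set Om).

Let mOm : measurable Om. Proof. exact: open_measurable_rV. Qed.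

Lemma test_functionP phi : test_function Om phi <-> smooth phi /\ Cc Om phi.
Proof.
split=> [[sp [K [cK KO pK]]]|[sp [_ [K [cK KO pK]]]]].
  by split=> //; split; [exact: smooth_continuous|exists K].
by split=> //; exists K.
Qed.

Lemma fin_muOm : (mu Om < +oo)%E.
Proof. exact: lebesgue_rV_bounded. Qed.

Lemma integrable_Om (f : V -> R) : mu.-integrable Om (EFin \o f) -> L1 (f \_ Om).
Proof.
move=> hf; rewrite /L1 -restrict_EFin; apply/integrable_restrict => //.
by rewrite setTI.
Qed.

Lemma ge0_integrableP (g : V -> R) : measurable_fun Om g -> (forall x, Om x -> 0 <= g x) ->
  (\int[mu]_(x in Om) (g x)%:E < +oo)%E <-> mu.-integrable Om (EFin \o g).
Proof.
move=> mg g0.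
have gE : (\int[mu]_(x in Om) `|(EFin \o g) x|)%E = (\int[mu]_(x in Om) (g x)%:E)%E.
  by apply: eq_integral => x; rewrite inE => Ox /=; rewrite ger0_norm// g0.
split=> [goo|/integrableP[_]]; last by rewrite gE.
by apply/integrableP; split; [exact/measurable_EFinP|rewrite gE].
Qed.

Lemma integrable_cst_Om (C : R) : mu.-integrable Om (EFin \o cst C).
Proof.
apply: measurable_bounded_integrable => //; first exact: fin_muOm.
by exists `|C|; split=> [|M CM x _]; [exact: num_real|exact: ltW].
Qed.

Lemma integrable_bound (f g : V -> R) : measurable_fun Om f ->
  (forall x, Om x -> `|f x| <= g x) -> mu.-integrable Om (EFin \o g) ->
  mu.-integrable Om (EFin \o f).
Proof.
move=> mf fg ig; apply: (@le_integrable _ _ _ _ _ mOm _ (EFin \o g)).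
- exact/measurable_EFinP.
- by move=> x Ox /=; rewrite lee_fin (le_trans (fg x Ox))// ler_norm.
- exact: ig.
Qed.

Lemma measurable_normpow p (f : V -> R) : measurable_fun Om f ->
  measurable_fun Om (fun x => `|f x| `^ p).
Proof.
move=> mf; apply: (measurableT_comp (measurable_powR p)).
exact: (measurableT_comp (@normr_measurable R setT)).
Qed.

Lemma in_LpP p (f : V -> R) : in_Lp Om p f <->
  measurable_fun Om f /\ mu.-integrable Om (EFin \o (fun x => `|f x| `^ p)).
Proof.
have h := fun mf => @ge0_integrableP (fun x => `|f x| `^ p) (@measurable_normpow p f mf)
  (fun x _ => powR_ge0 _ _).
by split=> -[mf /(h mf) foo]; split.
Qed.

Lemma in_Lp_D p (f g : V -> R) : 0 <= p -> in_Lp Om p f -> in_Lp Om p g ->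
  in_Lp Om p (fun x => f x + g x).
Proof.
move=> p0 /in_LpP[mf fi] /in_LpP[mg gi].
have mfg : measurable_fun Om (fun x => f x + g x) by exact: measurable_funD.
apply/in_LpP; split; first exact: mfg.
have := integrableZl mOm (2 `^ p) (integrableD mOm fi gi).
apply: integrable_bound; first exact: measurable_normpow.
move=> x Ox; rewrite ger0_norm ?powR_ge0//.
rewrite (le_trans _ (powR_add_le _ _ p0))//.
by apply: ge0_ler_powR; rewrite ?nnegrE ?addr_ge0// ler_normD.
Qed.

Lemma in_Lp_bounded p (f : V -> R) (C : R) : 0 <= p -> measurable_fun Om f ->
  (forall x, Om x -> `|f x| <= C) -> in_Lp Om p f.
Proof.
move=> p0 mf fC; apply/in_LpP; split; first exact: mf.
apply: (integrable_bound _ _ (integrable_cst_Om (`|C| `^ p))).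
  exact: measurable_normpow.
move=> x Ox /=; rewrite ger0_norm ?powR_ge0//.
by apply: ge0_ler_powR; rewrite ?nnegrE// (le_trans (fC x Ox))// ler_norm.
Qed.

Lemma in_Lp_le p (f f1 : V -> R) : 0 <= p -> measurable_fun Om f ->
  (forall x, Om x -> `|f x| <= `|f1 x|) -> in_Lp Om p f1 -> in_Lp Om p f.
Proof.
move=> p0 mf ff1 /in_LpP[mf1 i1]; apply/in_LpP; split; first exact: mf.
apply: (integrable_bound _ _ i1); first exact: measurable_normpow.
move=> x Ox; rewrite ger0_norm ?powR_ge0//.
by apply: ge0_ler_powR; rewrite ?nnegrE// ff1.
Qed.

Lemma in_Lp_norm p (f : V -> R) : in_Lp Om p f -> in_Lp Om p (fun x => `|f x|).
Proof.
move=> [mf foo]; split; first exact: (measurableT_comp (@normr_measurable R setT)).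
by under eq_integral do rewrite normr_id.
Qed.

Lemma in_Lp_bound p (f f1 : V -> R) (C : R) : 0 <= p -> 0 <= C -> measurable_fun Om f ->
  (forall x, Om x -> `|f x| <= `|f1 x| + C) -> in_Lp Om p f1 -> in_Lp Om p f.
Proof.
move=> p0 C0 mf fC h1.
have hC : in_Lp Om p (cst C) by apply: (@in_Lp_bounded p _ `|C|).
apply: (in_Lp_le p0 mf _ (in_Lp_D p0 (in_Lp_norm h1) hC)) => x Ox.
by rewrite (le_trans (fC x Ox))// ler_norm.
Qed.

Lemma in_Lp_integrable p (f : V -> R) : 1 <= p -> in_Lp Om p f ->
  mu.-integrable Om (EFin \o f).
Proof.
move=> p1 /in_LpP[mf fi].
have := integrableD mOm fi (integrable_cst_Om 1).
apply: integrable_bound; first exact: mf.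
by move=> x _ /=; rewrite addrC le_1_powR.
Qed.

Lemma in_Lp_L1 p (f : V -> R) : 1 <= p -> in_Lp Om p f -> L1 (f \_ Om).
Proof. by move=> p1 /(in_Lp_integrable p1)/integrable_Om. Qed.

(** Tests and their partial derivatives vanish off [Om], so both integrals extend to the whole
    space. [G] is arbitrary outside [Om], so it is cut off in order to become integrable
    everywhere. *)
Lemma weak_gradient_intg u (G : V -> V) : weak_gradient Om u G <->
  forall i phi, smooth phi -> Cc Om phi ->
    intg (fun x => u x * partial i phi x) = - intg (fun x => ((fun x => G x 0 i) \_ Om) x * phi x).
Proof.
have E1 i phi : smooth phi -> Cc Om phi -> \int[mu]_(x in Om) (u x * partial i phi x) =
    intg (fun x => u x * partial i phi x).
  move=> sp [cp [K [cK KO pK]]]; rewrite Rintegral_mkcond; apply: eq_intg => x.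
  rewrite patchE; case: ifPn => // /negP; rewrite inE => nOx.
  rewrite (partial_supp (fun x => smooth_is_derive i x sp) (rV_compact_closed cK) pK) ?mulr0//.
  by move=> /KO.
have E2 i phi : Cc Om phi -> \int[mu]_(x in Om) (G x 0 i * phi x) =
    intg (fun x => ((fun x => G x 0 i) \_ Om) x * phi x).
  move=> [cp [K [cK KO pK]]]; rewrite Rintegral_mkcond; apply: eq_intg => x.
  by rewrite !patchE; case: ifPn => //; rewrite mul0r.
split=> [h i phi sp Cp|h i phi /test_functionP[sp Cp]].
  by rewrite -E1// -E2//; apply: h; exact/test_functionP.
by rewrite E1// E2//; exact: h.
Qed.

Lemma sobolev_has_dq p u (G : V -> V) i : 1 <= p -> continuous u ->
  sobolev_grad Om p u G -> has_dq Om i u ((fun x => G x 0 i) \_ Om).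
Proof.
move=> p1 cu [_ LG /weak_gradient_intg wG].
apply: has_dq_weak => //; first exact: in_Lp_L1 p1 (LG i).
by move=> phi sp Cp; exact: wG.
Qed.

Lemma L1M_Om (f B : V -> R) : L1 (f \_ Om) -> Cc Om B -> L1 (fun x => (f \_ Om) x * B x).
Proof.
move=> Lf [cB [K [cK _ BK]]]; have [M _ hM] := Cc_bounded cB cK BK.
by apply: L1M hM => //; exact: continuous_measurable_rV.
Qed.

Lemma sobolev_grad_add p u (G : V -> V) (g : V -> R) (Gm : V -> V) : 1 <= p ->
  sobolev_grad Om p u G -> sobolev_grad Om p g Gm ->
  sobolev_grad Om p (fun x => u x + g x) (fun x => G x + Gm x).
Proof.
move=> p1 [Lu LG /weak_gradient_intg wu] [Lg LGm /weak_gradient_intg wg].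
have p0 : 0 <= p by rewrite (le_trans _ p1).
have GE i : (fun x => (G x + Gm x) 0 i) = (fun x => G x 0 i + Gm x 0 i).
  by apply/funext => x; rewrite mxE.
split; first exact: (in_Lp_D p0 Lu Lg).
  by move=> i; rewrite GE; exact: (in_Lp_D p0 (LG i) (LGm i)).
apply/weak_gradient_intg => i phi sp Cp.
have [cp [K [cK KO pK]]] := Cp.
have dK := partial_supp (fun x => smooth_is_derive i x sp) (rV_compact_closed cK) pK.
have Cd : Cc Om (partial i phi).
  by split; [exact: smooth_continuous (smooth_partial i sp)|exists K].
have uE (f : V -> R) x : f x * partial i phi x = (f \_ Om) x * partial i phi x.
  rewrite patchE; case: ifPn => // /negP; rewrite inE => nOx.
  by rewrite dK ?mulr0// => /KO.
have L f B : in_Lp Om p f -> Cc Om B -> L1 (fun x => (f \_ Om) x * B x).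
  by move=> Lf; apply: L1M_Om; exact: in_Lp_L1 p1 Lf.
have Lu' : L1 (fun x => u x * partial i phi x).
  by have := L _ _ Lu Cd; apply: eq_L1 => x; rewrite -uE.
have Lg' : L1 (fun x => g x * partial i phi x).
  by have := L _ _ Lg Cd; apply: eq_L1 => x; rewrite -uE.
have -> : intg (fun x => (u x + g x) * partial i phi x) =
    intg (fun x => u x * partial i phi x) + intg (fun x => g x * partial i phi x).
  by rewrite -intgD//; apply: eq_intg => x; rewrite mulrDl.
have LG' := L _ _ (LG i) Cp; have LGm' := L _ _ (LGm i) Cp.
rewrite wu// wg// -opprD -intgD//.
congr (- _); apply: eq_intg => x; rewrite !patchE.
by case: ifPn => _; rewrite ?mxE ?mulrDl// !mul0r addr0.
Qed.

(** Adding [g] to every approximant leaves the differences with the limit unchanged, and the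
    boundary values too, since the open set [Om] does not meet its boundary. *)
Lemma has_trace_add p u (F : V -> R) : 1 <= p -> has_trace Om p u F ->
  exists2 G, sobolev_grad Om p u G &
  forall g (Gm : V -> V), continuous g -> (forall x, ~ Om x -> g x = 0) ->
    sobolev_grad Om p g Gm -> has_trace Om p (fun x => u x + g x) F.
Proof.
move=> p1 [G [w [H [sG hw hcvg hbd]]]]; exists G => // g Gm cg gO sg.
exists (fun x => G x + Gm x), (fun k x => w k x + g x), (fun k x => H k x + Gm x); split.
- exact: sobolev_grad_add.
- move=> k; have [sH cw] := hw k; split; first exact: sobolev_grad_add.
  move=> x; apply: continuousD; first exact: cw.
  exact: (continuous_subspaceT cg).
- apply: cvg_trans hcvg; apply: near_eq_cvg; apply: nearW => k.
  have E1 : (w k \- u) = (fun x => w k x + g x) \- (fun x => u x + g x).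
    by apply/funext => x /=; rewrite opprD addrACA subrr addr0.
  have E2 : (H k \- G) = (fun x => H k x + Gm x) \- (fun x => G x + Gm x).
    by apply/funext => x /=; rewrite opprD addrACA subrr addr0.
  by rewrite E1 E2.
- apply: cvg_trans hbd; apply: near_eq_cvg; apply: nearW => k.
  apply: eq_integral => x; rewrite inE => -[_ nOx].
  rewrite gO ?addr0// => Ox; apply: nOx; rewrite /interior.
  exact: open_nbhs_nbhs.
Qed.

Lemma ae_le_continuous (f g : V -> R) : continuous f -> continuous g ->
  {ae mu, forall x, Om x -> f x <= g x} -> forall x, Om x -> f x <= g x.
Proof.
move=> cf cg [N [mN N0 hN]] x Ox; rewrite leNgt; apply/negP => gf.
pose U := Om `&` [set y | g y < f y].
have oU : open U.
  apply: openI => //.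
  rewrite (_ : [set _ | _] = (fun y => f y - g y) @^-1` [set t | 0 < t]); last first.
    by apply/seteqP; split=> y /=; rewrite subr_gt0.
  by apply: open_comp; [move=> y _; exact: (contB cf cg)|exact: open_gt].
have := lebesgue_rV_open_gt0 oU (ex_intro _ x (conj Ox gf)).
suff : (mu U <= 0)%E by move=> /le_lt_trans /[apply]; rewrite ltxx.
rewrite -N0; apply: le_measure; rewrite ?inE//; first exact: open_measurable_rV.
move=> y [Oy gfy]; apply: hN => /= /(_ Oy).
by rewrite leNgt gfy.
Qed.

End bridge.

(** * Energy-decreasing competitors *)

Section convexity.
Context {R : realType}.
Implicit Types s t p : R.

Lemma powR_pred t p : 0 <= t -> 1 < p -> t `^ (p - 1) * t = t `^ p.
Proof.
move=> t0 p1; have [->|tn0] := eqVneq t 0.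
  by rewrite mulr0 powR0// gt_eqF// (lt_trans _ p1).
rewrite -{2}[t]powRr1// -powRD ?subrK//.
by apply/implyP.
Qed.

(** This is Young's inequality for [s] and [t ^ (p-1)] with exponents [p] and [p / (p-1)]. *)
Lemma powR_tangent s t p : 0 <= s -> 0 <= t -> 1 < p ->
  t `^ p + p * t `^ (p - 1) * (s - t) <= s `^ p.
Proof.
move=> s0 t0 p1.
have p0 : 0 < p by rewrite (lt_trans _ p1).
have p10 : 0 < p - 1 by rewrite subr_gt0.
have pq : p^-1 + (p / (p - 1))^-1 = 1.
  by field; rewrite gt_eqF// gt_eqF.
have q0 : 0 < p / (p - 1) by rewrite divr_gt0.
have := conjugate_powR s0 (powR_ge0 t (p - 1)) p0 q0 pq.
rewrite -powRrM mulrCA divff ?gt_eqF// mulr1 => h.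
have h2 := powR_pred t0 p1.
have : p * (s * t `^ (p - 1)) <= p * (s `^ p / p + t `^ p / (p / (p - 1))).
  by rewrite ler_pM2l.
have -> : p * (s `^ p / p + t `^ p / (p / (p - 1))) = s `^ p + (p - 1) * t `^ p.
  by field; rewrite !gt_eqF.
have -> : p * t `^ (p - 1) * (s - t) = p * (s * t `^ (p - 1)) - p * t `^ p.
  by rewrite -h2; ring.
by lra.
Qed.

Context {d : nat}.
Local Notation V := 'rV[R]_d.

(** Convexity on the segment, then the tangent inequality at [b] and Cauchy-Schwarz. Linearizing at
    [b] matters: [b] will be a smooth gradient and [a] a merely integrable one, so the weight
    [|b|^(p-2) b] can be integrated by parts. *)
Lemma eucl_convex (a b : V) (t p : R) : 0 <= t <= 1 -> 2 < p ->
  eucl_norm ((1 - t) *: a + t *: b) `^ p <=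
  eucl_norm a `^ p + p * t * (eucl_norm b `^ (p - 2) * dotv b (b - a)).
Proof.
move=> /andP[t0 t1] p2; have p1 : 1 < p by lra.
have p0 : 0 <= p by lra.
set A := eucl_norm a; set B := eucl_norm b.
have A0 : 0 <= A by exact: eucl_norm_ge0.
have B0 : 0 <= B by exact: eucl_norm_ge0.
pose m := (1 - t) * A + t * B.
have t1' : 0 <= 1 - t by lra.
have m0 : 0 <= m by rewrite addr_ge0// mulr_ge0.
have h1 : eucl_norm ((1 - t) *: a + t *: b) `^ p <= m `^ p.
  apply: ge0_ler_powR; rewrite ?nnegrE ?eucl_norm_ge0//.
  by rewrite (le_trans (eucl_normD _ _))// !eucl_normZ (ger0_norm t0) (ger0_norm t1').
have h2 : m `^ p <= (1 - t) * A `^ p + t * B `^ p.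
  have := ler_wpM2l t1' (powR_tangent A0 m0 p1).
  have := ler_wpM2l t0 (powR_tangent B0 m0 p1).
  set Y := m `^ (p - 1); set M := m `^ p => i1 i2.
  have e1 : (1 - t) * (M + p * Y * (A - m)) + t * (M + p * Y * (B - m)) = M.
    by rewrite /m; ring.
  by lra.
have h3 := powR_tangent A0 B0 p1.
have h4 : B `^ (p - 1) = B `^ (p - 2) * B.
  have -> : p - 2 = (p - 1) - 1 by ring.
  have [->|Bn0] := eqVneq B 0; last first.
    by rewrite -{3}[B]powRr1// -powRD ?subrK//; apply/implyP.
  by rewrite mulr0 powR0// gt_eqF//; lra.
have h5 := powR_pred B0 p1.
have h6 : B ^+ 2 - B * A <= dotv b (b - a).
  have -> : dotv b (b - a) = dotv b b - dotv b a.
    by rewrite /dotv -sumrB; apply: eq_bigr => i _; rewrite !mxE; ring.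
  by rewrite dotv_xx lerD2l lerN2 cauchy_schwarz.
have h7 : p * t * (B `^ (p - 2) * (B ^+ 2 - B * A)) <= p * t * (B `^ (p - 2) * dotv b (b - a)).
  by rewrite ler_wpM2l ?mulr_ge0// ler_wpM2l// powR_ge0.
apply: (le_trans h1); apply: (le_trans h2); apply: (le_trans _ (lerD (lexx _) h7)).
have -> : p * t * (B `^ (p - 2) * (B ^+ 2 - B * A)) = t * (p * B `^ (p - 1) * (B - A)).
  by rewrite h4; ring.
clear h1 h2 h4 h5 h6 h7 m0; have := ler_wpM2l t0 h3; lra.
Qed.

End convexity.

Section box_cutoff.
Context {R : realType} {d : nat}.
Local Notation V := 'rV[R]_d.
Local Notation e_ i := (delta_mx 0 i : V).
Variables (x0 : V) (r : R).
Hypothesis r0 : 0 < r.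

Let cut1 (c t : R) := sstep (2 - (t - c) / r) * sstep (2 + (t - c) / r).

(** A product over coordinates because [|x - x0|] is the maximum norm: it is [1] up to distance [r]
    and [0] beyond [2 * r]. *)
Definition box_cut (x : V) : R := \prod_j cut1 (x0 0 j) (x 0 j).

Lemma box_cut_ge0 x : 0 <= box_cut x.
Proof. by apply: prodr_ge0 => j _; rewrite mulr_ge0// sstep_ge0. Qed.

Lemma box_cut_le1 x : box_cut x <= 1.
Proof.
rewrite -[leRHS](@prodr_const_nat _ 1 0 0) big_geq//.
rewrite -(expr1n R d) -[X in _ ^+ X]card_ord -prodr_const.
apply: ler_prod => j _; rewrite mulr_ge0 ?sstep_ge0//=.
by rewrite -[leRHS]mulr1 ler_pM ?sstep_ge0// sstep_le1.
Qed.

Lemma box_cut1 x : `|x - x0| <= r -> box_cut x = 1.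
Proof.
move=> xr; apply: big1 => j _.
have := le_trans (rV_coord_le_norm (x - x0) j) xr; rewrite !mxE ler_norml => /andP[h1 h2].
have h3 : (x 0 j - x0 0 j) / r <= 1 by rewrite ler_pdivrMr// mul1r.
have h4 : -1 <= (x 0 j - x0 0 j) / r by rewrite ler_pdivlMr// mulN1r.
by rewrite /cut1 !sstep_ge1 ?mulr1//; lra.
Qed.

Lemma box_cut0 x : 2 * r < `|x - x0| -> box_cut x = 0.
Proof.
move=> xr; have [j hj] : exists j, 2 * r < `|(x - x0) 0 j|.
  apply: contrapT => nj; move: xr; apply/negP; rewrite -leNgt.
  apply/rV_norm_leP; first by rewrite mulr_ge0// ltW.
  by move=> i; rewrite leNgt; apply/negP => hi; apply: nj; exists i.
rewrite /box_cut (bigD1 j)//= (_ : cut1 _ _ = 0) ?mul0r//.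
move: hj; rewrite !mxE /cut1; set t := x 0 j - x0 0 j.
have [t0|t0] := leP 0 t => hj.
  by rewrite sstep_le0 ?mul0r// subr_le0 ler_pdivlMr// ltW//; move: hj; rewrite ger0_norm.
rewrite [X in _ * X]sstep_le0 ?mulr0//.
move: hj; rewrite ltr0_norm// => hj.
by rewrite addrC -lerBrDr sub0r ler_pdivrMr// mulNr lerNr ltW.
Qed.

Lemma box_cut_smooth : smooth box_cut.
Proof.
move=> k; apply: is_Ck_prod; first exact: openT.
move=> j; apply: (is_Ck_coord (f := cut1 (x0 0 j))).
apply: (@Ck1M _ k (fun t => sstep (2 - (t - x0 0 j) / r)) (fun t => sstep (2 + (t - x0 0 j) / r))).
  rewrite (_ : (fun _ => _) = (fun x => sstep ((- r^-1) * x + (2 + x0 0 j / r)))).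
    by apply: Ck1_affine; exact: Ck1_sstep.
  by apply/funext => x; congr sstep; ring.
rewrite (_ : (fun _ => _) = (fun x => sstep (r^-1 * x + (2 - x0 0 j / r)))).
  by apply: Ck1_affine; exact: Ck1_sstep.
by apply/funext => x; congr sstep; ring.
Qed.

Lemma box_cut_Cc : Cc [set x | `|x - x0| < 3 * r] box_cut.
Proof.
split; first exact: smooth_continuous box_cut_smooth.
exists [set x | `|x - x0| <= 2 * r]; split.
- apply: bounded_closed_compact.
    exists (`|x0| + 2 * r); split; first exact: num_real.
    move=> M rM x /= xr; rewrite -(subrK x0 x) (le_trans (ler_normD _ _))//.
    by rewrite (le_trans _ (ltW rM))// addrC lerD2l.
  rewrite (_ : [set _ | _] = (fun x : V => `|x - x0|) @^-1` [set t | t <= 2 * r])//.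
  apply: closed_comp; last exact: closed_le.
  move=> x _; apply: (@continuous_comp _ _ _ (fun x : V => x - x0) (fun x => `|x|)).
    by apply: continuousB; [exact: cvg_id|exact: cst_continuous].
  exact: norm_continuous.
- by move=> x /= h; rewrite (le_lt_trans h)// ltr_pM2r//; lra.
- by move=> x /= /negP; rewrite -ltNge; exact: box_cut0.
Qed.

Lemma partial_box_cut i x : `|x - x0| < r -> partial i box_cut x = 0.
Proof.
move=> xr.
have h : \near x, cst 1 x = box_cut x.
  near=> y; rewrite box_cut1//.
  have h2 : `|x - y| < r - `|x - x0|.
    near: y; apply/nbhs_ballP; exists (r - `|x - x0|) => /=; first by rewrite subr_gt0.
    by move=> y; rewrite mx_norm_ball.
  by have := ler_distD x y x0; rewrite [`|y - x|]distrC; lra.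
have [_ h1] := near_eq_is_derive h (is_derive_cst (1:R) x (e_ i)).
exact: h1.
Unshelve. all: by end_near. Qed.

End box_cutoff.

Section dirichlet_energy.
Context {R : realType} {d : nat}.
Local Notation V := 'rV[R]_d.
Local Notation mu := (lebesgue_rV R d).
Variables (Om : set V) (p : R).
Hypotheses (oOm : open Om) (bOm : bounded_set Om) (p1 : 1 <= p).

Lemma measurable_eucl (G : V -> V) : (forall i, measurable_fun Om (fun x => G x 0 i)) ->
  measurable_fun Om (fun x => eucl_norm (G x)).
Proof.
move=> mG; apply: (measurableT_comp (f := @Num.sqrt R)).
  by apply: continuous_measurable_fun; exact: sqrt_continuous.
by apply: measurable_sum => i; exact: measurable_funX.
Qed.

Lemma eucl_le_sum (x : V) : eucl_norm x <= \sum_(i < d) `|x 0 i|.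
Proof.
have s0 : 0 <= \sum_(i < d) `|x 0 i| by apply: sumr_ge0.
rewrite -ler_sqr ?nnegrE ?eucl_norm_ge0// -dotv_xx expr2 mulr_suml.
apply: ler_sum => i _; rewrite (le_trans (ler_norm _))// normrM ler_wpM2l//.
by rewrite (bigD1 i)//= lerDl; apply: sumr_ge0.
Qed.

Lemma dirichlet_intg (G : V -> V) : (forall i, in_Lp Om p (fun x => G x 0 i)) ->
  L1 ((fun x => eucl_norm (G x) `^ p) \_ Om) /\
  dirichlet Om p G = (intg ((fun x => eucl_norm (G x) `^ p) \_ Om))%:E.
Proof.
move=> hG; have p0 : 0 <= p by rewrite (le_trans _ p1).
have hsum (s : seq 'I_d) : in_Lp Om p (fun x => \sum_(i <- s) `|G x 0 i|).
  elim: s => [|i s IH].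
    apply: (@in_Lp_bounded _ _ _ oOm bOm p _ 0) => //.
      by under eq_fun do rewrite big_nil; exact: measurable_cst.
    by move=> x _; rewrite big_nil normr0.
  under eq_fun do rewrite big_cons.
  exact: (in_Lp_D oOm p0 (in_Lp_norm (hG i)) IH).
have mG := measurable_eucl (fun i => (hG i).1).
have he : in_Lp Om p (fun x => eucl_norm (G x)).
  apply: (in_Lp_le oOm p0 mG _ (hsum (index_enum 'I_d))) => x _.
  rewrite ger0_norm ?eucl_norm_ge0// (le_trans (eucl_le_sum _))//.
  by rewrite ler_norm.
have [_ hi] := (in_LpP Om p _).1 he.
have eE : (fun x => `|eucl_norm (G x)| `^ p) = (fun x => eucl_norm (G x) `^ p).
  by apply/funext => x; rewrite ger0_norm// eucl_norm_ge0.
rewrite eE in hi; have L := integrable_Om oOm hi; split=> //.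
rewrite /dirichlet -intg_EFin// integral_mkcond.
by rewrite restrict_EFin.
Qed.

End dirichlet_energy.

(** * A competitor of smaller energy; the sign [s] treats upward and downward moves at once *)

Section competitor.
Context {R : realType} {d : nat}.
Local Notation V := 'rV[R]_d.
Local Notation mu := (lebesgue_rV R d).
Local Notation e_ i := (delta_mx 0 i : V).
Variables (Om : set V) (p : R) (u : V -> R) (G : V -> V) (s : R) (x0 : V) (r : R).
Variables (psi : V -> R) (Dpsi : 'I_d -> V -> R) (D2 : 'I_d -> 'I_d -> V -> R) (kap : R).
Hypotheses (oOm : open Om) (bOm : bounded_set Om) (p2 : 2 < p) (cu : continuous u).
Hypotheses (sG : sobolev_grad Om p u G) (s1 : s * s = 1) (r0 : 0 < r).
Let U : set V := [set x | `|x - x0| < 3 * r].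
Hypotheses (UOm : U `<=` Om) (cpsi : continuous psi).
Hypotheses (dpsi : forall i x, U x -> is_derive x (e_ i) psi (Dpsi i x)).
Hypotheses (cDpsi : forall i x, U x -> {for x, continuous (Dpsi i)}).
Hypotheses (dDpsi : forall i j x, U x -> is_derive x (e_ j) (Dpsi i) (D2 i j x)).
Hypotheses (cD2 : forall i j x, U x -> {for x, continuous (D2 i j)}).
Let q x := \sum_(i < d) Dpsi i x ^+ 2.
Hypotheses (q0 : forall x, U x -> 0 < q x).
Let h x := psi x - s * u x.
Hypotheses (hneg : forall x, U x -> r <= `|x - x0| -> h x <= 0) (hx0 : 0 < h x0).
Hypotheses (divpos : forall x, U x ->
  0 < (p - 2) * (\sum_(i < d) \sum_(j < d) Dpsi i x * Dpsi j x * D2 i j x)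
      + q x * \sum_(i < d) D2 i i x).
Hypotheses (kap0 : 0 < kap)
  (kap1 : forall x, `|x - x0| < r -> 2 * kap * posp (h x) <= 1).

Let p1 : 1 <= p. Proof. by rewrite (le_trans _ (ltW p2))// ler1n. Qed.
Let p0 : 0 <= p. Proof. exact: le_trans ler01 p1. Qed.
Let zt := box_cut x0 r.
Let th x := 2 * kap * posp (h x) * zt x.

(* The cutoff [zt] is [1] where [h > 0], so that the gradient of [u + competitor] is the
   convex combination [(1 - th) G + th s Dpsi]. *)
Definition competitor x : R := s * kap * (posp (h x) ^+ 2 * zt x).
Definition competitor_grad x : V := \row_i (s * th x * (Dpsi i x - s * G x 0 i)).

Let oU : open U.
Proof.
rewrite (_ : U = ball x0 (3 * r)); first by apply: ball_open; rewrite mulr_gt0.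
by apply/seteqP; split=> x; rewrite /U/= mx_norm_ball /ball_/= distrC.
Qed.

Let Czt : Cc U zt. Proof. exact: box_cut_Cc. Qed.
Let szt : smooth zt. Proof. exact: box_cut_smooth. Qed.

Let zt_out x : ~ U x -> zt x = 0.
Proof.
move=> nU; apply: box_cut0 => //; move/negP: nU; rewrite -leNgt; apply: lt_le_trans.
by rewrite ltr_pM2r//; lra.
Qed.

Let ch : continuous h. Proof. by apply: contB => //; apply: contM => //; exact: cont_cst. Qed.
Let cph : continuous (fun x => posp (h x)). Proof. exact: cont_posp. Qed.

Let zt0 x : 0 <= zt x. Proof. exact: box_cut_ge0. Qed.

Let th01 x : 0 <= th x <= 1.
Proof.
rewrite /th; apply/andP; split.
  by rewrite mulr_ge0// mulr_ge0 ?posp_ge0// mulr_ge0// ltW.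
have [Ux|/zt_out ->] := pselect (U x); last by rewrite mulr0.
have [xr|xr] := ltP `|x - x0| r; last first.
  by rewrite (posp_neg (hneg Ux xr)) mulr0 mul0r.
rewrite -[leRHS]mulr1; apply: ler_pM => //; [|exact: kap1|exact: box_cut_le1].
by rewrite mulr_ge0 ?posp_ge0// mulr_ge0// ltW.
Qed.

Let Gr i := (fun x => G x 0 i) \_ Om.
Let H i x := Dpsi i x - s * Gr i x.
Let Gam i x := 2 * posp (h x) * H i x.

Let hdq i : has_dq U i (fun x => posp (h x) ^+ 2) (Gam i).
Proof.
apply: has_dq_pos2; apply: has_dq_lin.
  by apply: has_dq_C1 => // x Ux; exact: cDpsi.
have [c1 c2 c3 c4] := sobolev_has_dq oOm bOm i p1 cu sG.
split=> //.
- by move=> B /(CcW UOm); exact: c2.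
- by move=> B /(CcW UOm); exact: c3.
- by move=> B /(CcW UOm); exact: c4.
Qed.

(** Within [r] of [x0] the cutoff is constant, and in the rest of [U] the positive part vanishes by
    [hneg]: the cutoff makes products globally defined without contributing to any derivative. *)
Let posp_dzt i x : posp (h x) ^+ 2 * partial i zt x = 0.
Proof.
have [Ux|nU] := pselect (U x).
  have [xr|xr] := ltP `|x - x0| r; first by rewrite partial_box_cut ?mulr0.
  by rewrite (posp_neg (hneg Ux xr)) expr0n mul0r.
have [czt [K [cK KU ztK]]] := Czt.
rewrite (partial_supp (fun x => smooth_is_derive i x szt) (rV_compact_closed cK) ztK) ?mulr0//.
by move=> /KU.
Qed.

Let Cdzt i : Cc U (partial i zt).
Proof.
have [czt [K [cK KU ztK]]] := Czt.
split; first exact: smooth_continuous (smooth_partial i szt).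
exists K; split=> //.
exact: (partial_supp (fun x => smooth_is_derive i x szt) (rV_compact_closed cK) ztK).
Qed.

(** Integration by parts with the test [X * zt]; the term carrying the derivative of [zt] is killed
    by [posp_dzt]. It is used with smooth [X] to identify the weak gradient and with the flux to
    compute the energy. *)
Let ibp i (X X' : V -> R) : (forall x, U x -> is_derive x (e_ i) X (X' x)) ->
  (forall x, U x -> {for x, continuous X}) -> (forall x, U x -> {for x, continuous X'}) ->
  intg (fun x => posp (h x) ^+ 2 * (X' x * zt x)) = - intg (fun x => Gam i x * (X x * zt x)).
Proof.
move=> dX cX cX'.
have CB : Cc U (fun x => X x * zt x) by exact: CcMl.
have C1 : Cc U (fun x => X' x * zt x) by exact: CcMl.
have C2 : Cc U (fun x => X x * partial i zt x) by exact: CcMl.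
pose B' x := X' x * zt x + X x * partial i zt x.
have hc : continuous B' by exact: contD (Cc_continuous C1) (Cc_continuous C2).
have hd x : is_derive x (e_ i) (fun x => X x * zt x) (B' x).
  have [Ux|nU] := pselect (U x).
    apply: (is_derive_eq (is_deriveM (dX x Ux) (smooth_is_derive i x szt))).
    by rewrite /GRing.scale/= /B' addrC; ring.
  have [cB [K [cK KU BK]]] := CB.
  have nK : nbhs x (~` K).
    apply: open_nbhs_nbhs; split; last by move=> /KU.
    by apply: closed_openC; exact: rV_compact_closed.
  have hn : \near x, cst 0 x = X x * zt x.
    by apply: filterS nK => y /= nKy; rewrite BK.
  apply: (is_derive_eq (near_eq_is_derive hn (is_derive_cst (0:R) x (e_ i)))).
  have [_ [K' [_ K'U dK']]] := Cdzt i.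
  by rewrite /B' zt_out// mulr0 add0r dK' ?mulr0// => /K'U.
have hI := has_dq_ibp (hdq i) CB hd hc.
rewrite -hI; apply: eq_intg => x; rewrite /B' mulrDr.
by rewrite [X in _ = _ + X](_ : _ = 0) ?addr0// mulrCA posp_dzt mulr0.
Qed.

Lemma competitor_continuous : continuous competitor.
Proof.
apply: contM; first exact: cont_cst.
by apply: contM; [exact: contM|exact: Cc_continuous Czt].
Qed.

Lemma competitor_out x : ~ U x -> competitor x = 0.
Proof. by move=> nU; rewrite /competitor zt_out// !mulr0. Qed.

Let cth : continuous th.
Proof.
by apply: contM; [apply: contM => //; exact: cont_cst|exact: Cc_continuous Czt].
Qed.

Let CthX (X : V -> R) : (forall x, U x -> {for x, continuous X}) -> Cc U (fun x => X x * th x).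
Proof.
move=> cX; have [czt [K [cK KU ztK]]] := Czt.
apply: CcMl => //; split=> //; exists K; split=> // x nK.
by rewrite /th ztK ?mulr0.
Qed.

Let mOm : measurable Om. Proof. exact: open_measurable_rV. Qed.

(** The gradient is in [L^p] because [Dpsi i * th] is continuous with compact support and
    [0 <= th <= 1]; the weak equation is [ibp] applied to the test function. *)
Lemma competitor_sobolev : sobolev_grad Om p competitor competitor_grad.
Proof.
have [Lu LG wu] := sG.
have CU : Cc U competitor.
  split; first exact: competitor_continuous.
  have [czt [K [cK KU ztK]]] := Czt.
  by exists K; split=> // x nK; rewrite /competitor ztK// !mulr0.
split.
- have [_ [K [cK KU fK]]] := CU.
  have [M _ hM] := Cc_bounded competitor_continuous cK fK.
  apply: (@in_Lp_bounded _ _ _ oOm bOm p _ M) => //.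
  by apply: measurable_funTS; apply: continuous_measurable_rV; exact: competitor_continuous.
- move=> i; have CD := CthX (@cDpsi i).
  have [cD [K [cK KU fK]]] := CD.
  have [M M0 hM] := Cc_bounded cD cK fK.
  have E : (fun x => competitor_grad x 0 i) =
      (fun x => s * (Dpsi i x * th x) - s * s * (th x * G x 0 i)).
    by apply/funext => x; rewrite mxE; ring.
  rewrite E s1; apply: (@in_Lp_bound _ _ _ oOm bOm p _ (fun x => G x 0 i) (`|s| * M) p0); last exact: LG.
  + by rewrite mulr_ge0.
  + apply: measurable_funB.
      apply: measurable_funM; first exact: measurable_cst.
      by apply: measurable_funTS; exact: continuous_measurable_rV.
    apply: measurable_funM; first exact: measurable_cst.
    apply: measurable_funM; last exact: (LG i).1.
    by apply: measurable_funTS; exact: continuous_measurable_rV.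
  + move=> x _; rewrite mul1r [leRHS]addrC (le_trans (ler_normB _ _))//.
    have /andP[t0 t1] := th01 x.
    apply: lerD; first by rewrite normrM ler_wpM2l.
    by rewrite normrM (ger0_norm t0) ler_piMl.
- apply/weak_gradient_intg => i phi sp Cp.
  have := @ibp i phi (partial i phi) (fun x _ => smooth_is_derive i x sp).
  move=> /(_ (fun x _ => @smooth_continuous _ _ _ sp x)).
  move=> /(_ (fun x _ => @smooth_continuous _ _ _ (smooth_partial i sp) x)).
  have Cpz : Cc U (fun x => phi x * zt x).
    by apply: CcMl => // x _; exact: (smooth_continuous sp).
  have Cpz' : Cc U (fun x => partial i phi x * zt x).
    by apply: CcMl => // x _; exact: (smooth_continuous (smooth_partial i sp)).
  have [_ hL _ _] := hdq i.
  have L1a := hL _ Cpz.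
  have L2a : L1 (fun x => posp (h x) ^+ 2 * (partial i phi x * zt x)).
    by apply: (continuous_Cc_L1 _ Cpz'); exact: contM.
  have -> : intg (fun x => competitor x * partial i phi x) =
      s * kap * intg (fun x => posp (h x) ^+ 2 * (partial i phi x * zt x)).
    by rewrite -intgZ//; apply: eq_intg => x; rewrite /competitor; ring.
  move=> ->; rewrite mulrN -intgZ//; congr (- _); apply: eq_intg => x.
  rewrite patchE; case: ifPn => [|/negP]; rewrite inE => Ox.
    rewrite mxE /Gam /H /Gr patchE ifT ?inE// /th; ring.
  by rewrite zt_out ?mulr0 ?mul0r// => /UOm.
Qed.

(** Component of the flux [|D psi|^(p-2) D psi], where [q] is [|D psi|^2]; [X'] is its derivative in
    the same direction, so the sum of the [X' i] is the p-Laplacian of [psi]. *)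
Let X i x := q x `^ ((p - 2) / 2) * Dpsi i x.
Let X' i x := (p - 2) / 2 * q x `^ ((p - 2) / 2 - 1) * (\sum_(j < d) 2 * Dpsi j x * D2 j i x) * Dpsi i x
  + q x `^ ((p - 2) / 2) * D2 i i x.

Let cq x : U x -> {for x, continuous q}.
Proof.
move=> Ux; rewrite /q; elim: (index_enum _) => [|i l IH].
  rewrite (_ : (fun _ => _) = cst 0); first exact: cst_continuous.
  by apply/funext => y; rewrite big_nil.
rewrite (_ : (fun _ => _) = (Dpsi i \* Dpsi i) \+ (fun x => \sum_(i <- l) Dpsi i x ^+ 2)).
  by apply: continuousD; first by apply: continuousM; exact: cDpsi.
by apply/funext => y; rewrite big_cons expr2.
Qed.

Let cpow (a : R) x : U x -> {for x, continuous (fun x => q x `^ a)}.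
Proof.
move=> Ux; apply: (@continuous_comp _ _ _ q (fun t => t `^ a)); first exact: cq.
apply/differentiable_continuous/derivable1_diffP.
by have [] := is_derive1_powR a (@q0 x Ux).
Qed.

Let csum2 i x : U x -> {for x, continuous (fun x => \sum_(j < d) 2 * Dpsi j x * D2 j i x)}.
Proof.
move=> Ux; elim: (index_enum _) => [|j l IH].
  rewrite (_ : (fun _ => _) = cst 0); first exact: cst_continuous.
  by apply/funext => y; rewrite big_nil.
rewrite (_ : (fun _ => _) = ((cst 2 \* Dpsi j) \* D2 j i) \+ (fun x => \sum_(j <- l) 2 * Dpsi j x * D2 j i x)).
  apply: continuousD; last exact: IH.
  apply: continuousM; last exact: cD2.
  by apply: continuousM; [exact: cst_continuous|exact: cDpsi].
by apply/funext => y; rewrite big_cons.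
Qed.

Let cX i x : U x -> {for x, continuous (X i)}.
Proof. by move=> Ux; apply: continuousM; [exact: cpow|exact: cDpsi]. Qed.

Let cX' i x : U x -> {for x, continuous (X' i)}.
Proof.
move=> Ux; apply: (@continuousD _ _ _ (fun x => (p - 2) / 2 * q x `^ ((p - 2) / 2 - 1) * (\sum_(j < d) 2 * Dpsi j x * D2 j i x) * Dpsi i x)
  (fun x => q x `^ ((p - 2) / 2) * D2 i i x)).
  apply: continuousM; last exact: cDpsi.
  apply: continuousM; last exact: csum2.
  by apply: continuousM; [exact: cst_continuous|exact: cpow].
by apply: continuousM; [exact: cpow|exact: cD2].
Qed.

Let dq_ i x : U x -> is_derive x (e_ i) q (\sum_(j < d) 2 * Dpsi j x * D2 j i x).
Proof.
move=> Ux; have -> : q = \sum_(j < d) (fun x => Dpsi j x ^+ 2).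
  by apply/funext => y; rewrite fct_sumE.
apply: is_derive_sum => j.
apply: (is_derive_eq (is_deriveX 2 (@dDpsi j i x Ux))).
by rewrite /GRing.scale/= expr1.
Qed.

Let dX i x : U x -> is_derive x (e_ i) (X i) (X' i x).
Proof.
move=> Ux.
have hq := is_derive_comp1 (is_derive1_powR ((p - 2) / 2) (@q0 x Ux)) (@dq_ i x Ux).
apply: (is_derive_eq (is_deriveM hq (@dDpsi i i x Ux))).
by rewrite /GRing.scale/= /X' addrC; ring.
Qed.

(** Factoring out [|D psi|^(p-4)], that is [q] to the power [(p - 2) / 2 - 1], leaves the expression
    in [divpos]. *)
Let div_pos x : U x -> 0 < \sum_i X' i x.
Proof.
move=> Ux.
have qn0 : q x != 0 by rewrite gt_eqF// q0.
have hq : q x `^ ((p - 2) / 2) = q x `^ ((p - 2) / 2 - 1) * q x.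
  by rewrite -{3}[q x]powRr1 ?ltW ?q0// -powRD ?subrK// qn0 implybT.
have -> : \sum_i X' i x = q x `^ ((p - 2) / 2 - 1) *
   ((p - 2) * (\sum_(i < d) \sum_(j < d) Dpsi i x * Dpsi j x * D2 i j x)
      + q x * \sum_(i < d) D2 i i x).
  rewrite mulrDr big_split/=; congr (_ + _); last first.
    by rewrite mulrA -hq mulr_sumr.
  rewrite exchange_big/= mulrCA !mulr_sumr; apply: eq_bigr => i _.
  rewrite !mulr_sumr mulr_suml; apply: eq_bigr => j _; by field.
by apply: mulr_gt0; [apply: powR_gt0; exact: q0|exact: divpos].
Qed.

Let Z0 x := \sum_i Gam i x * (X i x * zt x).

Let L1_Gam i : L1 (fun x => Gam i x * (X i x * zt x)).
Proof. by have [_ hL _ _] := hdq i; apply: hL; apply: CcMl => // x; exact: cX. Qed.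

Let L1_sum (l : seq 'I_d) (f : 'I_d -> V -> R) : (forall i, L1 (f i)) ->
  L1 (fun x => \sum_(i <- l) f i x) /\
  intg (fun x => \sum_(i <- l) f i x) = \sum_(i <- l) intg (f i).
Proof.
move=> hf; elim: l => [|i l [IH1 IH2]].
  rewrite big_nil (_ : (fun _ => _) = cst 0); last by apply/funext => x; rewrite big_nil.
  have L0 : L1 (cst 0 : V -> R) by exact: integrable0.
  by split=> //; rewrite -[RHS](mul0r (intg (cst 0 : V -> R))) -intgZ//; apply: eq_intg => x; rewrite mul0r.
rewrite big_cons -IH2 (_ : (fun _ => _) = fun x => f i x + \sum_(i <- l) f i x); last first.
  by apply/funext => x; rewrite big_cons.
by split; [exact: L1D|rewrite intgD].
Qed.

(** By [ibp] with [X] the flux, the integral of [Z0] is minus that of [(h^+)^2 * zt] times the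
    p-Laplacian of [psi]. This integrand is nonnegative, and positive near [x0]. *)
Let intg_Z0 : L1 Z0 /\ intg Z0 < 0.
Proof.
have [LZ EZ] := L1_sum (index_enum 'I_d) L1_Gam; split=> //.
have CX' i : Cc U (fun x => X' i x * zt x) by apply: CcMl => // x; exact: cX'.
have LX' i : L1 (fun x => posp (h x) ^+ 2 * (X' i x * zt x)).
  by apply: (continuous_Cc_L1 _ (CX' i)); exact: contM.
have [LS ES] := L1_sum (index_enum 'I_d) LX'.
rewrite -oppr_gt0 EZ -sumrN.
rewrite (eq_bigr (fun i => intg (fun x => posp (h x) ^+ 2 * (X' i x * zt x)))); last first.
  by move=> i _; rewrite (ibp (@dX i) (@cX i) (@cX' i)).
rewrite -ES.
have SE x : \sum_i posp (h x) ^+ 2 * (X' i x * zt x) = posp (h x) ^+ 2 * zt x * \sum_i X' i x.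
  by rewrite mulr_sumr; apply: eq_bigr => i _; ring.
pose W := [set x | 0 < h x] `&` ball x0 r.
apply: (@intg_gt0 _ _ _ W) => //.
- move=> x; rewrite SE; have [Ux|/zt_out ->] := pselect (U x); last by rewrite mulr0 mul0r.
  by rewrite mulr_ge0 ?(ltW (div_pos Ux))// mulr_ge0// sqr_ge0.
- apply: openI; last exact: ball_open.
  rewrite (_ : [set _ | _] = h @^-1` [set t | 0 < t])//.
  by apply: open_comp; [move=> x _; exact: ch|exact: open_gt].
- by exists x0; split=> //; exact: ballxx.
- move=> x [hx]; rewrite mx_norm_ball /ball_/= distrC => xr.
  have Ux : U x by rewrite /U/= (lt_le_trans xr)// ler_peMl ?ltW//; lra.
  rewrite SE mulr_gt0 ?div_pos// mulr_gt0//; last by rewrite /zt box_cut1// ltW.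
  by rewrite exprn_gt0// posp_pos// ltW.
Qed.

(** The new gradient is [(1 - th) G + th s D psi], so [eucl_convex] with [t = th] bounds the energy
    density pointwise by the old one plus [p * kap * Z0]. *)
Lemma competitor_energy : (dirichlet Om p (fun x => G x + competitor_grad x)%R < dirichlet Om p G)%E.
Proof.
have [_ LG _] := sG; have [_ LC _] := competitor_sobolev.
have LGC i : in_Lp Om p (fun x => (G x + competitor_grad x) 0 i).
  rewrite (_ : (fun _ => _) = (fun x => G x 0 i + competitor_grad x 0 i)).
    exact: (in_Lp_D oOm p0 (LG i) (LC i)).
  by apply/funext => x; rewrite mxE.
have [L1G ->] := dirichlet_intg oOm bOm p1 LG.
have [L1GC ->] := dirichlet_intg oOm bOm p1 LGC.
have [LZ Z_lt0] := intg_Z0.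
rewrite lte_fin.
apply: (@le_lt_trans _ _ (intg (fun x => ((fun x => eucl_norm (G x) `^ p) \_ Om) x + p * kap * Z0 x))).
  apply: le_intg => //; first by apply: L1D => //; exact: L1Z.
  move=> x; rewrite !patchE; case: ifPn => [|/negP]; rewrite inE => Ox; last first.
    by rewrite /Z0 big1 ?mulr0 ?addr0// => i _; rewrite zt_out ?mulr0// => /UOm.
  pose b : V := \row_i (s * Dpsi i x).
  have -> : G x + competitor_grad x = (1 - th x) *: G x + th x *: b.
    apply/rowP => i; rewrite !mxE.
    have -> : s * th x * (Dpsi i x - s * G x 0 i) = th x * (s * Dpsi i x) - s * s * (th x * G x 0 i) by ring.
    rewrite s1; ring.
  apply: (le_trans (eucl_convex _ _ (th01 x) p2)); rewrite lerD2l.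
  have bq : eucl_norm b `^ (p - 2) = q x `^ ((p - 2) / 2).
    have -> : eucl_norm b = q x `^ 2^-1.
      rewrite powR12_sqrt; last by apply: sumr_ge0 => i _; exact: sqr_ge0.
      congr Num.sqrt; apply: eq_bigr => i _; rewrite mxE exprMn.
      by rewrite [s ^+ 2]expr2 s1 mul1r.
    by rewrite -powRrM mulrC.
  rewrite bq le_eqVlt; apply/orP; left; apply/eqP.
  rewrite /dotv /Z0 !mulr_sumr; apply: eq_bigr => i _.
  rewrite !mxE /Gam /H /Gr patchE ifT ?inE// /X /th.
  have -> : s * Dpsi i x * (s * Dpsi i x - G x 0 i) = Dpsi i x * (s * s * Dpsi i x - s * G x 0 i) by ring.
  rewrite s1; ring.
rewrite intgD//; last exact: L1Z.
rewrite intgZ// gtrDl pmulr_rlt0// mulr_gt0//.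
exact: lt_le_trans ltr01 p1.
Qed.

End competitor.

(** * Viscosity inequalities for the limit *)

Section minimizer_ext.
Context {R : realType} {d : nat}.
Local Notation V := 'rV[R]_d.
Local Notation mu := (lebesgue_rV R d).
Variables (Om : set V) (p : R).
Hypothesis (oOm : open Om).

Lemma in_Lp_ext (f g : V -> R) : (forall x, Om x -> f x = g x) ->
  in_Lp Om p f -> in_Lp Om p g.
Proof.
move=> fg [mf foo]; split.
  by apply: eq_measurable_fun mf => x; rewrite inE; exact: fg.
rewrite (eq_integral (fun x => (`|f x| `^ p)%:E))// => x; rewrite inE => Ox.
by rewrite fg.
Qed.

Lemma sobolev_grad_ext (u v : V -> R) G : (forall x, Om x -> u x = v x) ->
  sobolev_grad Om p u G -> sobolev_grad Om p v G.
Proof.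
move=> uv [Lu LG wu]; split; [exact: in_Lp_ext Lu|exact: LG|].
move=> i phi tphi; rewrite -wu//; apply: eq_Rintegral => x; rewrite inE => Ox.
by rewrite uv.
Qed.

Lemma has_trace_ext (u v F : V -> R) : (forall x, Om x -> u x = v x) ->
  has_trace Om p u F -> has_trace Om p v F.
Proof.
move=> uv [G [w [H [sG hw hc hb]]]]; exists G, w, H; split.
- exact: sobolev_grad_ext sG.
- exact: hw.
- apply: cvg_trans hc; apply: near_eq_cvg; apply: nearW => k.
  have E : (\int[mu]_(x in Om) (`|(w k \- u) x| `^ p)%:E =
      \int[mu]_(x in Om) (`|(w k \- v) x| `^ p)%:E)%E.
    by apply: eq_integral => x; rewrite inE => Ox /=; rewrite uv.
  by rewrite /sobolev_norm E.
- exact: hb.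
Qed.

Lemma p_admissible_ext (u v F Psi Psi' : V -> R) : (forall x, Om x -> u x = v x) ->
  (forall x, Om x -> Psi x = Psi' x) -> p_admissible Om F Psi p u -> p_admissible Om F Psi' p v.
Proof.
move=> uv PP [[G sG] tu ae]; split.
- by exists G; exact: sobolev_grad_ext sG.
- exact: has_trace_ext tu.
- by apply: filterS ae => x h Ox; rewrite -PP// -uv//; exact: h.
Qed.

(** Permits replacing [u_p] and the obstacle by extensions continuous on the whole space. *)
Lemma p_minimizer_ext (u v F Psi Psi' : V -> R) : (forall x, Om x -> u x = v x) ->
  (forall x, Om x -> Psi x = Psi' x) -> p_minimizer Om F Psi p u -> p_minimizer Om F Psi' p v.
Proof.
move=> uv PP [au mu]; split; first exact: p_admissible_ext au.
move=> Gu w Gw sv aw sw; apply: (mu Gu w Gw); last exact: sw.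
- by apply: sobolev_grad_ext sv => x Ox; rewrite uv.
- by apply: p_admissible_ext aw => x Ox; [|rewrite PP].
Qed.

End minimizer_ext.

Lemma tietze_compact (R : realType) (d : nat) (K : set 'rV[R]_d) (f : 'rV[R]_d -> R) :
  compact K -> {within K, continuous f} ->
  exists2 g, continuous g & forall x, K x -> f x = g x.
Proof.
move=> cK cf.
have clK : closed K by exact: rV_compact_closed.
have [M M0 fM] : exists2 M : R, 0 < M & forall x, K x -> `|f x| <= M.
  have : bounded_set (f @` K) by apply: compact_bounded; exact: continuous_compact.
  move=> [M [_ hM]]; exists (`|M| + 1); first by rewrite ltr_wpDl.
  by move=> x Kx; apply: (hM (`|M| + 1)); [rewrite (le_lt_trans (ler_norm _))// ltrDl|exists x].
have nX : normal_space 'rV[R]_d by exact: (@pseudometric_normal R).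
have [g [fg cg _]] := continuous_bounded_extension nX clK M0 cf fM.
by exists g => // x Kx; apply: fg; rewrite inE.
Qed.

Section viscosity.
Context {R : realType} {d : nat}.
Local Notation V := 'rV[R]_d.
Local Notation e_ i := (delta_mx 0 i : V).
Variables (Om : set V) (F Psi : V -> R) (pj : nat -> R) (uj : nat -> V -> R) (uoo : V -> R).
Hypotheses (oOm : open Om) (bOm : bounded_set Om) (cPsi : continuous Psi).
Hypotheses (pjoo : pj j @[j --> \oo] --> +oo) (cuj : forall j, continuous (uj j)).
Hypotheses (cuoo : continuous uoo)
  (minj : \forall j \near \oo, p_minimizer Om F Psi (pj j) (uj j)).
Hypotheses (unif : forall e, 0 < e -> \forall j \near \oo, forall x, Om x -> `|uj j x - uoo x| < e).

(* [s = 1]: [phi] touches from below; [s = -1]: from above. *)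
Lemma viscosity_limit (s : R) (U : set V) (phi : V -> R) (x0 : V) :
  s * s = 1 -> open U -> U `<=` Om -> U x0 -> is_Ck 2 U phi -> phi x0 = uoo x0 ->
  (forall y, U y -> s * phi y <= s * uoo y) -> (s < 0 -> Psi x0 < uoo x0) ->
  s * infinity_laplacian phi x0 <= 0.
Proof.
move=> ss oU UOm Ux0 Cphi phix0 touch hPsi.
rewrite leNgt; apply/negP; set L0 := s * _ => L0_gt0.
pose p1 i := partial i phi.
pose p2 i j := partial j (partial i phi).
have dphi i x : U x -> is_derive x (e_ i) phi (p1 i x).
  by have [h _] := is_CkS_elim Cphi i; exact: h.
have C1 i : is_Ck 1 U (p1 i) by have [_ h] := is_CkS_elim Cphi i.
have cphi := is_Ck_continuous Cphi.
have dp1 i j x : U x -> is_derive x (e_ j) (p1 i) (p2 i j x).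
  by have [h _] := is_CkS_elim (C1 i) j; exact: h.
have cp1 i := is_Ck_continuous (C1 i).
have cp2 i j x : U x -> {for x, continuous (p2 i j)}.
  by have [_ h] := is_CkS_elim (C1 i) j; exact: is_Ck_continuous h x.
pose N := \sum_(i < d) p1 i x0 ^+ 2.
have N0 : 0 <= N by apply: sumr_ge0 => i _; exact: sqr_ge0.
(* Subtracting [lam * Q] makes the contact strict and lowers the infinity Laplacian at [x0] by
   [2 * lam * N <= L0 / 2], so it remains positive. *)
pose lam := L0 / (4 * (N + 1)).
have N1 : 0 < N + 1 by rewrite ltr_wpDl.
have lam0 : 0 < lam by rewrite divr_gt0// mulr_gt0.
pose Q (x : V) := \sum_(j < d) (x - x0) 0 j ^+ 2.
pose zc i (x : V) := (x - x0) 0 i.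
have czc i : continuous (zc i).
  have -> : zc i = fun x : V => x 0 i - x0 0 i by apply/funext => y; rewrite /zc !mxE.
  by apply: contB; [exact: coord_continuous|exact: cont_cst].
have cQ : continuous Q by apply: cont_sum => j; exact: (contM (@czc j) (@czc j)).
pose Dpsi i x := s * p1 i x - 2 * lam * zc i x.
pose D2 i j x := s * p2 i j x - 2 * lam * (i == j)%:R.
pose psi0 x := s * phi x - lam * Q x.
have dpsi0 i x : U x -> is_derive x (e_ i) psi0 (Dpsi i x).
  move=> Ux; have -> : psi0 = s *: phi \- lam *: Q by [].
  apply: (is_derive_eq (is_deriveB (is_deriveZ s (dphi i x Ux)) (is_deriveZ lam (is_derive_sqdist x0 i x)))).
  by rewrite /GRing.scale/= /Dpsi /zc; ring.
have dDpsi i j x : U x -> is_derive x (e_ j) (Dpsi i) (D2 i j x).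
  move=> Ux; have -> : Dpsi i = s *: p1 i \- (2 * lam) *: zc i by [].
  have hz : is_derive x (e_ j) (zc i) (i == j)%:R.
    have -> : zc i = (fun x : V => x 0 i) \+ cst (- x0 0 i).
      by apply/funext => y; rewrite /zc !mxE.
    apply: (is_derive_eq (is_deriveD (is_derive_coord i j x) (is_derive_cst (- x0 0 i) x (e_ j)))).
    by rewrite addr0.
  exact: (is_deriveB (is_deriveZ s (dp1 i j x Ux)) (is_deriveZ (2 * lam) hz)).
have cDpsi i x : U x -> {for x, continuous (Dpsi i)}.
  move=> Ux; have -> : Dpsi i = (cst s \* p1 i) \- (cst (2 * lam) \* zc i) by [].
  apply: continuousB; apply: continuousM; try exact: cst_continuous.
    exact: cp1.
  exact: czc.
have cD2 i j x : U x -> {for x, continuous (D2 i j)}.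
  move=> Ux; have -> : D2 i j = (cst s \* p2 i j) \- cst (2 * lam * (i == j)%:R) by [].
  apply: continuousB; last exact: cst_continuous.
  by apply: continuousM; [exact: cst_continuous|exact: cp2].
have csum (I : Type) (l : seq I) (f : I -> V -> R) x :
    (forall i, {for x, continuous (f i)}) -> {for x, continuous (fun x => \sum_(i <- l) f i x)}.
  move=> cf; elim: l => [|i l IH].
    rewrite (_ : (fun _ => _) = cst 0); first exact: cst_continuous.
    by apply/funext => y; rewrite big_nil.
  rewrite (_ : (fun _ => _) = f i \+ (fun x => \sum_(i <- l) f i x)).
    by apply: continuousD; [exact: cf|exact: IH].
  by apply/funext => y; rewrite big_cons.
pose Lam x := \sum_(i < d) \sum_(j < d) Dpsi i x * Dpsi j x * D2 i j x.
pose q x := \sum_(i < d) Dpsi i x ^+ 2.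
pose Del x := \sum_(i < d) D2 i i x.
have cLam : {for x0, continuous Lam}.
  apply: (csum) => i; apply: (csum) => j; apply: (@continuousM _ _ (Dpsi i \* Dpsi j) (D2 i j)).
    by apply: continuousM; exact: cDpsi.
  exact: cD2.
have cqD : {for x0, continuous (fun x => q x * Del x)}.
  apply: (@continuousM _ _ q Del); apply: (csum) => i; last exact: cD2.
  by apply: (@continuousM _ _ (Dpsi i) (Dpsi i)); exact: cDpsi.
have Lam_x0 : 0 < Lam x0.
  have zc0 i : zc i x0 = 0 by rewrite /zc subrr mxE.
  have E : Lam x0 = L0 - 2 * lam * N.
    rewrite /Lam /L0 /infinity_laplacian /N mulr_sumr [in RHS]mulr_sumr -sumrB.
    apply: eq_bigr => i _; rewrite mulr_sumr.
    have -> : 2 * lam * p1 i x0 ^+ 2 = \sum_(j < d) 2 * lam * p1 i x0 * p1 j x0 * (i == j)%:R.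
      rewrite (bigD1 i)//= eqxx mulr1 big1 ?addr0; first by ring.
      by move=> j; rewrite eq_sym => /negbTE ->; rewrite mulr0.
    rewrite -sumrB; apply: eq_bigr => j _.
    rewrite /Dpsi /D2 !zc0 /p1 /p2 !mulr0 !subr0.
    transitivity (s * s * (s * (partial i phi x0 * partial j phi x0 * partial j (partial i phi) x0))
       - s * s * (2 * lam * partial i phi x0 * partial j phi x0 * (i == j)%:R)); first by ring.
    by rewrite ss !mul1r.
  rewrite E subr_gt0 /lam.
  have -> : 2 * (L0 / (4 * (N + 1))) * N = L0 * (N / (N + 1)) / 2 by field; rewrite gt_eqF.
  have : N / (N + 1) <= 1 by rewrite ler_pdivrMr// mul1r lerDl.
  have : 0 <= N / (N + 1) by rewrite divr_ge0// ltW.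
  by nra.
(* Near [x0] one has [Lam > c] and [q * Del > - M], so [(p - 2) * Lam + q * Del] is positive as soon
   as [p > M / c + 2]. *)
pose c := Lam x0 / 2.
have c0 : 0 < c by rewrite divr_gt0.
pose M := `|q x0 * Del x0| + 1.
have M0 : 0 < M by rewrite ltr_wpDl.
have near_gt (f : V -> R) a : {for x0, continuous f} -> a < f x0 -> \forall x \near x0, a < f x.
  move=> cf af; have e0 : 0 < f x0 - a by rewrite subr_gt0.
  have /cvgrPdist_lt/(_ _ e0) := cf; apply: filterS => x.
  by rewrite ltr_norml => /andP[_]; rewrite ltrD2l ltrN2.
have near1 : \forall x \near x0, c < Lam x by apply: (near_gt) => //; rewrite /c; lra.
have near2 : \forall x \near x0, - M < q x * Del x.
  apply: (near_gt) => //; rewrite /M.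
  by have := ler_norm (- (q x0 * Del x0)); rewrite normrN; lra.
(* Room above the obstacle near [x0], of use only for downward moves; [1] is a dummy value for
   upward ones. *)
pose m := (if s < 0 then (uoo x0 - Psi x0) / 2 else 1).
have m0 : 0 < m by rewrite /m; case: ifPn => // /hPsi h; rewrite divr_gt0// subr_gt0.
have near3 : \forall x \near x0, s < 0 -> m < uoo x - Psi x.
  have [sn|sp] := ltP s 0; last by near=> x.
  have : \forall x \near x0, m < uoo x - Psi x.
    apply: (near_gt (fun x => uoo x - Psi x)); first exact: (contB cuoo cPsi).
    by move: m0; rewrite /m sn; lra.
  by apply: filterS.
have near4 : nbhs x0 U by apply: open_nbhs_nbhs.
have /nbhs_ballP[rho/= rho0 hrho] : nbhs x0 (U `&` [set x | [/\ c < Lam x, - M < q x * Del x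
    & s < 0 -> m < uoo x - Psi x]]).
  apply: filterI => //; near=> x; split.
  - by near: x.
  - by near: x.
  - by near: x.
have {}hrho x : `|x - x0| < rho -> U x /\ [/\ c < Lam x, - M < q x * Del x
    & s < 0 -> m < uoo x - Psi x].
  by move=> xr; apply: hrho; rewrite mx_norm_ball /ball_/= distrC.
pose r := rho / 4.
have r0 : 0 < r by rewrite divr_gt0.
have r3 : 3 * r < rho by rewrite /r; lra.
pose U' : set V := [set x | `|x - x0| < 3 * r].
have U'U x : U' x -> U x by move=> xr; apply: (hrho x _).1; exact: lt_trans r3.
(* As [lam * Q >= 2 * delta] at distance at least [r], raising [psi0] by [delta] puts it at least
   [delta] below [s * uoo] there and [delta] above it at [x0]. An error of [delta / 2] between
   [uj j] and [uoo] preserves both signs. *)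
pose delta := lam * r ^+ 2 / 2.
have r20 : 0 < lam * r ^+ 2 by rewrite mulr_gt0// exprn_gt0.
have delta0 : 0 < delta by rewrite divr_gt0.
pose K : set V := [set x | `|x - x0| <= 3 * r].
have cdist : continuous (fun x : V => `|x - x0|).
  move=> x; apply: (@continuous_comp _ _ _ (fun x : V => x - x0) (fun x => `|x|)).
    by apply: continuousB; [exact: cvg_id|exact: cst_continuous].
  exact: norm_continuous.
have cballK t : compact [set x : V | `|x - x0| <= t].
  apply: bounded_closed_compact.
    exists (`|x0| + t); split; first exact: num_real.
    move=> M' rM x /= xr; rewrite -(subrK x0 x) (le_trans (ler_normD _ _))//.
    by rewrite (le_trans _ (ltW rM))// addrC lerD2l.
  rewrite (_ : [set _ | _] = (fun x : V => `|x - x0|) @^-1` [set t' | t' <= t])//.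
  by apply: closed_comp; [move=> x _; exact: cdist|exact: closed_le].
have KU x : K x -> U x by move=> xr; apply: (hrho x _).1; exact: le_lt_trans r3.
(* [phi] is regular on [U] only, whereas [has_dq] asks for continuity on the whole space; on [U']
   the extension keeps the derivatives of [psi0]. *)
have [psi cpsi psiE] : exists2 psi, continuous psi & forall x, K x -> psi0 x + delta = psi x.
  apply: tietze_compact; first exact: cballK.
  apply: continuous_in_subspaceT => x; rewrite inE => /KU Ux.
  have -> : (fun x => psi0 x + delta) = ((cst s \* phi) \- (cst lam \* Q)) \+ cst delta by [].
  apply: continuousD; last exact: cst_continuous.
  apply: continuousB; apply: continuousM; try exact: cst_continuous.
    exact: cphi.
  exact: cQ.
have oU' : open U'.
  rewrite (_ : U' = ball x0 (3 * r)); first by apply: ball_open; rewrite mulr_gt0.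
  by apply/seteqP; split=> x; rewrite /U'/= mx_norm_ball /ball_/= distrC.
have U'K x : U' x -> K x by exact: ltW.
have dpsi i x : U' x -> is_derive x (e_ i) psi (Dpsi i x).
  move=> U'x; have h : \near x, psi0 x + delta = psi x.
    by apply: filterS (open_nbhs_nbhs (conj oU' U'x)) => y /U'K; exact: psiE.
  apply: (near_eq_is_derive h).
  apply: (is_derive_eq (is_deriveD (dpsi0 i x (U'U x U'x)) (is_derive_cst delta x (e_ i)))).
  by rewrite addr0.
(* Each term of [Lam] contains a factor [Dpsi i], so a zero of the gradient would be a zero of
   [Lam]. *)
have Lam_q x : U' x -> 0 < q x.
  move=> U'x; have [_ [h1 _ _]] := hrho x (lt_trans U'x r3).
  have q0 : 0 <= q x by apply: sumr_ge0 => i _; exact: sqr_ge0.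
  rewrite lt_def q0 andbT; apply/eqP => qx0.
  have D0 i : Dpsi i x = 0.
    move/eqP: qx0; rewrite psumr_eq0; last by move=> j _; exact: sqr_ge0.
    by move=> /allP/(_ i); rewrite mem_index_enum => /(_ isT)/=; rewrite sqrf_eq0 => /eqP.
  suff : Lam x = 0 by move=> h; move: h1; rewrite h ltNge (ltW c0).
  by apply: big1 => i _; apply: big1 => j _; rewrite D0 !mul0r.
near \oo => j.
have pjM : M / c + 2 < pj j.
  by near: j; apply: (cvgryPgt _).1 => //; exact: num_real.
have pj2 : 2 < pj j by rewrite (le_lt_trans _ pjM)// lerDr divr_ge0// ltW.
have ujm : forall x, Om x -> `|uj j x - uoo x| < Num.min (delta / 2) (m / 2).
  by near: j; apply: unif; rewrite lt_min !divr_gt0.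
have [adm minu] : p_minimizer Om F Psi (pj j) (uj j) by near: j.
have p1' : 1 <= pj j by rewrite (le_trans _ (ltW pj2))// ler1n.
have [_ tr aePsi] := adm.
have [G sG addtr] := has_trace_add oOm bOm p1' tr.
have ujPsi := ae_le_continuous oOm (@cPsi) (@cuj j) aePsi.
pose h x := psi x - s * uj j x.
have ch : continuous h by apply: contB => //; apply: contM; [exact: cont_cst|exact: (@cuj j)].
have s_abs : `|s| = 1.
  by apply/eqP; rewrite -sqrp_eq1// real_normK ?num_real// expr2 ss.
have ujd x : Om x -> `|s * uj j x - s * uoo x| < delta / 2 /\ `|uj j x - uoo x| < m / 2.
  move=> Ox; have := ujm x Ox; rewrite lt_min -mulrBr normrM s_abs mul1r => /andP[a b].
  by split.
have Qge x : r <= `|x - x0| -> r ^+ 2 <= Q x.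
  move=> xr; have : `|x - x0| <= eucl_norm (x - x0) by exact: norm_le_eucl.
  have -> : Q x = eucl_norm (x - x0) ^+ 2.
    by rewrite -dotv_xx; apply: eq_bigr => i _; rewrite expr2.
  move=> h1; rewrite ler_sqr ?nnegrE ?eucl_norm_ge0 ?(ltW r0)//.
  exact: le_trans xr h1.
have hneg x : U' x -> r <= `|x - x0| -> h x <= 0.
  move=> U'x xr; rewrite /h -psiE; last exact: U'K.
  have Ux := U'U x U'x; have := touch x Ux; have [h1 _] := ujd x (UOm _ Ux).
  have h2 := ler_wpM2l (ltW lam0) (Qge x xr).
  move: h1; rewrite ltr_norml => /andP[h3 h4] h5.
  rewrite /psi0 /delta; rewrite /delta in h3 h4.
  move: h2 h3 h4 h5; move: (r ^+ 2) (lam) (Q x) (s * phi x) (s * uj j x) (s * uoo x) => a1 a2 a3 a4 a5 a6; lra.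
have hx0 : 0 < h x0.
  rewrite /h -psiE; last by rewrite /K/= subrr normr0 mulr_ge0// ltW.
  have [h1 _] := ujd x0 (UOm _ Ux0).
  have Q0 : Q x0 = 0 by apply: big1 => i _; rewrite subrr mxE expr0n.
  move: h1; rewrite ltr_norml => /andP[h3 h4].
  rewrite /psi0 Q0 mulr0 subr0 phix0; move: h3 h4 delta0; move: (s * uj j x0) (s * uoo x0) (delta) => a1 a2 a3; lra.
have divpos x : U' x -> 0 < (pj j - 2) * Lam x + q x * Del x.
  move=> U'x; have [_ [h1 h2 _]] := hrho x (lt_trans U'x r3).
  have h3 : M < (pj j - 2) * c by rewrite -ltr_pdivrMr// ltrBrDr.
  have h4 : (pj j - 2) * c <= (pj j - 2) * Lam x.
    by apply: ler_wpM2l; [rewrite subr_ge0|]; exact: ltW.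
  by rewrite -(subrr M) ltrD// (lt_le_trans h3 h4).
have [B B0 hB] : exists2 B, 0 <= B & forall x, `|x - x0| <= r -> posp (h x) <= B.
  have cph : continuous (fun x => posp (h x)) by exact: cont_posp.
  have [|y _ hy] := @compact_EVT_max _ R _ _ _ (cballK r) (continuous_subspaceT cph).
    by exists x0 => /=; rewrite subrr normr0 ltW.
  exists (posp (h y)); first exact: posp_ge0.
  by move=> x xr; apply: hy; rewrite inE.
(* The first bound yields [th <= 1]. The second keeps the displacement within [m / 2]; since [uj j]
   is above [Psi] by more than [m / 2] where it moves, a downward move respects the obstacle. *)
pose kap := Num.min (1 / (2 * (B + 1))) (m / (2 * (B + 1) ^+ 2)).
have B1 : 0 < B + 1 by rewrite ltr_wpDl.
have kap0 : 0 < kap by rewrite lt_min !divr_gt0 ?mulr_gt0// exprn_gt0.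
have kapa : kap <= 1 / (2 * (B + 1)) by rewrite ge_min lexx.
have kapb : kap <= m / (2 * (B + 1) ^+ 2) by rewrite ge_min lexx orbT.
have kap1 x : `|x - x0| < r -> 2 * kap * posp (h x) <= 1.
  move=> /ltW/hB hxB.
  apply: (@le_trans _ _ (2 * kap * (B + 1))).
    by rewrite ler_wpM2l ?mulr_ge0 ?ltW// (le_lt_trans hxB)// ltrDl.
  by move: kapa; rewrite ler_pdivlMr ?mulr_gt0// mulrA (mulrC kap).
have U'Om : U' `<=` Om by move=> x /U'U/UOm.
have cDpsi' i x : U' x -> {for x, continuous (Dpsi i)} by move=> /U'U; exact: cDpsi.
have cD2' i k x : U' x -> {for x, continuous (D2 i k)} by move=> /U'U; exact: cD2.
have dDpsi' i k x : U' x -> is_derive x (e_ k) (Dpsi i) (D2 i k x) by move=> /U'U; exact: dDpsi.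
have sg := competitor_sobolev oOm bOm pj2 (@cuj j) sG ss r0 U'Om cpsi dpsi cDpsi' hneg kap0 kap1.
have en := competitor_energy oOm bOm pj2 (@cuj j) sG ss r0 U'Om cpsi dpsi cDpsi' dDpsi' cD2' Lam_q hneg hx0 divpos kap0 kap1.
set g := competitor _ _ _ _ _ _ in sg; set Gm := competitor_grad _ _ _ _ _ _ _ in sg en.
have cg : continuous g by exact: competitor_continuous.
have gO x : ~ Om x -> g x = 0.
  by move=> nO; apply: competitor_out => // /U'Om.
have sv := sobolev_grad_add oOm bOm p1' sG sg.
have : p_admissible Om F Psi (pj j) (fun x => uj j x + g x).
  split.
  - by eexists; exact: sv.
  - exact: addtr cg gO sg.
  - apply: aeW => x Ox.
    have z0 := @box_cut_ge0 R d x0 r x; have z1 := @box_cut_le1 R d x0 r x.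
    have [sp|sn] := leP 0 s.
      rewrite (le_trans (ujPsi x Ox))// lerDl /g /competitor; by rewrite mulr_ge0 ?(mulr_ge0 sp (ltW kap0))// mulr_ge0 ?sqr_ge0.
    have sE : s = -1.
      have : s ^+ 2 == 1 by rewrite expr2 ss.
      rewrite sqrf_eq1 => /orP[/eqP s1|/eqP//].
      by have := sn; rewrite s1 ltNge ler01.
    have [xr|xr] := ltP `|x - x0| r; last first.
      suff -> : g x = 0 by rewrite addr0; exact: ujPsi.
      have [U'x|nU'] := pselect (U' x); last by exact: competitor_out.
      by rewrite /g /competitor (posp_neg (hneg x U'x xr)) expr0n mul0r mulr0.
    have xr3 : `|x - x0| < rho by rewrite (lt_trans xr)// /r; lra.
    have [_ [_ _ /(_ sn) hm]] := hrho x xr3.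
    have [_ h2] := ujd x Ox.
    have hxB := hB x (ltW xr).
    have gE : g x = - (kap * (posp (h x) ^+ 2 * box_cut x0 r x)).
      by rewrite /g /competitor -/(h x) [X in X * kap]sE mulN1r mulNr.
    have h3 : kap * (posp (h x) ^+ 2 * box_cut x0 r x) <= m / 2.
      apply: (@le_trans _ _ (kap * (B + 1) ^+ 2)).
        apply: ler_wpM2l; first exact: ltW.
        rewrite -[leRHS]mulr1; apply: ler_pM => //; first exact: sqr_ge0.
        rewrite ler_sqr ?nnegrE ?posp_ge0 ?ltW// (le_lt_trans hxB)// ltrDl//.
      by move: kapb; rewrite !ler_pdivlMr ?mulr_gt0 ?exprn_gt0// mulrAC mulrA.
    move: h2; rewrite ltr_norml => /andP[h4 h5]; rewrite gE; lra.
move=> /(minu G _ _ sG)/(_ sv); rewrite leNgt => /negP; apply.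
exact: en.
Unshelve. all: by end_near. Qed.

End viscosity.

(** * Hausdorff measure *)

Section hausdorff_caratheodory.
Context {R : realType} (n : nat).
Local Notation V := 'rV[R]_n.
Local Open Scope ereal_scope.

Lemma le_diameter (A B : set V) : A `<=` B -> diameter A <= diameter B.
Proof.
by move=> AB; apply: ereal_sup_le; apply: image_subset => -[x y] [/= /AB Bx /AB By].
Qed.

Lemma diameter_ge (A : set V) x y : A x -> A y -> (eucl_norm (x - y))%:E <= diameter A.
Proof. by move=> Ax Ay; apply: ereal_sup_ubound; exists (x, y). Qed.

Lemma diameter_ge0 (A : set V) : A !=set0 -> 0 <= diameter A.
Proof. by move=> [x Ax]; apply: le_trans (diameter_ge Ax Ax); rewrite lee_fin eucl_norm_ge0. Qed.

Lemma le_diam_pow s (A B : set V) : A `<=` B -> diam_pow s A <= diam_pow s B.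
Proof.
move=> AB; have [->|A0] := eqVneq A set0; first by rewrite diam_pow0 diam_pow_ge0.
have {}A0 : A !=set0 by apply/set0P.
have B0 : B !=set0 by case: A0 => x /AB; exists x.
rewrite /diam_pow ifF ?ifF; try by apply/negbTE/set0P.
elim: s => [|s IH]; first by rewrite !expe0.
by rewrite !expeS lee_pmul// ?expe_ge0 ?diameter_ge0// le_diameter.
Qed.

Lemma hausdorff_content_anti s (A : set V) r1 r2 : (r1 <= r2)%R ->
  hausdorff_content s r2 A <= hausdorff_content s r1 A.
Proof.
move=> r12; apply: ereal_inf_le_tmp => _ [C [AC Cd] <-]; exists C => //.
by split=> // k; rewrite (le_trans (Cd k))// lee_fin.
Qed.

(** A covering set of diameter at most [e < r] meets at most one of [A] and [B], so intersecting a
    cover with each of them splits its sum. *)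
Lemma hausdorff_content_separated s (A B : set V) r e : (0 < e < r)%R ->
  (forall a b, A a -> B b -> (r <= eucl_norm (a - b))%R) ->
  hausdorff_content s e A + hausdorff_content s e B <= hausdorff_content s e (A `|` B).
Proof.
move=> /andP[e0 er] sep; apply: le_ereal_inf_tmp => _ [C [ABC Cd] <-].
apply: (@le_trans _ _ (\sum_(k <oo) diam_pow s (C k `&` A) + \sum_(k <oo) diam_pow s (C k `&` B))).
  apply: leeD; apply: ereal_inf_lbound; eexists; try reflexivity.
    split=> [x Ax|k]; first by have [k _ Ck] := ABC x (or_introl Ax); exists k.
    by apply: le_trans (Cd k); apply: le_diameter.
  split=> [x Bx|k]; first by have [k _ Ck] := ABC x (or_intror Bx); exists k.
  by apply: le_trans (Cd k); apply: le_diameter.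
rewrite -nneseriesD; try by move=> *; exact: diam_pow_ge0.
apply: lee_nneseries => [k _ _|k _]; first by rewrite adde_ge0 ?diam_pow_ge0.
have [->|CA] := eqVneq (C k `&` A) set0; first by rewrite diam_pow0 add0e le_diam_pow.
have [->|CB] := eqVneq (C k `&` B) set0; first by rewrite diam_pow0 adde0 le_diam_pow.
move/set0P: CA => [a [Ca Aa]]; move/set0P: CB => [b [Cb Bb]].
have := le_trans (diameter_ge Ca Cb) (Cd k); rewrite lee_fin leNgt.
by rewrite (lt_le_trans er (sep a b Aa Bb)).
Qed.

(** Two scales are first reduced to a common one below [r]; then the suprema over them are taken one
    after the other, which is legitimate once all values are known to be finite. *)
Lemma hausdorff_separated s (A B : set V) r : (0 < r)%R ->
  (forall a b, A a -> B b -> (r <= eucl_norm (a - b))%R) ->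
  hausdorff s A + hausdorff s B <= hausdorff s (A `|` B).
Proof.
move=> r0 sep; set X := hausdorff s (A `|` B).
have key e1 e2 : (0 < e1)%R -> (0 < e2)%R ->
    hausdorff_content s e1 A + hausdorff_content s e2 B <= X.
  move=> e10 e20; pose e : R := (Num.min (Num.min e1 e2) (r / 2))%R.
  have e0 : (0 < e)%R by rewrite !lt_min e10 e20 divr_gt0.
  have er : (e < r)%R by rewrite gt_min ltr_pdivrMr// ltr_pMr// ltr1n orbT.
  apply: (@le_trans _ _ (hausdorff_content s e A + hausdorff_content s e B)).
    by apply: leeD; apply: hausdorff_content_anti; rewrite /e !ge_min lexx ?orbT.
  apply: le_trans (hausdorff_content_le _ _ e0).
  by apply: (@hausdorff_content_separated s A B r e) => //; rewrite e0 er.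
have [->|Xoo] := eqVneq X +oo; first exact: leey.
have X0 : 0 <= X by exact: hausdorff_ge0.
have Xfin : X \is a fin_num by rewrite ge0_fin_numE// ltey.
have cfin Y e : Y `<=` A `|` B -> (0 < e)%R -> hausdorff_content s e Y \is a fin_num.
  move=> YAB e0; rewrite ge0_fin_numE ?hausdorff_content_ge0//.
  apply: le_lt_trans (_ : X < +oo); last by rewrite ltey.
  exact: le_trans (hausdorff_content_le _ _ e0) (le_hausdorff _ YAB).
have h2 e2 : (0 < e2)%R -> hausdorff s A + hausdorff_content s e2 B <= X.
  move=> e20; rewrite -leeBrDr; last by apply: cfin => // x; right.
  apply: ge_ereal_sup => _ [e1 e10 <-].
  by rewrite leeBrDr; [exact: key|apply: cfin => // x; right].
have Afin : hausdorff s A \is a fin_num.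
  rewrite ge0_fin_numE ?hausdorff_ge0//; apply: le_lt_trans (_ : X < +oo); last by rewrite ltey.
  by apply: le_hausdorff => x; left.
rewrite addeC -leeBrDr//; apply: ge_ereal_sup => _ [e2 e20 <-].
by rewrite leeBrDr// addeC; exact: h2.
Qed.

(* [X `\` F] is the increasing union of the sets [A m] of its points at distance at
   least [1 / m.+1] from [F]; as [A m] and [A m.+2 `\` A m.+1] are separated, the
   layers have summable content. *)
Lemma closed_hausdorff_measurable s (F : set V) : closed F ->
  (hausdorff_outer R n s).-caratheodory F.
Proof.
move=> cF; apply: le_caratheodory_measurable => X; set H := hausdorff_outer R n s.
have [->|Xoo] := eqVneq (H X) +oo; first exact: leey.
have H0 A : 0 <= H A by exact: hausdorff_ge0.
have Hle A B : A `<=` B -> H A <= H B by exact: le_hausdorff.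
have Hsep A B r : (0 < r)%R -> (forall a b, A a -> B b -> (r <= eucl_norm (a - b))%R) ->
    H A + H B <= H (A `|` B) := @hausdorff_separated s A B r.
have Xfin : H X \is a fin_num by rewrite ge0_fin_numE// ltey.
pose A m := X `&` [set x | forall f, F f -> (m.+1%:R^-1 <= eucl_norm (x - f))%R].
have AX m : A m `<=` X by move=> x [].
have AS m : A m `<=` A m.+1.
  move=> x [Xx h]; split=> // f /h; apply: le_trans.
  by rewrite lef_pV2 ?posrE// ler_nat.
have sepXF m : H (X `&` F) + H (A m) <= H X.
  apply: (@le_trans _ _ (H ((X `&` F) `|` A m))); last by apply: Hle => x [[]|[]].
  apply: (Hsep _ _ (m.+1%:R^-1)%R); first by rewrite invr_gt0.
  by move=> a b [_ Fa] [_ /(_ a Fa)]; rewrite eucl_distC.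
pose D m := A m.+1 `\` A m.
have HD m : H (A m) + H (D m.+1) <= H (A m.+2).
  apply: (@le_trans _ _ (H (A m `|` D m.+1))); last first.
    by apply: Hle => x [/AS/AS//|[]].
  pose a : R := (m.+1%:R^-1)%R; pose b : R := (m.+2%:R^-1)%R.
  have ab : (b < a)%R by rewrite ltf_pV2 ?posrE// ltr_nat.
  apply: (Hsep _ _ (a - b)%R); first by rewrite subr_gt0.
  move=> x y [Xx hx] [[Xy _] nAy].
  have [f Ff hf] : exists2 f, F f & (eucl_norm (y - f) < b)%R.
    apply: contrapT => nf; apply: nAy; split=> // f Ff; rewrite leNgt; apply/negP => hf.
    by apply: nf; exists f.
  rewrite lerBlDr (le_trans (hx f Ff))// (le_trans (eucl_dist_tri y x f))//.
  by rewrite lerD2l ltW.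
(* Only layers two indices apart are separated; carrying two consecutive sets [A] treats even and
   odd layers in one induction. *)
have sumD N : \sum_(0 <= k < N) H (D k.+1) <= H (A N) + H (A N.+1).
  elim: N => [|N IH]; first by rewrite big_geq// adde_ge0.
  rewrite big_nat_recr//=; apply: le_trans (leeD IH (lexx _)) _.
  by rewrite addeAC addeC leeD// HD.
have XX : H X + H X < +oo by rewrite ltey_eq fin_numD Xfin.
have sumoo : \sum_(0 <= k <oo) H (D k.+1) < +oo.
  apply: le_lt_trans XX; apply: lime_le; first by apply: is_cvg_nneseries.
  by apply: nearW => N; apply: le_trans (sumD N) _; rewrite leeD// Hle.
have tail := nneseries_tail_cvg sumoo (fun k _ => H0 _).
(* Since [F] is closed, a point of [X] off [F] lies in some [A m]: either already in [A N.+1] or in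
   a layer of index at least [N]. The tail of the convergent series then vanishes in the limit. *)
have key N : H (X `&` F) + H (X `&` ~` F) <= H X + \sum_(N <= k <oo) H (D k.+1).
  apply: (@le_trans _ _ (H (X `&` F) + (H (A N.+1) + \sum_(N <= k <oo) H (D k.+1)))).
    rewrite leeD2l//.
    apply: (@le_trans _ _ (H (A N.+1 `|` \bigcup_(k in ~` `I_N) D k.+1))); last first.
      apply: le_trans (outer_measureU2 _ _ _) _; rewrite leeD2l//.
      exact: outer_measure_sigma_subadditive_tail.
    apply: Hle => x [Xx nFx].
    have [m Am] : exists m, A m x.
      have /nbhs_ballP[e/= e0 eF] : nbhs x (~` F).
        by apply: open_nbhs_nbhs; split=> //; exact: closed_openC.
      exists (Num.truncn (e^-1)%R); split=> // f Ff.
      have : (e <= `|x - f|)%R.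
        rewrite leNgt; apply/negP => xf; apply: (eF f) => //.
        by rewrite -ball_normE /= .
      move=> /le_trans/(_ (norm_le_eucl _)); apply: le_trans.
      rewrite -[leRHS]invrK lef_pV2 ?posrE ?invr_gt0//.
      by rewrite ltW// truncnS_gt ?invr_ge0 ?(ltW e0).
    have [AN|nAN] := pselect (A N.+1 x); [by left|right].
    elim: m Am => [A0|m IH Am1].
      exfalso; apply: nAN; elim: N.+1 => // k; exact: AS.
    have [/IH//|nAm] := pselect (A m x).
    have Nm : (N.+1 <= m)%N.
      rewrite leqNgt; apply/negP => mN; apply: nAN.
      have {}mN : (m.+1 <= N.+1)%N by [].
      by rewrite -(subnK mN); elim: (_ - _)%N => // k; exact: AS.
    have m0 : (0 < m)%N by exact: leq_ltn_trans Nm.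
    exists m.-1 => /=; last by rewrite prednK.
    by apply/negP; rewrite -leqNgt -ltnS prednK.
  by rewrite addeA leeD2r// sepXF.
have cv : (H X + \sum_(N <= k <oo) H (D k.+1))%E @[N --> \oo] --> H X.
  rewrite -[X in _ --> X]adde0; apply: cvgeD => //; last exact: cvg_cst.
  by rewrite fin_num_adde_defr.
by apply: (cvge_to_ge cv); apply: nearW => N; exact: key.
Qed.

End hausdorff_caratheodory.

(** * A Chebyshev bound, and thin layers over sets of small surface measure *)

Section layers.
Context {R : realType}.
Local Open Scope ereal_scope.

(** Chebyshev's inequality without measurability of [f]: the integral of a nonnegative function is a
    supremum over the simple functions below it, and those below [c] times the indicator of [S] are
    also below [f] on [D]. *)
Lemma ge0_subset_integral_le d (T : measurableType d) (mu : {measure set T -> \bar R})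
    (D S : set T) (f : T -> \bar R) (c : R) : measurable S -> S `<=` D -> (0 <= c)%R ->
  (forall x, D x -> 0 <= f x) -> (forall x, S x -> c%:E <= f x) ->
  c%:E * mu S <= \int[mu]_(x in D) f x.
Proof.
move=> mS SD c0 f0 cf.
have -> : c%:E * mu S = \int[mu]_(x in setT) (c%:E * (\1_S x)%:E).
  have mI : measurable_fun setT (fun x : T => (\1_S x : R)%:E).
    by apply/measurable_EFinP; exact: measurable_indic.
  rewrite (ge0_integralZl _ measurableT mI); [|by move=> x _; rewrite lee_fin|by rewrite lee_fin].
  by rewrite integral_indic// setIT.
rewrite !ge0_integralE//; last by move=> x _; rewrite mule_ge0// lee_fin.
rewrite patch_setT; apply: ereal_sup_le => _ [h /= hh <-]; exists h => //= x.
apply: le_trans (hh x) _; rewrite indicE /patch.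
have [xS|xS] := boolP (x \in S).
  rewrite mule1 ifT; first by apply: cf; rewrite inE in xS.
  by rewrite inE; apply: SD; rewrite inE in xS.
rewrite mule0; case: ifPn => // xD; apply: f0; by rewrite inE in xD.
Qed.

(* The layer over [S] is covered by thin boxes, one for each piece of a cover of
   [S] by sets of diameter at most [e]. *)
Lemma layer_small n (i : 'I_n) (S : set 'rV[R]_n) (e h : R) : (0 < e)%R ->
  hausdorff n.-1 S < h%:E ->
  exists W, [/\ measurable W,
    (forall y t, S y -> (`|t| <= e)%R -> W (y + t *: delta_mx 0 i)%R) &
    lebesgue_rV R n W <= (4 * 2 ^+ n.-1 * e * h)%:E].
Proof.
move=> e0 Sh.
have [_ [C [SC Cd] <-] Ch] := ereal_inf_lt (le_lt_trans (hausdorff_content_le n.-1 S e0) Sh).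
have pc k : {c | C k !=set0 -> C k c}.
  by apply: cid; have [[c Cc]|C0] := pselect (C k !=set0); [exists c|exists 0%R].
pose c k := projT1 (pc k); have Cc k : C k !=set0 -> C k (c k) by exact: (projT2 (pc k)).
pose D k : R := fine (diameter (C k)).
have DE k : C k !=set0 -> diameter (C k) = (D k)%:E /\ (0 <= D k <= e)%R.
  move=> C0; have d0 := diameter_ge0 C0.
  have E : diameter (C k) = (D k)%:E.
    by rewrite /D fineK// ge0_fin_numE// (le_lt_trans (Cd k))// ltry.
  by split=> //; rewrite -!lee_fin -E d0 Cd.
(* Half-sides. In direction [i] the diameter [D k <= e] and the height [|t| <= e] add up to at most
   [2 * e]; the volume is thus [4 * e] times [(2 * D k) ^+ n.-1]. *)
pose r k : 'rV[R]_n := (\row_j (if j == i then 2 * e else D k))%R.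
pose B k := if pselect (C k !=set0) then rV_box (c k - r k)%R (c k + r k)%R else set0.
have mB k : measurable (B k).
  by rewrite /B; destruct (pselect (C k !=set0)) as [a1|a1]; [exact: rV_box_measurable|exact: measurable0].
exists (\bigcup_k B k); split; first exact: bigcupT_measurable.
- move=> y t /SC[k _ Cy] te; exists k => //.
  have C0 : C k !=set0 by exists y.
  have [E /andP[D0 De]] := DE k C0.
  rewrite /B; case: pselect => // _ j; rewrite !mxE.
  have : (`|(y - c k) 0 j| <= D k)%R.
    rewrite -lee_fin -E; apply: le_trans (diameter_ge Cy (Cc k C0)).
    by rewrite lee_fin coord_le_eucl.
  rewrite !mxE eqxx /= eq_sym; move: te; rewrite !ler_norml => /andP[t1 t2] /andP[y1 y2].
  by case: eqP => _ /=; rewrite ?mulr1 ?mulr0; apply/andP; split; lra.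
have BE k : lebesgue_rV R n (B k) <= (4 * 2 ^+ n.-1 * e)%:E * diam_pow n.-1 (C k).
  rewrite /B; case: pselect => [C0|C0]; last by rewrite measure0 mule_ge0 ?diam_pow_ge0// lee_fin !mulr_ge0 ?exprn_ge0// ltW.
  have [E /andP[D0 De]] := DE k C0.
  rewrite lebesgue_rV_box; last first.
    move=> j; rewrite !mxE; have r0 : (0 <= if j == i then 2 * e else D k)%R.
      by case: eqP => // _; rewrite mulr_ge0// ltW.
    by rewrite lerD2l (le_trans _ r0)// oppr_le0.
  rewrite /diam_pow ifF; last by apply/negbTE/set0P.
  rewrite E -EFin_expe -EFinM lee_fin (bigD1 i)//= !mxE eqxx.
  rewrite (eq_bigr (fun=> 2 * D k)%R); last first.
    by move=> j /negbTE ji; rewrite !mxE ji; ring.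
  rewrite prodr_const cardC1 card_ord exprMn.
  rewrite [X in (X * _)%R](_ : _ = (4 * e)%R); last by ring.
  by rewrite le_eqVlt; apply/orP; left; apply/eqP; ring.
apply: le_trans (_ : \sum_(k <oo) lebesgue_rV R n (B k) <= _).
  by apply: measure_sigma_subadditive => //; exact: bigcupT_measurable.
apply: le_trans (_ : \sum_(k <oo) ((4 * 2 ^+ n.-1 * e)%:E * diam_pow n.-1 (C k)) <= _).
  by apply: lee_nneseries => k *; [exact: measure_ge0|exact: BE].
rewrite nneseriesZl; last by move=> *; exact: diam_pow_ge0.
rewrite [X in _ <= X]EFinM; apply: lee_wpmul2l; last exact: ltW.
by rewrite lee_fin !mulr_ge0 ?exprn_ge0// ltW.
Qed.

End layers.

(** * Boundary values *)

(** The point [c] is given by the mean value theorem on [[0, 1]], where the step rises from [0] to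
    [1]; it witnesses that the averaging kernel built from [ds] has positive mass. *)
Lemma sstep_derivative (R : realType) : exists (ds : R -> R) (M c : R),
  [/\ continuous ds, (forall x, is_derive x (1:R) (@sstep R) (ds x)),
      (forall x, 0 <= ds x <= M), (forall x, x < 0 \/ 1 < x -> ds x = 0) &
      [/\ 0 < M, 0 < c < 1 & 0 < ds c]].
Proof.
have [ds dS cds] := @Ck1_sstep R 1.
have cS : continuous (@sstep R) by exact: Ck1_continuous (@Ck1_sstep R 0).
have ds0 x : x < 0 \/ 1 < x -> ds x = 0.
  move=> x01; have [k hk] : exists k : R, \near x, k = sstep x.
    case: x01 => x0; [exists 0|exists 1].
      near=> y; rewrite sstep_le0//; apply: ltW; near: y; exact: lt_nbhsl.
    near=> y; rewrite sstep_ge1//; apply: ltW; near: y; exact: lt_nbhsr.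
  have hd := near_eq_is_derive hk (is_derive_cst k x (1:R)).
  by have [_ <-] := dS x; have [_ ->] := hd.
have mvt a b : a < b -> exists2 c, a < c < b & sstep b - sstep a = ds c * (b - a).
  move=> ab.
  have [c] := @MVT R (@sstep R) ds a b ab (fun x _ => dS x) (continuous_subspaceT cS).
  by rewrite in_itv/= => cab E; exists c.
have ds_ge0 x : 0 <= ds x.
  rewrite leNgt; apply/negP => dsx.
  have /nbhs_ballP[e/= e0 he] : \forall y \near x, ds y < 0.
    by have := @cds x [set z | z < 0] (lt_nbhsl dsx).
  have [|c /andP[xc cx] E] := mvt x (x + e); first by rewrite ltrDl.
  have : 0 <= sstep (x + e) - sstep x by rewrite subr_ge0 sstep_homo// lerDl ltW.
  rewrite E addrAC subrr add0r pmulr_lge0// leNgt he//.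
  by rewrite /ball/= distrC ger0_norm ?subr_ge0 ?(ltW xc)// ltrBlDl.
have [c /andP[c0 c1]] := mvt 0 1 ltr01.
rewrite (sstep_le0 (lexx 0)) (sstep_ge1 (lexx 1)) !subr0 mulr1 => dsc.
have [|m _ hm] := @compact_EVT_max R R ds `[0, 1]%classic _ (@segment_compact R 0 1)
    (continuous_subspaceT cds).
  by exists 0; rewrite /= in_itv/= lexx ler01.
exists ds, (Num.max 1 (ds m)), c; split=> //.
- move=> x; rewrite ds_ge0/= le_max; have [x0|x0] := ltP x 0; first by rewrite ds0 ?ler01//; left.
  have [x1|x1] := ltP 1 x; first by rewrite ds0 ?ler01//; right.
  by apply/orP; right; apply: hm; rewrite inE/= in_itv/= x0 x1.
- by rewrite lt_max ltr01 c0 c1 -dsc ltr01.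
Unshelve. all: by end_near. Qed.

(** * Averages over a layer in a boundary chart; [tau] is the signed height over the boundary *)

Section chart.
Context {R : realType} {d : nat}.
Local Notation V := 'rV[R]_d.
Local Notation mu := (lebesgue_rV R d).
Local Notation "'e_ i" := (delta_mx 0 i : V) (at level 8, i at level 2, format "''e_' i").
Variables (Om : set V) (i : 'I_d) (x0 : V) (sg rho r : R) (tau : V -> R).
Hypotheses (oOm : open Om) (sg2 : sg * sg = 1) (ctau : continuous tau).
Hypotheses (tauD : forall y t, tau (y + t *: 'e_i) = tau y + sg * t) (tau0 : tau x0 = 0).
Hypotheses (r0 : 0 < r) (r_rho : r <= rho / 2).
Hypotheses (tau_r : forall y, `|y - x0| <= r -> `|tau y| <= rho / 4).
Hypothesis OmP : forall y, `|y - x0| < rho -> (Om y <-> 0 < tau y).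

Let rho0 : 0 < rho. Proof. by move: r_rho r0; lra. Qed.
Let sg1 : `|sg| = 1.
Proof. by apply/eqP; rewrite -sqrp_eq1// real_normK ?num_real// expr2 sg2. Qed.

(** Horizontal cutoff: it omits the [i]-th coordinate, so its derivative along ['e_i] is [0]. The
    vertical localization is left to functions of [tau]. *)
Let eta (y : V) : R := posp (r ^+ 2 - \sum_(j < d | j != i) (y 0 j - x0 0 j) ^+ 2).

Let eta_shift y t : eta (y + t *: 'e_i) = eta y.
Proof.
rewrite /eta; congr (posp (_ - _)); apply: eq_bigr => j /negbTE ji.
by rewrite !mxE ji andbF mulr0 addr0.
Qed.

Let eta_bound y : 0 <= eta y <= r ^+ 2.
Proof.
rewrite posp_ge0/= /eta /posp ge_max sqr_ge0 andbT gerBl.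
by apply: sumr_ge0 => j _; exact: sqr_ge0.
Qed.

Let ceta : continuous eta.
Proof.
apply: cont_posp; apply: contB; first exact: cont_cst.
rewrite (_ : (fun x : V => _) = fun y : V => \sum_(j < d) (if j != i then (y 0 j - x0 0 j) ^+ 2 else 0)); last first.
  by apply/funext => y; rewrite big_mkcond.
apply: cont_sum => j; case: (j != i); last exact: cont_cst.
rewrite (_ : (fun x : V => _) = fun y : V => (y 0 j - x0 0 j) * (y 0 j - x0 0 j)); last first.
  by apply/funext => y; rewrite expr2.
by apply: contM; apply: contB; try exact: cont_cst; exact: coord_continuous.
Qed.

(** Sliding [y] along ['e_i] to the level of [x0] gives a point within [r] of [x0], where
    [|tau| <= rho / 4]. As [tau] changes at unit rate, the slide is as long as the difference of two
    values of [tau], at most [rho / 2]. *)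
Let chart_near y : eta y != 0 -> `|tau y| <= rho / 4 -> `|y - x0| <= rho / 2.
Proof.
move=> ey ty; have rho20 : 0 <= rho / 2 by rewrite divr_ge0// ltW.
have hj j : j != i -> `|y 0 j - x0 0 j| <= r.
  move=> ji; rewrite leNgt; apply/negP => h; move/eqP: ey; apply.
  rewrite /eta posp_neg// subr_le0 (bigD1 j)//= (le_trans (_ : _ <= (y 0 j - x0 0 j) ^+ 2))//.
    rewrite -(real_normK (num_real (y 0 j - x0 0 j))) ler_sqr ?nnegrE ?ltW//.
    exact: lt_trans h.
  by rewrite lerDl; apply: sumr_ge0 => k _; exact: sqr_ge0.
apply/rV_norm_leP => // j; rewrite !mxE; have [ji|ji] := eqVneq j i; last first.
  by rewrite (le_trans (hj j ji)).
rewrite ji; set t := x0 0 i - y 0 i.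
have : `|y + t *: 'e_i - x0| <= r.
  apply/rV_norm_leP => [|k]; first exact: ltW.
  rewrite !mxE; have [->|ki] := eqVneq k i.
    by rewrite eqxx /= mulr1 /t (addrC (y 0 i)) subrK subrr normr0 ltW.
  by rewrite andbF mulr0 addr0 hj.
move=> /tau_r; rewrite tauD => h.
have -> : `|y 0 i - x0 0 i| = `|sg * t| by rewrite normrM sg1 mul1r distrC.
have -> : sg * t = (tau y + sg * t) - tau y by rewrite addrC addKr.
rewrite (le_trans (ler_normB _ _))// (le_trans (lerD h ty))//; lra.
Qed.

Let foot (y : V) : V := y - (sg * tau y) *: 'e_i.

Let tau_foot y : tau (foot y) = 0.
Proof. by rewrite /foot -scaleNr tauD mulrN mulrA sg2 mul1r subrr. Qed.

Let tau0_boundary y : `|y - x0| < rho -> tau y = 0 -> boundary Om y.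
Proof.
move=> yx ty; split; last first.
  by move=> /interior_subset /OmP => /(_ yx); rewrite ty ltxx.
move=> W /nbhs_ballP[e/= e0 eW].
pose t := Num.min (e / 2) ((rho - `|y - x0|) / 2).
have t0 : 0 < t by rewrite lt_min !divr_gt0// subr_gt0.
have te : t < e by rewrite gt_min; apply/orP; left; lra.
have tr : t < rho - `|y - x0|.
  rewrite gt_min; apply/orP; right; move: yx; rewrite -subr_gt0.
  by move: (rho - `|y - x0|) => z; lra.
have nt : `|(sg * t) *: 'e_i : V| = t by rewrite norm_shift_delta normrM sg1 mul1r gtr0_norm.
exists (y + (sg * t) *: 'e_i); split.
  apply/OmP; last by rewrite tauD ty add0r mulrA sg2 mul1r.
  by rewrite addrAC (le_lt_trans (ler_normD _ _))// nt -ltrBrDl.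
by apply: eW; rewrite mx_norm_ball /ball_/= opprD addrA subrr add0r normrN nt.
Qed.

Let foot_boundary y : eta y != 0 -> `|tau y| <= rho / 4 ->
  boundary Om (foot y) /\ `|foot y - x0| <= rho / 2.
Proof.
move=> ey ty; have h : `|foot y - x0| <= rho / 2.
  apply: chart_near; first by rewrite /foot -scaleNr eta_shift.
  by rewrite tau_foot normr0 divr_ge0// ltW.
split=> //; apply: tau0_boundary (tau_foot y).
by rewrite (le_lt_trans h)// ltr_pdivrMr// ltr_pMr// ltr1n.
Qed.


Let K (e : R) : set V := [set y | `|y - x0| <= rho / 2 /\ e <= tau y].

Let cK e : compact (K e).
Proof.
apply: bounded_closed_compact.
  exists (`|x0| + rho / 2); split; first exact: num_real.
  move=> M' rM x /= [xr _]; rewrite -(subrK x0 x) (le_trans (ler_normD _ _))//.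
  by rewrite (le_trans _ (ltW rM))// addrC lerD2l.
have -> : K e = ((fun x : V => `|x - x0|) @^-1` [set t' | t' <= rho / 2]) `&`
    (tau @^-1` [set t' | e <= t']) by [].
apply: closedI.
  apply: closed_comp; last exact: closed_le.
  move=> x _; apply: (@continuous_comp _ _ _ (fun x : V => x - x0) (fun x => `|x|)).
    by apply: continuousB; [exact: cvg_id|exact: cst_continuous].
  exact: norm_continuous.
by apply: closed_comp; [move=> x _; exact: ctau|exact: closed_ge].
Qed.

Let KOm e : 0 < e -> K e `<=` Om.
Proof.
move=> e0 y [yx ty]; apply/OmP; last exact: lt_le_trans ty.
by rewrite (le_lt_trans yx)// ltr_pdivrMr// ltr_pMr// ltr1n.
Qed.

(* [g] is integrated against the derivative along ['e_i] of a cutoff that rises on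
   [e <= tau <= 2 * e] and falls at a fixed height, so that the mass [m0] of its
   rising part does not depend on [e]. *)
Lemma chart_estimate : exists m0 C, [/\ 0 < m0, 0 < C &
  forall (g Gm : V -> R) e W c1 b, has_dq Om i g Gm -> (forall x, 0 <= g x) ->
    L1 (g \_ Om) -> L1 (Gm \_ Om) -> 0 < e <= rho / 8 -> measurable W -> 0 <= c1 ->
    (forall z t, boundary Om z -> `|z - x0| <= rho / 2 -> `|t| <= 2 * e ->
       ~ W (z + t *: 'e_i) -> c1 <= g (z + t *: 'e_i)) ->
    (mu W <= (e * b)%:E)%E ->
    c1 * m0 <= C * (c1 * b + intg (g \_ Om) + intg (fun x => `|(Gm \_ Om) x|))].
Proof.
have [ds [M [c [cds dS dsM dsout [M0 /andP[c0 c1] dsc]]]]] := sstep_derivative R.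
pose S := @sstep R; pose dl := rho / 8; have dl0 : 0 < dl by rewrite divr_gt0.
(* Averaging kernel of the layer [e <= tau <= 2 * e]: up to the sign [sg], the derivative along
   ['e_i] of [eta * S (tau / e - 1)]. *)
pose P e y := eta y * (ds (tau y / e - 1) / e).
have P_ge0 e y : 0 < e -> 0 <= P e y.
  move=> e0; have /andP[h _] := eta_bound y; rewrite mulr_ge0// divr_ge0 ?(ltW e0)//.
  by have /andP[] := dsM (tau y / e - 1).
have P_le e y : 0 < e -> P e y <= r ^+ 2 * (M / e).
  move=> e0; have /andP[h1 h2] := eta_bound y; have /andP[h3 h4] := dsM (tau y / e - 1).
  by rewrite ler_pM// ?divr_ge0 ?(ltW e0)// ler_pM2r// invr_gt0.
have caff e : continuous (fun y => tau y / e - 1).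
  by apply: contB; [apply: contM => //|]; exact: cont_cst.
have ccomp (f : R -> R) e : continuous f -> continuous (fun y => f (tau y / e - 1)).
  move=> cf y; apply: (@continuous_comp _ _ _ (fun y => tau y / e - 1) f); first exact: caff.
  exact: cf.
have cP e : continuous (P e).
  by apply: contM => //; apply: contM; [exact: ccomp|exact: cont_cst].
have PK e y : 0 < e <= dl -> P e y != 0 -> [/\ K e y, eta y != 0 & 0 <= tau y <= 2 * e].
  move=> /andP[e0 ed]; rewrite /P mulf_eq0 negb_or => /andP[ey].
  rewrite mulf_eq0 negb_or => /andP[dy _].
  have t1 : e <= tau y.
    rewrite leNgt; apply/negP => h; move/eqP: dy; apply; apply: dsout; left.
    by rewrite subr_lt0 ltr_pdivrMr// mul1r.
  have t2 : tau y <= 2 * e.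
    rewrite leNgt; apply/negP => h; move/eqP: dy; apply; apply: dsout; right.
    by rewrite ltrBrDr ltr_pdivlMr// natr1 in h *.
  have t0 : 0 <= tau y by rewrite (le_trans (ltW e0)).
  split=> //; last by rewrite t0 t2.
  split=> //; apply: chart_near => //; rewrite ger0_norm// (le_trans t2)//.
  by rewrite /dl in ed; lra.
have CP e : 0 < e <= dl -> Cc Om (P e).
  move=> ed; have /andP[e0 _] := ed; split=> //; exists (K e); split; [exact: cK|exact: KOm|].
  by move=> y; apply: contra_notP => /eqP /(PK _ _ ed)[].
have dl_le : 0 < dl <= dl by rewrite dl0 lexx.
pose m0 := intg (P dl).
have m00 : 0 < m0.
  apply: (@intg_gt0 _ _ _ (P dl @^-1` [set t | 0 < t])).
  - exact: Cc_is_L1 (CP _ dl_le).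
  - by move=> x; exact: P_ge0.
  - by apply: open_comp; [move=> x _; exact: cP|exact: open_gt].
  - exists (x0 + (sg * (dl * (1 + c))) *: 'e_i) => /=.
    rewrite /P eta_shift; apply: mulr_gt0.
      rewrite /eta big1; last by move=> j _; rewrite subrr expr0n.
      by rewrite subr0 posp_pos ?sqr_ge0//; apply: exprn_gt0.
    rewrite tauD tau0 add0r !mulrA sg2 mul1r (mulrC dl) mulfK ?gt_eqF//.
    by rewrite addrAC subrr add0r divr_gt0.
  - by [].
have r20 : 0 < r ^+ 2 by rewrite exprn_gt0.
exists m0, (r ^+ 2 * (M / dl) + r ^+ 2 + r ^+ 2 * M); split=> //.
  by rewrite addr_gt0 ?addr_gt0 ?(mulr_gt0 r20 M0) ?(mulr_gt0 r20 (divr_gt0 M0 dl0)).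
move=> g Gm e W k b dqg g0 Lg LG ed mW k0 hk Wb; have /andP[e0 _] := ed.
(* Both steps are [0] below height [e] and [1] above [2 * dl], so [B] has compact support in [Om].
   Its derivative along ['e_i] compares the average over the thin layer with that over the fixed
   one. *)
pose B y := eta y * (S (tau y / e - 1) - S (tau y / dl - 1)).
have cS : continuous S by exact: Ck1_continuous (@Ck1_sstep R 0).
have BK y : ~ K e y -> B y = 0.
  apply: contra_notP => /eqP; rewrite /B mulf_eq0 negb_or => /andP[ey Sy].
  have t1 : e <= tau y.
    rewrite leNgt; apply/negP => h; move/eqP: Sy; apply; rewrite /S !sstep_le0 ?subr0//.
      by rewrite subr_le0 ler_pdivrMr// mul1r (le_trans (ltW h))//; case/andP: ed.
    by rewrite subr_le0 ler_pdivrMr// mul1r ltW.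
  have t2 : tau y <= 2 * dl.
    rewrite leNgt; apply/negP => h; move/eqP: Sy; apply; rewrite /S !sstep_ge1 ?subrr//.
      by rewrite lerBrDr ler_pdivlMr//; exact: ltW.
    rewrite lerBrDr ler_pdivlMr//; apply: le_trans (ltW h).
    by apply: ler_wpM2l => //; case/andP: ed.
  split=> //; apply: chart_near => //; rewrite ger0_norm ?(le_trans (ltW e0))// (le_trans t2)//.
  by rewrite /dl; lra.
have cB : continuous B.
  by apply: contM => //; apply: contB; exact: ccomp.
have CB : Cc Om B by split; [exact: cB|exists (K e); split; [exact: cK|exact: KOm|exact: BK]].
have B_le y : `|B y| <= r ^+ 2.
  have /andP[h1 h2] := eta_bound y; rewrite /B normrM ger0_norm// -[leRHS]mulr1.
  apply: ler_pM => //; rewrite ler_norml.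
  move: (sstep_ge0 (tau y / e - 1)) (sstep_le1 (tau y / e - 1)).
  move: (sstep_ge0 (tau y / dl - 1)) (sstep_le1 (tau y / dl - 1)); rewrite /S.
  by move: (sstep _) (sstep _) => a1 a2; lra.
have dtau y : is_derive y ('e_i : V) tau sg.
  apply/is_derive_line; rewrite (_ : (fun h : R => _) = fun h => tau y + sg * h).
    have h := is_deriveD (is_derive_cst (tau y) (0:R) (1:R)) (is_deriveZ sg (is_derive_id (0:R) (1:R))).
    by apply: (is_derive_eq h); rewrite add0r [_ *: _]mulr1.
  by apply/funext => h; rewrite addrC tauD.
have deta y : is_derive y ('e_i : V) eta 0.
  apply/is_derive_line; rewrite (_ : (fun h : R => _) = fun h => eta y).
    exact: is_derive_cst.
  by apply/funext => h; rewrite addrC eta_shift.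
have dSt a y : is_derive y ('e_i : V) (fun y => S (tau y / a - 1)) (ds (tau y / a - 1) * (sg / a)).
  apply: (@is_derive_comp1 _ _ S (fun y => tau y / a - 1)).
  have h := is_deriveB (is_deriveM (dtau y) (is_derive_cst (a^-1) y ('e_i : V))) (is_derive_cst (1:R) y ('e_i : V)).
  apply: (is_derive_eq h).
  by rewrite scaler0 add0r subr0 /GRing.scale/= mulrC.
have dB y : is_derive y ('e_i : V) B (sg * (P e y - P dl y)).
  apply: (is_derive_eq (is_deriveM (deta y) (is_deriveB (dSt e y) (dSt dl y)))).
  rewrite scaler0 addr0 /GRing.scale/= /P.
  by move: (ds (tau y / e - 1)) (ds (tau y / dl - 1)) (eta y) (e^-1) (dl^-1) => a1 a2 a3 a4 a5; ring.
have cB' : continuous (fun y => sg * (P e y - P dl y)).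
  by apply: contM; [exact: cont_cst|apply: contB].
have [cg _ _ _] := dqg.
have LgP a : 0 < a <= dl -> L1 (fun x => g x * P a x).
  by move=> ad; apply: Cc_is_L1 (CcMl oOm _ (CP a ad)) => x _; exact: cg.
have LP a : 0 < a <= dl -> L1 (P a) by move=> ad; exact: Cc_is_L1 (CP a ad).
have ibp := has_dq_ibp dqg CB dB cB'.
(* The same integration by parts applied to the constant function [1], whose weak derivative is
   [0]. *)
have mass : intg (P e) = m0.
  have dq1 : has_dq Om i (fun _ : V => 1) (fun=> 0).
    exact: (has_dq_C1 oOm (@cont_cst _ _ 1) (fun x _ => is_derive_cst (1:R) x ('e_i : V))
      (fun x _ => @cont_cst _ _ 0 x)).
  have := has_dq_ibp dq1 CB dB cB'.
  rewrite [X in _ = - X -> _](_ : _ = 0); last first.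
    by rewrite (@eq_intg _ _ _ (fun x => 0 * B x))// intgZ ?mul0r//; exact: Cc_is_L1 CB.
  rewrite (@eq_intg _ _ _ (fun x => sg * (P e x - P dl x))); last by move=> x; rewrite mul1r.
  have LPe := LP e ed; have LPd := LP dl dl_le.
  rewrite intgZ; last exact: L1B.
  rewrite intgB// oppr0 => /eqP; rewrite mulf_eq0 => /orP[/eqP sg00|].
    by move: sg2; rewrite sg00 mulr0 => /esym/eqP; rewrite oner_eq0.
  by rewrite subr_eq0 => /eqP.
have LGe := LgP e ed; have LGd := LgP dl dl_le.
have ibp' : intg (fun x => g x * P e x) - intg (fun x => g x * P dl x) =
    - (sg * intg (fun x => Gm x * B x)).
  rewrite -mulrN -ibp (@eq_intg _ _ (fun x => g x * (sg * (P e x - P dl x))) (fun x => sg * (g x * P e x - g x * P dl x))); last first.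
    by move=> x /=; rewrite mulrCA mulrBr.
  by rewrite intgZ ?mulrA ?sg2 ?mul1r ?intgB//; exact: L1B.
have GB x : Gm x * B x = (Gm \_ Om) x * B x.
  rewrite patchE; case: ifPn => // /negP; rewrite inE => nO.
  by rewrite BK ?mulr0// => /(KOm e0).
have LGB : L1 (fun x => (Gm \_ Om) x * B x) by exact: L1M_Om.
have Q_le : `|intg (fun x => Gm x * B x)| <= r ^+ 2 * intg (fun x => `|(Gm \_ Om) x|).
  rewrite (eq_intg GB); apply: le_trans (intg_norm LGB) _.
  rewrite -intgZ; last exact: L1_norm.
  apply: le_intg; [exact: L1_norm|by apply: L1Z; exact: L1_norm|].
  by move=> x; rewrite normrM mulrC ler_wpM2r.
have A_le : intg (fun x => g x * P dl x) <= r ^+ 2 * (M / dl) * intg (g \_ Om).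
  rewrite -intgZ//; apply: le_intg => //; first exact: L1Z.
  move=> x; rewrite patchE; case: ifPn => [_|/negP].
    by rewrite mulrC ler_wpM2r// P_le.
  rewrite inE => nO; rewrite mulr0 (_ : P dl x = 0) ?mulr0//.
  by apply/eqP; apply: contrapT => /negP/(PK dl x dl_le)[/(KOm dl0)].
have LW : L1 (\1_W : V -> R).
  have Wfin : (mu W < +oo)%E by apply: le_lt_trans Wb _; exact: ltry.
  apply/integrableP; split; first by apply/measurable_EFinP; exact: measurable_indic.
  rewrite (eq_integral (fun x => (\1_W x : R)%:E)); first by rewrite integral_indic// setIT.
  by move=> x _ /=; rewrite ger0_norm.
have W_le : intg (\1_W : V -> R) <= e * b.
  by rewrite -lee_fin -intg_EFin// integral_indic// setIT.
(* Off [W] a point of the layer is its foot on the boundary plus a height at most [2 * e], so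
   [g >= k] there. On [W] the subtracted bound on [P e] already makes the left integrand
   nonpositive. The [1 / e] of the kernel cancels the [e] of the volume of [W]. *)
have low : k * m0 - k * (r ^+ 2 * (M / e)) * (e * b) <= intg (fun x => g x * P e x).
  rewrite -mass; apply: (@le_trans _ _ (k * intg (P e) - k * (r ^+ 2 * (M / e)) * intg (\1_W : V -> R))).
    rewrite lerD2l lerN2; apply: ler_wpM2l W_le.
    exact: mulr_ge0 k0 (mulr_ge0 (ltW r20) (divr_ge0 (ltW M0) (ltW e0))).
  have LPe := LP e ed.
  rewrite -!intgZ// -intgB; try exact: L1Z.
  apply: le_intg => //; first by apply: L1B; exact: L1Z.
  move=> x; have Px := P_ge0 e x e0; rewrite indicE.
  have [Wx|nWx] := boolP (x \in W).
    rewrite mulr1 -mulrBr; apply: (@le_trans _ _ 0); last exact: mulr_ge0 (g0 x) Px.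
    by apply: mulr_ge0_le0 => //; rewrite subr_le0 P_le.
  rewrite mulr0n mulr0 subr0; have [->|/(PK e x ed)[_ ex /andP[tx0 tx]]] := eqVneq (P e x) 0.
    by rewrite !mulr0.
  rewrite ler_wpM2r//.
  have tx4 : `|tau x| <= rho / 4.
    by rewrite ger0_norm// (le_trans tx)//; move: ed => /andP[_]; rewrite /dl; lra.
  have [bf nf] := foot_boundary ex tx4.
  have xE : x = foot x + (sg * tau x) *: 'e_i by rewrite subrK.
  rewrite xE; apply: hk bf nf _ _.
    by rewrite normrM sg1 mul1r ger0_norm.
  by rewrite -xE => Wx; move/negP: nWx; rewrite inE.
have I1 : 0 <= intg (g \_ Om) by apply: intg_ge0 => x; rewrite patchE; case: ifP.
have I2 : 0 <= intg (fun x => `|(Gm \_ Om) x|) by apply: intg_ge0.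
have E : k * (r ^+ 2 * (M / e)) * (e * b) = r ^+ 2 * M * (k * b).
  by field; rewrite gt_eqF.
have b0 : 0 <= b.
  rewrite -(pmulr_rge0 b e0) -lee_fin; apply: le_trans Wb; exact: measure_ge0.
have Qs : - (sg * intg (fun x => Gm x * B x)) <= r ^+ 2 * intg (fun x => `|(Gm \_ Om) x|).
  by apply: le_trans Q_le; rewrite -[X in _ <= X]mul1r -sg1 -normrM -normrN ler_norm.
have h1 : intg (fun x => g x * P e x) <= r ^+ 2 * (M / dl) * intg (g \_ Om) +
    r ^+ 2 * intg (fun x => `|(Gm \_ Om) x|).
  by rewrite -(subrK (intg (fun x => g x * P dl x)) (intg (fun x => g x * P e x))) ibp' addrC lerD.
move: low; rewrite E lerBlDr => /le_trans; apply; apply: le_trans (lerD h1 (lexx _)) _.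
have k1 : 0 <= k * b by rewrite mulr_ge0.
have a1 : 0 <= r ^+ 2 * (M / dl) by exact: mulr_ge0 (ltW r20) (divr_ge0 (ltW M0) (ltW dl0)).
have a3 : 0 <= r ^+ 2 * M by exact: mulr_ge0 (ltW r20) (ltW M0).
move: k1 I1 I2 a1 a3 (ltW r20).
move: (r ^+ 2) (r ^+ 2 * (M / dl)) (r ^+ 2 * M) (k * b) (intg (g \_ Om))
  (intg (fun x => `|(Gm \_ Om) x|)) => x2 x1 x3 y1 y2 y3 *; rewrite !mulrDl !mulrDr.
by rewrite -subr_ge0 [X in 0 <= X](_ : _ = x1 * y1 + x1 * y3 + x2 * y1 + x2 * y2 + x3 * y2 + x3 * y3);
  [rewrite !addr_ge0 ?mulr_ge0|ring].
Qed.

End chart.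

Section boundary_chart.
Context {R : realType} {d : nat}.
Local Notation V := 'rV[R]_d.
Local Notation "'e_ i" := (delta_mx 0 i : V) (at level 8, i at level 2, format "''e_' i").
Variable Om : set V.

Lemma boundary_chart x0 (R1 : R) : open Om -> smooth_boundary Om -> boundary Om x0 -> 0 < R1 ->
  exists i (sg rho r : R) (tau : V -> R),
  [/\ sg * sg = 1, continuous tau, (forall y t, tau (y + t *: 'e_i) = tau y + sg * t) &
      tau x0 = 0] /\
  [/\ 0 < r, r <= rho / 2, rho <= R1, (forall y, `|y - x0| <= r -> `|tau y| <= rho / 4) &
      forall y, `|y - x0| < rho -> (Om y <-> 0 < tau y)].
Proof.
move=> oOm sOm bx R10; have [i [s [gam [sgam gamD hx]]]] := sOm x0 bx.
pose sg : R := (-1) ^+ s; pose tau (y : V) := sg * (y 0 i - gam y).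
have sg2 : sg * sg = 1 by rewrite /sg -expr2 sqrr_sign.
have ctau : continuous tau.
  apply: contM; first exact: cont_cst.
  by apply: contB; [exact: coord_continuous|exact: smooth_continuous].
have tauD y t : tau (y + t *: 'e_i) = tau y + sg * t.
  by rewrite /tau gamD !mxE !eqxx mulr1 -mulrDr; congr (_ * _); ring.
have [e/= e0 he] : exists2 e : R, 0 < e & forall y, `|y - x0| < e -> (Om y <-> 0 < tau y).
  move: hx => /nbhs_ballP[e/= e0 he]; exists e => // y yx.
  by apply: he; rewrite mx_norm_ball /ball_/= distrC.
(* A positive value would put [x0] in the open set [Omega], a negative one would keep [Omega] away
   from a neighborhood of [x0]. *)
have tau0 : tau x0 = 0.
  have [cx nix] := bx; apply/eqP; rewrite eq_le; apply/andP; split.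
    rewrite leNgt; apply/negP => t0; apply: nix.
    rewrite /interior; apply: open_nbhs_nbhs; split=> //; apply/(he x0) => //.
    by rewrite subrr normr0.
  rewrite leNgt; apply/negP => t0.
  have h1 : \forall y \near x0, tau y < 0.
    by have := @ctau x0 [set z | z < 0] (lt_nbhsl t0).
  have h2 : \forall y \near x0, `|y - x0| < e.
    by apply/nbhs_ballP; exists e => // y; rewrite mx_norm_ball /ball_/= distrC.
  have [y [Oy [ty yx]]] := cx _ (filterI h1 h2).
  by have /(he y yx) := Oy; rewrite ltNge (ltW ty).
pose rho := Num.min R1 e.
have rho0 : 0 < rho by rewrite lt_min R10.
have [r1 /= r10 hr1] : exists2 r1 : R, 0 < r1 & forall y, `|y - x0| < r1 -> `|tau y| < rho / 4.
  have /nbhs_ballP[r1/= r10 hr] : \forall y \near x0, `|tau x0 - tau y| < rho / 4.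
    by have /cvgrPdist_lt := @ctau x0; apply; rewrite divr_gt0.
  exists r1 => // y yx; have := hr y; rewrite tau0 sub0r normrN; apply.
  by rewrite mx_norm_ball /ball_/= distrC.
pose r := Num.min (r1 / 2) (rho / 2).
exists i, sg, rho, r, tau; split; split=> //.
- by rewrite lt_min !divr_gt0.
- by rewrite /r ge_min lexx orbT.
- by rewrite /rho ge_min lexx.
- move=> y yr; apply: ltW; apply: hr1; apply: le_lt_trans yr _.
  by rewrite /r gt_min ltr_pdivrMr// ltr_pMr// ltr1n.
- by move=> y yr; apply: he; apply: lt_le_trans yr _; rewrite /rho ge_min lexx orbT.
Qed.

End boundary_chart.

Section small_energy.
Context {R : realType} {d : nat}.
Local Notation V := 'rV[R]_d.
Local Notation mu := (lebesgue_rV R d).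
Variables (Om : set V) (p : R).
Hypotheses (oOm : open Om) (bOm : bounded_set Om) (p2 : 2 <= p).

(** For [t > lam] one has [t^p >= lam^(p-2) t^2]. On a bounded domain this stands in for Hölder's
    inequality in passing from [L^p] smallness to [L^2] smallness. *)
Lemma sqr_le_powR (lam t : R) : 0 < lam -> 0 <= t ->
  t ^+ 2 <= lam ^+ 2 + (lam `^ (p - 2))^-1 * t `^ p.
Proof.
move=> l0 t0; have [tl|lt] := leP t lam.
  rewrite -[leLHS]addr0 lerD ?mulr_ge0 ?invr_ge0 ?powR_ge0//.
  by rewrite ler_sqr// nnegrE ltW.
have tp : 0 < t by exact: lt_trans lt.
rewrite -[leLHS]add0r lerD ?sqr_ge0// mulrC ler_pdivlMr ?powR_gt0//.
have -> : t `^ p = t ^+ 2 * t `^ (p - 2).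
  rewrite -powR_mulrn ?(ltW tp)// -powRD; last by apply/implyP => _; rewrite gt_eqF.
  by rewrite addrC subrK.
rewrite ler_wpM2l ?sqr_ge0//; apply: ge0_ler_powR; rewrite ?nnegrE ?subr_ge0 ?(ltW l0) ?(ltW tp) ?(ltW lt)//.
Qed.

(** The quantity [2 f^2 + D^2] dominates [(f^+)^2] plus the absolute value [2 f^+ |D|] of its
    derivative, which is what the chart estimate has to absorb. *)
Lemma small_energy (k0 : R) : 0 < k0 -> exists2 eta, 0 < eta &
  forall f D, in_Lp Om p f -> in_Lp Om p D ->
  intg ((fun x => `|f x| `^ p) \_ Om) + intg ((fun x => `|D x| `^ p) \_ Om) < eta ->
  L1 ((fun x => 2 * f x ^+ 2 + D x ^+ 2) \_ Om) /\
  intg ((fun x => 2 * f x ^+ 2 + D x ^+ 2) \_ Om) < k0.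
Proof.
move=> k00; have p1 : 1 <= p by rewrite (le_trans _ p2)// ler1n.
have mOm : measurable Om by exact: open_measurable_rV.
have L1c : L1 ((fun _ : V => 1 : R) \_ Om) by apply: integrable_Om => //; exact: integrable_cst_Om.
pose m := intg ((fun _ : V => 1 : R) \_ Om).
have m0 : 0 <= m by apply: intg_ge0 => x; rewrite patchE; case: ifP.
(* With [m] the volume of [Om], the constant part [3 * lam ^+ 2 * m] stays below [k0 / 2]; the
   choice of [eta] below keeps the [p]-th power part under the other half. *)
pose lam := Num.min 1 (k0 / (6 * (m + 1))).
have m1 : 0 < m + 1 by rewrite ltr_wpDl.
have l0 : 0 < lam by rewrite lt_min ltr01 divr_gt0// mulr_gt0.
have l2 : lam ^+ 2 * 3 * m <= k0 / 2.
  have la : lam <= 1 by rewrite ge_min lexx.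
  have lb : lam * (6 * (m + 1)) <= k0 by rewrite -ler_pdivlMr ?mulr_gt0// ge_min lexx orbT.
  have lc : lam ^+ 2 <= lam by rewrite expr2 ler_piMr// ltW.
  apply: (@le_trans _ _ (lam * 3 * (m + 1))).
    apply: ler_pM; [by rewrite mulr_ge0 ?sqr_ge0|exact: m0|by rewrite ler_pM2r|].
    by rewrite lerDl.
  by move: lb; lra.
pose c := (lam `^ (p - 2))^-1; have c0 : 0 < c by rewrite invr_gt0 powR_gt0.
exists (k0 / (4 * c)); first by rewrite divr_gt0// mulr_gt0.
move=> f D Lf LD small.
have [mf If] := (in_LpP Om p f).1 Lf; have [mD ID] := (in_LpP Om p D).1 LD.
have {}If := integrable_Om oOm If; have {}ID := integrable_Om oOm ID.
pose B := fun x => 3 * lam ^+ 2 * ((fun _ : V => 1 : R) \_ Om) x +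
  (2 * c) * (((fun x => `|f x| `^ p) \_ Om) x + ((fun x => `|D x| `^ p) \_ Om) x).
have LB : L1 B by apply: L1D; [exact: L1Z|apply: L1Z; exact: L1D].
have h x : 0 <= ((fun x => 2 * f x ^+ 2 + D x ^+ 2) \_ Om) x <= B x.
  rewrite /B !patchE; case: ifPn => [_|_]; last by rewrite !(mulr0, addr0) lexx.
  have a1 := sqr_le_powR l0 (normr_ge0 (f x)); have a2 := sqr_le_powR l0 (normr_ge0 (D x)).
  rewrite !real_normK ?num_real// in a1 a2.
  have b1 := powR_ge0 `|f x| p; have b2 := powR_ge0 `|D x| p.
  have e1 := mulr_ge0 (ltW c0) b2.
  rewrite -/c in a1 a2; apply/andP; split.
    by apply: addr_ge0; [apply: mulr_ge0|]; rewrite ?sqr_ge0.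
  rewrite mulr1 mulrDr -!mulrA; move: a1 a2 e1.
  move: (c * `|f x| `^ p) (c * `|D x| `^ p) (f x ^+ 2) (D x ^+ 2) (lam ^+ 2).
  by clear=> *; lra.
have mf' := L1_measurable (in_Lp_L1 oOm bOm p1 Lf).
have mD' := L1_measurable (in_Lp_L1 oOm bOm p1 LD).
have L : L1 ((fun x => 2 * f x ^+ 2 + D x ^+ 2) \_ Om).
  apply: le_L1 LB; last by move=> x; have /andP[a b] := h x; rewrite ger0_norm.
  rewrite (_ : _ \_ Om = fun x => 2 * (f \_ Om) x ^+ 2 + (D \_ Om) x ^+ 2); last first.
    by apply/funext => x; rewrite !patchE; case: ifP => // _; rewrite expr0n/= mulr0 addr0.
  apply: measurable_funD; last exact: measurable_funX.
  by apply: measurable_funM => //; exact: measurable_funX.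
split=> //; apply: (@le_lt_trans _ _ (intg B)).
  by apply: le_intg => // x; have /andP[] := h x.
rewrite /B intgD; [|exact: L1Z|by apply: L1Z; exact: L1D].
rewrite !intgZ//; last exact: L1D.
rewrite intgD// -/m.
move: small; rewrite -(ltr_pM2l (mulr_gt0 (ltr0Sn R 1) c0)).
have -> : 2 * c * (k0 / (4 * c)) = k0 / 2 by field; rewrite gt_eqF.
move: l2; rewrite (mulrC 3); move: (lam ^+ 2 * 3 * m) (2 * c * _) => a b; lra.
Qed.

End small_energy.

(** * Traces of continuous Sobolev functions are boundary values *)

Section trace.
Context {R : realType} {d : nat}.
Local Notation V := 'rV[R]_d.
Local Notation mu := (lebesgue_rV R d).
Local Notation "'e_ i" := (delta_mx 0 i : V) (at level 8, i at level 2, format "''e_' i").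
Variables (Om : set V) (p : R).
Hypotheses (oOm : open Om) (bOm : bounded_set Om) (p2 : 2 <= p).

Let p1 : 1 <= p. Proof. by rewrite (le_trans _ p2)// ler1n. Qed.
Let p0 : 0 <= p. Proof. exact: le_trans ler01 p1. Qed.
Let mOm : measurable Om. Proof. exact: open_measurable_rV. Qed.

Lemma closed_boundary (A : set V) : closed (boundary A).
Proof.
rewrite /boundary setDE; apply: closedI; first exact: closed_closure.
exact: open_closedC (@open_interior _ A).
Qed.

Lemma in_Lp_B (f g : V -> R) : in_Lp Om p f -> in_Lp Om p g -> in_Lp Om p (fun x => f x - g x).
Proof.
move=> hf hg; apply: (in_Lp_D oOm p0 hf).
by apply: (in_Lp_le oOm p0 _ _ hg) => [|x _]; [exact: measurableT_comp hg.1|rewrite normrN].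
Qed.

Lemma intg_powR_Om (f : V -> R) : in_Lp Om p f ->
  (\int[mu]_(x in Om) (`|f x| `^ p)%:E)%E = (intg ((fun x => `|f x| `^ p) \_ Om))%:E.
Proof.
move=> /(in_LpP Om p f)[_ /(integrable_Om oOm) h].
by rewrite -intg_EFin// integral_mkcond restrict_EFin.
Qed.

(** Here [a] is the sign of [u x0 - F x0] and [3 * c] its absolute value; near [x0] the variations
    of [u] and [F] cost at most [c / 2] each. *)
Lemma chart_gap (u F : V -> R) x0 : continuous u -> [lipschitz F x | x in boundary Om] ->
  boundary Om x0 -> u x0 <> F x0 ->
  exists a c R1, [/\ a * a = 1, 0 < c, 0 < R1 &
    forall y, boundary Om y -> `|y - x0| <= R1 -> 2 * c <= a * (u y - F y)].
Proof.
move=> cu [M [_ hM]] bx uF.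
pose L := `|M| + 1; have L0 : 0 < L by rewrite ltr_wpDl.
have hL y : boundary Om y -> `|F y - F x0| <= L * `|y - x0|.
  move=> By; have /(_ _ (y, x0))/= := hM L _; apply=> //.
  by rewrite (le_lt_trans (ler_norm M))// ltrDl.
have [a [a2 ha]] : exists a : R, a * a = 1 /\ 0 < a * (u x0 - F x0).
  have [h|h|h] := ltgtP (u x0) (F x0); last by [].
    by exists (-1); rewrite mulrNN mulr1 mulN1r oppr_gt0 subr_lt0.
  by exists 1; rewrite mulr1 mul1r subr_gt0.
have a1 : `|a| = 1 by apply/eqP; rewrite -sqrp_eq1// real_normK ?num_real// expr2 a2.
pose c := a * (u x0 - F x0) / 3; have c0 : 0 < c by rewrite divr_gt0.
have /nbhs_ballP[e/= e0 he] : \forall y \near x0, `|u x0 - u y| < c / 2.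
  by have /cvgrPdist_lt := @cu x0; apply; rewrite divr_gt0.
pose R1 := Num.min (e / 2) (c / (2 * L)).
have R10 : 0 < R1 by rewrite lt_min !divr_gt0// mulr_gt0.
exists a, c, R1; split=> // y By yx.
have h1 : `|u x0 - u y| < c / 2.
  apply: he; rewrite mx_norm_ball /ball_/= distrC (le_lt_trans yx)// gt_min.
  by rewrite ltr_pdivrMr// ltr_pMr// ltr1n.
have h2 : `|F y - F x0| <= c / 2.
  apply: le_trans (hL y By) _; rewrite mulrC -ler_pdivlMr//; apply: le_trans yx _.
  by rewrite /R1 ge_min -mulrA -invfM lexx orbT.
have h3 : a * (u x0 - u y) <= c / 2.
  by rewrite (le_trans (ler_norm _))// normrM a1 mul1r ltW.
have h4 : a * (F y - F x0) <= c / 2.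
  by rewrite (le_trans (ler_norm _))// normrM a1 mul1r.
have -> : a * (u y - F y) = 3 * c - a * (u x0 - u y) - a * (F y - F x0).
  by rewrite /c; field.
by move: h3 h4; move: (a * _) (a * _) => *; lra.
Qed.

Let amgm_sqr (y z t : R) : y ^+ 2 <= t -> y ^+ 2 + 2 * y * z <= 2 * t + z ^+ 2.
Proof.
move=> yt; rewrite -subr_ge0.
have -> : 2 * t + z ^+ 2 - (y ^+ 2 + 2 * y * z) = 2 * (t - y ^+ 2) + (y - z) ^+ 2 by ring.
by rewrite addr_ge0 ?sqr_ge0// mulr_ge0// subr_ge0.
Qed.

Lemma trace_boundary (u F : V -> R) : smooth_boundary Om -> continuous u ->
  [lipschitz F x | x in boundary Om] -> has_trace Om p u F ->
  forall x, boundary Om x -> u x = F x.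
Proof.
move=> sOm cu lF [G [w [H [sG hw hc hb]]]] x0 bx; apply: contrapT => uF.
have [a [c [R1 [a2 c0 R10 gap]]]] := chart_gap cu lF bx uF.
have a1 : `|a| = 1 by apply/eqP; rewrite -sqrp_eq1// real_normK ?num_real// expr2 a2.
have [i [sg [rho [r [tau [[sg2 ctau tauD tau0] [r0 rrho rhoR tau_r OmP]]]]]]] :=
  boundary_chart oOm sOm bx R10.
have rho0 : 0 < rho by move: r0 rrho; lra.
have [m0 [C [m00 C0 est]]] := chart_estimate oOm sg2 ctau tauD tau0 r0 rrho tau_r OmP.
(* [h0] and [k0] are chosen so that, on the right of the chart estimate, the exceptional set
   contributes exactly [c1 * m0 / 2] and the integrals strictly less than [c1 * m0 / 2], against
   [c1 * m0] on the left. *)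
pose c1 := (c / 2) ^+ 2; have c10 : 0 < c1 by rewrite exprn_gt0// divr_gt0.
pose A : R := 8 * 2 ^+ d.-1; have A0 : 0 < A by rewrite mulr_gt0// exprn_gt0.
pose h0 := m0 / (2 * C * A); have h00 : 0 < h0 by rewrite divr_gt0// !mulr_gt0.
pose k0 := c1 * m0 / (2 * C); have k00 : 0 < k0 by rewrite divr_gt0 ?mulr_gt0.
have [eta eta0 small] := small_energy oOm bOm p2 k00.
have cp0 : 0 < c `^ p by exact: powR_gt0.
(* The first bound, by Chebyshev at level [c], gives surface measure below [h0] to the points where
   [w k] is at least [c] away from [F]; the second puts the energy of the difference below [eta]. *)
have [k [hk1 hk2]] : exists k,
    (\int[hausdorff_measure R d d.-1]_(x in boundary Om) (`|w k x - F x| `^ p)%:E < (c `^ p * h0)%:E)%E /\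
    sobolev_norm Om p (w k \- u) (H k \- G) < eta `^ p^-1.
  have /fine_cvgP[hfin /cvgrPdist_lt hcv] := hb.
  have ch0 : 0 < c `^ p * h0 by rewrite mulr_gt0.
  have hc1 := hcv _ ch0.
  have hc2 : \forall k \near \oo, `|0 - sobolev_norm Om p (w k \- u) (H k \- G)| < eta `^ p^-1.
    by move/cvgrPdist_lt: hc; apply; exact: powR_gt0.
  have [N _ hN] := filterI hfin (filterI hc1 hc2).
  exists N; have [f1 [f2 f3]] := hN N (leqnn N); split.
    rewrite -(fineK f1) lte_fin; move: f2; rewrite sub0r normrN.
    by apply: le_lt_trans; exact: ler_norm.
  by move: f3; rewrite sub0r normrN; apply: le_lt_trans; exact: ler_norm.
have [w' cw' ww'] := tietze_compact (closure_bounded bOm) (hw k).2.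
have Omcl x : Om x -> closure Om x by exact: subset_closure.
have sw : sobolev_grad Om p w' (H k).
  by apply: sobolev_grad_ext (hw k).1 => x /Omcl; exact: ww'.
pose f x := a * (u x - w' x).
have cf : continuous f by apply: contM; [exact: cont_cst|exact: contB].
have dq0 : has_dq Om i (fun _ : V => 0) (fun=> 0).
  exact: (has_dq_C1 oOm (@cont_cst _ _ 0) (fun x _ => is_derive_cst (0:R) x ('e_i : V))
      (fun x _ => @cont_cst _ _ 0 x)).
have dqu := @sobolev_has_dq _ _ _ oOm bOm p u G i p1 cu sG.
have dqw := @sobolev_has_dq _ _ _ oOm bOm p w' (H k) i p1 cw' sw.
have dqf := @has_dq_lin _ _ _ _ _ _ _ _ (- a) dq0 (@has_dq_lin _ _ _ _ _ _ _ _ 1 dqu dqw).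
have fE : (fun x => 0 - - a * (u x - 1 * w' x)) = f.
  by apply/funext => x; rewrite sub0r mulNr opprK mul1r.
rewrite fE in dqf; have dqg := has_dq_pos2 dqf.
set Gm := (fun x => 2 * _ * _) in dqg.
pose D x := a * (G x 0 i - H k x 0 i).
have GmE x : Om x -> Gm x = 2 * posp (f x) * D x.
  by move=> Ox; rewrite /Gm !patchE mem_set// sub0r mulNr opprK mul1r.
have in_a g : in_Lp Om p g -> in_Lp Om p (fun x => a * g x).
  move=> hg; apply: (in_Lp_le oOm p0 _ _ hg) => [|x _]; last by rewrite normrM a1 mul1r.
  by apply: measurable_funM => //; exact: hg.1.
have [Lu LG _] := sG; have [Lw LH _] := sw.
have Lf : in_Lp Om p f := in_a _ (in_Lp_B Lu Lw).
have LD : in_Lp Om p D := in_a _ (in_Lp_B (LG i) (LH i)).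
have smallfD : intg ((fun x => `|f x| `^ p) \_ Om) + intg ((fun x => `|D x| `^ p) \_ Om) < eta.
  have LHG j : in_Lp Om p (fun x => (H k \- G) x 0 j).
    have -> : (fun x => (H k \- G) x 0 j) = (fun x => H k x 0 j - G x 0 j).
      by apply/funext => x; rewrite !mxE.
    exact: (in_Lp_B (LH j) (LG j)).
  have [Ldir dirE] := dirichlet_intg oOm bOm p1 LHG.
  have fpE : (\int[mu]_(x in Om) (`|(w k \- u) x| `^ p)%:E)%E =
      (intg ((fun x => `|f x| `^ p) \_ Om))%:E.
    rewrite -(intg_powR_Om Lf); apply: eq_integral => x; rewrite inE => /Omcl clx.
    by rewrite /= ww'// /f normrM a1 mul1r distrC.
  have [_ ID] := (in_LpP Om p D).1 LD; have {}ID := integrable_Om oOm ID.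
  have D_le : intg ((fun x => `|D x| `^ p) \_ Om) <=
      intg ((fun x => eucl_norm ((H k \- G) x) `^ p) \_ Om).
    apply: le_intg => // x; rewrite !patchE; case: ifP => // _.
    apply: ge0_ler_powR; rewrite ?nnegrE ?eucl_norm_ge0//.
    apply: le_trans (coord_le_eucl _ i).
    by rewrite /D normrM a1 mul1r !mxE distrC.
  apply: le_lt_trans (lerD (lexx _) D_le) _.
  move: hk2; rewrite /sobolev_norm fpE dirE -EFinD /=.
  set X := (X in X `^ _ < _); apply: contraTT; rewrite -!leNgt => eX.
  by apply: ge0_ler_powR; rewrite ?invr_ge0 ?nnegrE ?(ltW eta0)// (le_trans (ltW eta0)).
have [LB IB] := small f D Lf LD smallfD.
have g_le x : posp (f x) ^+ 2 <= f x ^+ 2.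
  rewrite -(real_normK (num_real (f x))) ler_sqr ?nnegrE ?posp_ge0//.
  by rewrite /posp ge_max ler_norm normr_ge0.
have posp_le x : posp (f x) <= `|f x| by rewrite /posp ge_max ler_norm normr_ge0.
have intB : mu.-integrable Om (EFin \o (fun x => 2 * f x ^+ 2 + D x ^+ 2)).
  have := LB; rewrite /L1 -restrict_EFin => /(integrable_restrict _ mOm measurableT).
  by rewrite setTI.
have Gm_le x : Om x -> posp (f x) ^+ 2 + `|Gm x| <= 2 * f x ^+ 2 + D x ^+ 2.
  move=> Ox; rewrite GmE// normrM ger0_norm; last by rewrite mulr_ge0 ?posp_ge0.
  have := @amgm_sqr (posp (f x)) `|D x| (f x ^+ 2) (g_le x).
  by rewrite (real_normK (num_real (D x))).
have cg : continuous (fun x => posp (f x) ^+ 2) by case: dqg.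
have Lg : L1 ((fun x => posp (f x) ^+ 2) \_ Om).
  apply: integrable_Om => //; apply: (integrable_bound oOm _ _ intB).
    by apply: continuous_on_measurable_rV => // x _; exact: cg.
  move=> x Ox; rewrite ger0_norm ?sqr_ge0//; apply: le_trans (Gm_le x Ox).
  by rewrite lerDl.
have LGm : L1 (Gm \_ Om).
  apply: integrable_Om => //; apply: (integrable_bound oOm _ _ intB).
    apply: (eq_measurable_fun (fun x => 2 * posp (f x) * D x)).
      by move=> x; rewrite inE => /GmE.
    apply: measurable_funM; last exact: LD.1.
    apply: continuous_on_measurable_rV => // x _.
    by apply: contM; [exact: cont_cst|exact: cont_posp].
  by move=> x Ox; apply: le_trans (Gm_le x Ox); rewrite lerDr sqr_ge0.
have kap : intg ((fun x => posp (f x) ^+ 2) \_ Om) + intg (fun x => `|(Gm \_ Om) x|) < k0.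
  apply: le_lt_trans IB; rewrite -intgD//; last exact: L1_norm.
  apply: le_intg => //; first by apply: L1D => //; exact: L1_norm.
  move=> x; rewrite !patchE; case: ifPn => [|_]; last by rewrite normr0 addr0.
  by rewrite inE; exact: Gm_le.
(* Exceptional set: since [a * (u - F) >= 2 * c] near [x0], a point with [f <= c] has
   [|w k - F| >= c]. It is closed, hence measurable for the surface measure. *)
pose S : set V := boundary Om `&` [set y | `|y - x0| <= rho / 2] `&` [set y | f y <= c].
have cS : closed S.
  apply: closedI; first apply: closedI; first exact: closed_boundary.
    rewrite (_ : [set _ | _] = (fun x : V => `|x - x0|) @^-1` [set t' | t' <= rho / 2])//.
    apply: closed_comp; last exact: closed_le.
    move=> x _; apply: (@continuous_comp _ _ _ (fun x : V => x - x0) (fun x => `|x|)).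
      by apply: continuousB; [exact: cvg_id|exact: cst_continuous].
    exact: norm_continuous.
  rewrite (_ : [set _ | _] = f @^-1` [set t' | t' <= c])//.
  by apply: closed_comp; [move=> x _; exact: cf|exact: closed_le].
have rr : rho / 2 <= R1 by apply: le_trans rhoR; rewrite ler_pdivrMr// ler_pMr// ler1n.
have SH : (hausdorff d.-1 S < h0%:E)%E.
  have cheb : ((c `^ p)%:E * hausdorff d.-1 S <=
      \int[hausdorff_measure R d d.-1]_(x in boundary Om) (`|w k x - F x| `^ p)%:E)%E.
    apply: (@ge0_subset_integral_le _ _ _ (hausdorff_measure R d d.-1) (boundary Om) S).
    - exact: closed_hausdorff_measurable.
    - by move=> x [[]].
    - exact: powR_ge0.
    - by move=> x _; rewrite lee_fin powR_ge0.
    - move=> x [[Bx xr] fx]; rewrite lee_fin; apply: ge0_ler_powR => //; rewrite ?nnegrE ?(ltW c0)//.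
      have h1 := gap x Bx (le_trans xr rr).
      rewrite ww'; last by case: Bx.
      rewrite -[leRHS]mul1r -a1 -normrM; apply: le_trans (ler_norm _).
      have -> : a * (w' x - F x) = a * (u x - F x) - f x by rewrite /f; ring.
      rewrite lerBrDr (le_trans _ h1)// (_ : 2 * c = c + c); last by rewrite mulr_natl mulr2n.
      by rewrite lerD2l.
  have := le_lt_trans cheb hk1; rewrite EFinM lte_pmul2l//.
have [e1 e10 he1] := heine_compact (@compact_eucl_ball R d x0 (d%:R * rho)) (fun x _ => @cf x) (divr_gt0 c0 (ltr0n R 2)).
(* As [2 * e < e1], [f] loses less than [c / 2] between a boundary point and the points of the layer
   above it, so it stays above [c / 2] over the points outside [S]. The covering is taken at height
   [2 * e], where the layer ends; this accounts for the [8] in [A]. *)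
pose e := Num.min (rho / 8) (e1 / 4).
have e0 : 0 < e by rewrite lt_min !divr_gt0.
have e20 : 0 < 2 * e by rewrite mulr_gt0.
have e2e1 : 2 * e < e1.
  have he4 : e * 4 <= e1 by rewrite -ler_pdivlMr// ge_min lexx orbT.
  by apply: lt_le_trans he4; rewrite mulrC ltr_pM2l// ltr_nat.
have [W [mW SW Wle]] := layer_small i e20 SH.
have eb : 0 < e <= rho / 8 by rewrite e0/= ge_min lexx.
have foot z t : boundary Om z -> `|z - x0| <= rho / 2 -> `|t| <= 2 * e ->
    ~ W (z + t *: 'e_i) -> c1 <= posp (f (z + t *: 'e_i)) ^+ 2.
  move=> Bz zr te nW; have nS : ~ S z by move=> /SW/(_ te).
  have fz : c < f z by rewrite ltNge; apply/negP => fz; apply: nS.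
  have ft : `|f z - f (z + t *: 'e_i)| < c / 2.
    apply: he1 => /=.
      apply: le_trans (eucl_le_norm _) _; apply: ler_wpM2l => //; apply: le_trans zr _.
      by rewrite ler_pdivrMr// ler_pMr// ler1n.
    rewrite opprD addrA subrr add0r normrN norm_shift_delta.
    exact: le_lt_trans e2e1.
  have f2 : c / 2 <= f (z + t *: 'e_i).
    move: ft; rewrite ltr_norml => /andP[_ ft]; rewrite -(lerD2r (c / 2)) -splitr.
    by apply: ltW; apply: lt_trans fz _; rewrite -ltrBlDl.
  have c20 : 0 <= c / 2 by rewrite divr_ge0// ltW.
  rewrite posp_pos ?(le_trans c20)// /c1 ler_sqr ?nnegrE ?(le_trans c20)//.
have Wle' : (mu W <= (e * (A * h0))%:E)%E.
  apply: le_trans Wle _; rewrite lee_fin le_eqVlt; apply/orP; left; apply/eqP.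
  by rewrite /A; ring.
have := est (fun x => posp (f x) ^+ 2) Gm e W c1 (A * h0) dqg (fun x => sqr_ge0 _) Lg LGm
  eb mW (ltW c10) foot Wle'.
apply/negP; rewrite -ltNge.
have Ah : A * h0 = m0 / (2 * C) by rewrite /h0; field; rewrite !gt_eqF.
rewrite -addrA mulrDr Ah.
have -> : C * (c1 * (m0 / (2 * C))) = c1 * m0 / 2 by field; rewrite gt_eqF.
have h1 : C * (intg ((fun x => posp (f x) ^+ 2) \_ Om) + intg (fun x => `|(Gm \_ Om) x|)) <
    C * k0 by rewrite ltr_pM2l.
have Ck : C * k0 = c1 * m0 / 2 by rewrite /k0; field; rewrite gt_eqF.
rewrite Ck in h1; apply: lt_le_trans (_ : c1 * m0 / 2 + c1 * m0 / 2 <= _); first by rewrite ltrD2l.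
by rewrite -splitr.
Qed.

End trace.

(** Each term is a product of three derivatives, hence odd in [phi]; this exchanges sub- and
    superharmonic tests. *)
Lemma infinity_laplacianN (R : realType) (d : nat) (W : set 'rV[R]_d) phi x : open W -> W x ->
  is_Ck 2 W phi -> infinity_laplacian (fun y => - phi y) x = - infinity_laplacian phi x.
Proof.
move=> oW Wx hphi; rewrite /infinity_laplacian -sumrN; apply: eq_bigr => i _.
rewrite -sumrN; apply: eq_bigr => j _.
have h1 k := (is_CkS_elim hphi k).1; have h2 := (is_CkS_elim (is_CkS_elim hphi i).2 j).1 x Wx.
have hN k y : W y -> is_derive y (delta_mx 0 k) (fun y => - phi y) (- partial k phi y).
  by move=> Wy; exact: is_deriveN (h1 k y Wy).
have E k : partial k (fun y => - phi y) x = - partial k phi x by have [_ h] := hN k x Wx; exact: h.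
rewrite !E (partial2E oW Wx (hN i) (is_deriveN h2)).
by rewrite mulrN mulrNN.
Qed.

(** * Passage to the limit in [p_ j] and comparison with an arbitrary supersolution *)

Lemma uniform_cvg_near (R : realType) (T : choiceType) (K : set T) (f_ : nat -> T -> R) (f : T -> R) :
  {uniform K, f_ @ \oo --> f} ->
  forall e, 0 < e -> \forall j \near \oo, forall x, K x -> `|f_ j x - f x| < e.
Proof.
move=> hunif e e0.
suff : nbhs (f : {uniform` K -> R}) [set h | forall x, K x -> `|h x - f x| < e] by exact: hunif.
apply/uniform_nbhs; exists [set z : R * R | ball z.1 e z.2]; split.
  exact: (@entourage_ball R R (PosNum e0)).
by move=> h hh x Kx; rewrite distrC; exact: hh.
Qed.

Theorem theorem2p1 (R : realType) (d : nat) (hd : (0 < d)%N)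
    (Omega : set 'rV[R]_d) (hOmega : bounded_smooth_domain Omega)
    (F : 'rV[R]_d -> R) (hF : [lipschitz F x | x in boundary Omega])
    (Psi : 'rV[R]_d -> R) (hPsi : {within closure Omega, continuous Psi})
    (hPsiF : sup (Psi @` boundary Omega) < inf (F @` boundary Omega))
    (u : R -> 'rV[R]_d -> R)
    (hu : forall p : R, 1 < p -> p_minimizer Omega F Psi p (u p))
    (hucont : forall p : R, d%:R < p ->
       {within closure Omega, continuous (u p)})
    (p_ : nat -> R) (hp1 : forall j, 1 < p_ j)
    (hp : p_ j @[j --> \oo] --> +oo)
    (u_oo : 'rV[R]_d -> R)
    (hunif : {uniform closure Omega, (fun j => u (p_ j)) @ \oo --> u_oo})
    (hweak : forall q : R, 1 < q ->
       sobolev_weak_cvg Omega q (fun j => u (p_ j)) u_oo) :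
  obstacle_supersolutions Omega F Psi u_oo /\
  forall v, obstacle_supersolutions Omega F Psi v ->
    forall x, closure Omega x -> u_oo x <= v x.
Proof.
have [oOm _ _ bOm sOm] := hOmega; set K := closure Omega in hPsi hucont hunif *.
have cK : compact K := closure_bounded bOm.
have OmK x : Omega x -> K x by exact: subset_closure.
have pgt (a : R) : \forall j \near \oo, a < p_ j.
  by apply: (cvgryPgt _).1 => //; exact: num_real.
have cuoo0 : {within K, continuous u_oo}.
  apply: uniform_limit_continuous_subspace hunif.
  by apply: filterS (pgt d%:R) => j; exact: hucont.
(* All functions are replaced by extensions continuous on the whole space, which agree with them on
   the closure. *)
have [Psi' cPsi' PsiE] := tietze_compact cK hPsi.
have [uoo cuoo uooE] := tietze_compact cK cuoo0.
(* Continuity of [u (p_ j)] is known for [p_ j > d] only; for the finitely many other indices [0] is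
   a placeholder. *)
have /choice[uj huj] : forall j, exists g : 'rV[R]_d -> R, continuous g /\
    (d%:R < p_ j -> forall x, K x -> u (p_ j) x = g x).
  move=> j; have [dp|dp] := ltP d%:R (p_ j); last first.
    by exists (fun=> 0); split=> //; exact: cont_cst.
  by have [g cg gE] := tietze_compact cK (hucont _ dp); exists g.
have cuj j : continuous (uj j) := (huj j).1.
have ujE : \forall j \near \oo, forall x, K x -> u (p_ j) x = uj j x.
  by apply: filterS (pgt d%:R) => j; exact: (huj j).2.
have minj : \forall j \near \oo, p_minimizer Omega F Psi' (p_ j) (uj j).
  apply: filterS ujE => j h; apply: p_minimizer_ext (hu _ (hp1 j)).
    by move=> x /OmK; exact: h.
  by move=> x /OmK; exact: PsiE.
have unifK e : 0 < e -> \forall j \near \oo, forall x, K x -> `|uj j x - uoo x| < e.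
  move=> e0; near=> j => x Kx; have <- : u (p_ j) x = uj j x by move: x Kx; near: j.
  by rewrite -uooE//; move: x Kx; near: j; exact: uniform_cvg_near.
have unif e : 0 < e -> \forall j \near \oo, forall x, Omega x -> `|uj j x - uoo x| < e.
  by move=> /unifK; apply: filterS => j h x /OmK; exact: h.
have lim x : K x -> uj j x @[j --> \oo] --> uoo x.
  move=> Kx; apply/cvgrPdist_lt => e /unifK; apply: filterS => j h.
  by rewrite distrC; exact: h.
have uooPsi x : Omega x -> Psi' x <= uoo x.
  move=> Ox; apply: cvgr_to_ge (lim x (OmK x Ox)) _.
  apply: filterS minj => j [[_ _ ae] _].
  exact: (ae_le_continuous oOm (@cPsi') (@cuj j) ae Ox).
have uooF x : boundary Omega x -> uoo x = F x.
  move=> Bx; have Kx : K x by case: Bx.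
  have cF : uj j x @[j --> \oo] --> F x.
    (* At a boundary point the sequence is eventually constant: as soon as [p_ j >= 2], the trace
       condition gives the value [F x] exactly. *)
    apply: cvg_near_cst; near=> j.
    have p2 : 2 <= p_ j by apply: ltW; near: j.
    have [[_ tr _] _] : p_minimizer Omega F Psi' (p_ j) (uj j) by near: j.
    by apply: (trace_boundary oOm bOm p2 sOm (@cuj j) hF tr).
  exact: (cvg_unique _ (lim x Kx) cF).
have visc := viscosity_limit oOm bOm (@cPsi') hp (fun j => @cuj j) (@cuoo) minj unif.
split.
  split.
  - exact: cuoo0.
  - move=> x phi U oU UOm Ux Cphi [phix touch]; rewrite -oppr_le0 opprK.
    rewrite -[leLHS]mul1r; apply: (visc 1 U) => //.
    + by rewrite mulr1.
    + by rewrite phix uooE//; exact/OmK/UOm.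
    + by move=> y Uy; rewrite !mul1r -uooE ?touch//; exact/OmK/UOm.
    + by rewrite ltNge ler01.
  - by move=> x Ox; rewrite PsiE ?uooE ?uooPsi//; exact: OmK.
  - by move=> x Bx; rewrite uooE ?uooF//; case: Bx.
move=> v [cv supv vPsi vF] x Kx.
have [v' cv' vE] := tietze_compact cK cv.
(* Off contact the viscosity limit also holds with the sign [-1], so [uoo] is infinity subharmonic
   there. *)
pose U := [set y | Omega y /\ Psi' y < uoo y].
have oU : open U.
  have -> : U = Omega `&` ((fun y => uoo y - Psi' y) @^-1` [set t | 0 < t]).
    by apply/seteqP; split=> y /=; rewrite /U/= subr_gt0.
  apply: openI => //; apply: open_comp; last exact: open_gt.
  by move=> y _; exact: contB.
have UOm : U `<=` Omega by move=> y [].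
rewrite uooE// vE//.
apply: (cone_comparison (Ordinal hd) oOm bOm (@cuoo) (@cv') UOm) => //.
- apply: subharmonic_cone_above => //.
  move=> y phi W oW WU Wy Cphi phiy touch; rewrite -oppr_le0 -mulN1r.
  apply: (visc (-1) W) => //.
  + by rewrite mulrNN mulr1.
  + by move=> z /WU/UOm.
  + by move=> z Wz; rewrite !mulN1r lerN2 touch.
  + by move=> _; have [] := WU y Wy.
- apply: subharmonic_cone_above => //; first by move=> y; apply: continuousN; exact: cv'.
  move=> y phi W oW WO Wy Cphi phiy touch.
  rewrite -[leRHS]opprK -(infinity_laplacianN oW Wy Cphi).
  have CN : is_Ck 2 W (fun y => - phi y).
    have h := is_CkM oW (@is_Ck_cst R d 2 W (-1) oW) Cphi.
    by apply: (is_Ck_eq oW _ h) => z _ /=; rewrite mulN1r.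
  apply: (supv y (fun y => - phi y) W oW WO Wy CN); split.
    by rewrite phiy opprK vE//; exact/OmK/WO.
  by move=> z Wz; rewrite (vE z (OmK z (WO z Wz))) lerNl; exact: touch.
(* Outside [U] there are two cases: in contact, [uoo <= Psi <= v]; on the boundary, both functions
   equal [F]. *)
- move=> y Ky nUy; have [Oy|nOy] := pselect (Omega y).
    have h : uoo y <= Psi' y by rewrite leNgt; apply/negP => h; apply: nUy.
    by rewrite (le_trans h)// -PsiE// -vE// vPsi.
  have By : boundary Omega y by split=> // /interior_subset.
  by rewrite uooF// -vE// vF.
Unshelve. all: by end_near. Qed.
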